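(* Let $d\ge 1$, $\gamma>1$, $T^*\in(0,\infty]$, and let $(\varrho,\mathbf{u})\in C([0,T^* )\times\mathbb{R}^d)$ be an admissible solution (in the sense defined in the context) of the isentropic Euler system $$\partial_t\varrho+\mathrm{div}_x(\varrho\mathbf{u})=0,\qquad \partial_t(\varrho\mathbf{u})+\mathrm{div}_x(\varrho\mathbf{u}\otimes\mathbf{u})+\nabla_x(\varrho^\gamma)=0,\qquad x\in\mathbb{R}^d,\ t>0,$$ with initial data $(\varrho_0,\mathbf{u}_0)$. Assume that there are constants $\overline{\varrho}>0$ and $R>0$ such that $$(\varrho_0(x),\mathbf{u}_0(x))=(\overline{\varrho},\mathbf{0})\ \text{ for } |x|\ge R,\qquad \int_{\mathbb{R}^d}(\varrho_0-\overline{\varrho})\,dx\ge 0,$$ and $$\frac{1}{\omega_d R^{d+1}}\int_{\mathbb{R}^d}\varrho_0\mathbf{u}_0\cdot x\,dx\ \ge\ (d+1)\,\sigma\,\|\varrho_0\|_{L^\infty(\mathbb{R}^d)},\qquad \sigma:=\sqrt{\gamma}\,(\overline{\varrho})^{\frac{\gamma-1}{2}}.$$ Then $T^*$ is finite.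
   Context: Here $\varrho\ge 0$ is the density, $\mathbf{u}$ takes values in $\mathbb{R}^d$, the pressure is $p(\varrho)=\varrho^\gamma$ with $\gamma>1$, and $P(\varrho)=\frac{1}{\gamma-1}\varrho^\gamma$. The constant $\omega_d$ is the surface area of the unit sphere $\{x\in\mathbb{R}^d:|x|=1\}$. Weak solution: $(\varrho,\mathbf{u})\in C([0,T^* );L^1_{loc}(\mathbb{R}^d))\cap L^\infty([0,T^* )\times\mathbb{R}^d)$ is a weak solution of the isentropic Euler system if for all $0\le t_1<t_2<T^*$: (i) for all $\varphi\in C^1_c([t_1,t_2]\times\mathbb{R}^d)$, $$\left[\int_{\mathbb{R}^d}\varrho(t,\cdot)\varphi(t,\cdot)\,dx\right]_{t=t_1}^{t=t_2}=\int_{t_1}^{t_2}\int_{\mathbb{R}^d}\left[\varrho\,\partial_t\varphi+\varrho\mathbf{u}\cdot\nabla_x\varphi\right]dx\,dt;$$ (ii) for all $\psi\in C^1_c([t_1,t_2]\times\mathbb{R}^d;\mathbb{R}^d)$, $$\left[\int_{\mathbb{R}^d}\varrho\mathbf{u}(t,\cdot)\cdot\psi(t,\cdot)\,dx\right]_{t=t_1}^{t=t_2}=\int_{t_1}^{t_2}\int_{\mathbb{R}^d}\left[\varrho\mathbf{u}\cdot\partial_t\psi+\varrho\mathbf{u}\otimes\mathbf{u}:\nabla_x\psi+p(\varrho)\,\mathrm{div}_x\psi\right]dx\,dt.$$ Admissible solution: a weak solution with initial data $(\varrho_0,\mathbf{u}_0)=(\varrho,\mathbf{u})(0,\cdot)$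 such that for all $0\le\varphi\in C^1_c([0,T^* )\times\mathbb{R}^d)$, $$\int_0^{T^*}\!\!\int_{\mathbb{R}^d}\left[\left(\tfrac{\varrho|\mathbf{u}|^2}{2}+P(\varrho)\right)\partial_t\varphi+\left(\tfrac{\varrho|\mathbf{u}|^2}{2}+P(\varrho)+p(\varrho)\right)\mathbf{u}\cdot\nabla_x\varphi\right]dx\,dt+\int_{\mathbb{R}^d}\left(\tfrac{\varrho_0|\mathbf{u}_0|^2}{2}+P(\varrho_0)\right)\varphi(0,\cdot)\,dx\ge 0.$$ *)

(* Defs.v *)
From HB Require Import structures.
From mathcomp Require Import all_boot all_order all_algebra.
From mathcomp Require Import all_classical all_reals all_analysis.

Set Implicit Arguments.
Unset Strict Implicit.
Unset Printing Implicit Defensive.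

Import Order.TTheory GRing.Theory Num.Def Num.Theory.
Import numFieldNormedType.Exports.

Local Open Scope classical_set_scope.
Local Open Scope ring_scope.

(* The product sigma-algebra on row vectors; on 'rV[R]_n it is the Borel one. *)
Definition measure_rV_display : measure_display -> measure_display.
Proof. exact. Qed.

Section measurable_rV.
Context {d} {T : measurableType d} (n : nat).

Let coord : 'I_n -> 'rV[T]_n -> T := fun i x => x ord0 i.

Let rV_set0 : g_sigma_preimage coord set0.
Proof. exact: sigma_algebra0. Qed.

Let rV_setC A : g_sigma_preimage coord A -> g_sigma_preimage coord (~` A).
Proof. exact: sigma_algebraC. Qed.

Let rV_bigcup (F : _^nat) : (forall i, g_sigma_preimage coord (F i)) ->
  g_sigma_preimage coord (\bigcup_i (F i)).
Proof. exact: sigma_algebra_bigcup. Qed.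

HB.instance Definition _ := @isMeasurable.Build (measure_rV_display d)
  'rV[T]_n (g_sigma_preimage coord) rV_set0 rV_setC rV_bigcup.

Lemma measurable_coord_rV (i : 'I_n) :
  measurable_fun [set: 'rV[T]_n] (fun x : 'rV[T]_n => x ord0 i).
Proof.
move=> _ Y mY; rewrite setTI; apply: sub_sigma_algebra => /=.
rewrite -bigcup_seq/=; exists i => /=; first by rewrite mem_index_enum.
by exists Y => //; rewrite setTI.
Qed.

Lemma measurable_fun_rVP d1 (T1 : measurableType d1) (f : T1 -> 'rV[T]_n) :
  (forall i, measurable_fun [set: T1] (fun x => f x ord0 i)) ->
  measurable_fun [set: T1] f.
Proof.
move=> mf.
suff prefS : g_sigma_preimage (fun i => @coord i \o f) `<=` measurable.
  move=> _ A mA; apply: prefS; rewrite g_sigma_preimage_comp.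
  by exists A.
apply: smallest_sub; first exact: sigma_algebra_measurable.
rewrite -bigcup_seq; apply: bigcup_sub => i _ A [B mB <-].
exact: mf.
Qed.

End measurable_rV.

(* Lebesgue measure on 'rV[R]_n: transport of the n-fold product measure. *)
Section lebesgue_rV.
Context {R : realType}.

Definition rV_cons n (p : measurableTypeR R * 'rV[R]_n) : 'rV[R]_n.+1 :=
  \row_i oapp (p.2 ord0) p.1 (unlift ord0 i).

Definition rV_uncons n (v : 'rV[R]_n.+1) : measurableTypeR R * 'rV[R]_n :=
  (v ord0 ord0, \row_j v ord0 (lift ord0 j)).

Lemma rV_consK n : cancel (@rV_cons n) (@rV_uncons n).
Proof.
move=> [a v]; rewrite /rV_uncons /rV_cons mxE unlift_none; congr pair.
by apply/rowP => j; rewrite !mxE liftK.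
Qed.

Lemma measurable_rV_cons n : measurable_fun setT (@rV_cons n).
Proof.
apply: measurable_fun_rVP => i; case: (unliftP ord0 i) => [j|] ->.
  under eq_fun do rewrite mxE liftK/=.
  apply: (measurableT_comp (measurable_coord_rV j)); exact: measurable_snd.
under eq_fun do rewrite mxE unlift_none/=.
exact: measurable_fst.
Qed.

Lemma measurable_rV_uncons n : measurable_fun setT (@rV_uncons n).
Proof.
apply/measurable_fun_pairP; split; first exact: (measurable_coord_rV ord0).
apply: measurable_fun_rVP => i /=; under eq_fun do rewrite mxE.
exact: (measurable_coord_rV (lift ord0 i)).
Qed.

Section step.
Variables (n : nat) (mu : {sigma_finite_measure set 'rV[R]_n -> \bar R}).

Definition lebesgue_rV_step : set 'rV[R]_n.+1 -> \bar R :=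
  pushforward (@lebesgue_measure R \x mu)%E (@rV_cons n).

Let step0 : lebesgue_rV_step set0 = 0%E.
Proof. by rewrite /lebesgue_rV_step /pushforward preimage_set0 measure0. Qed.

Let step_ge0 A : (0 <= lebesgue_rV_step A)%E.
Proof. by rewrite /lebesgue_rV_step /pushforward measure_ge0. Qed.

Let step_sigma_additive : semi_sigma_additive lebesgue_rV_step.
Proof.
have mcons A : measurable A -> measurable (@rV_cons n @^-1` A).
  by move=> mA; rewrite -[X in measurable X]setTI; exact: measurable_rV_cons.
move=> F mF tF mUF; rewrite /lebesgue_rV_step /pushforward preimage_bigcup.
apply: measure_semi_sigma_additive => [k||]; first exact: mcons.
- apply/trivIsetP => /= i j _ _ ij; rewrite -preimage_setI.
  by move/trivIsetP : tF => /(_ _ _ _ _ ij) ->//; rewrite preimage_set0.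
- by rewrite -preimage_bigcup; exact: mcons.
Qed.

HB.instance Definition _ := isMeasure.Build _ _ _
  lebesgue_rV_step step0 step_ge0 step_sigma_additive.

Let step_sigma_finite : sigma_finite setT lebesgue_rV_step.
Proof.
have /sigma_finiteP[F [TF ndF Foo]] := sigma_finiteT (@lebesgue_measure R).
have /sigma_finiteP[G [TG ndG Goo]] := sigma_finiteT mu.
exists (fun k => @rV_uncons n @^-1` (F k `*` G k)).
  rewrite -preimage_bigcup -(preimage_setT (@rV_uncons n)); congr (_ @^-1` _).
  rewrite -setXTT TF TG predeqE => -[x y]; split.
    move=> [/= [i _ Fix] [j _ Gjy]]; exists (maxn i j) => //; split.
    - by move: x Fix; exact/subsetPset/ndF/leq_maxl.
    - by move: y Gjy; exact/subsetPset/ndG/leq_maxr.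
  by move=> [i _ []/= ? ?]; split; exists i.
move=> k; have [mFk Fk] := Foo k; have [mGk Gk] := Goo k; split.
  rewrite -[X in measurable X]setTI; apply: measurable_rV_uncons => //.
  exact: measurableX.
rewrite /lebesgue_rV_step /pushforward -comp_preimage.
rewrite (_ : _ \o _ = id) ?preimage_id; last exact/funext/rV_consK.
by rewrite product_measure1E// lte_mul_pinfty// ge0_fin_numE.
Qed.

HB.instance Definition _ := Measure_isSigmaFinite.Build _ _ _
  lebesgue_rV_step step_sigma_finite.

End step.

Fixpoint lebesgue_rV n : {sigma_finite_measure set 'rV[R]_n -> \bar R} :=
  match n with
  | 0 => [the {sigma_finite_measure set 'rV[R]_0 -> \bar R} of
           dirac (0 : 'rV[R]_0)]
  | k.+1 => [the {sigma_finite_measure set 'rV[R]_k.+1 -> \bar R} of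
              lebesgue_rV_step (lebesgue_rV k)]
  end.

Lemma lebesgue_rV_box n (A : 'I_n -> set (measurableTypeR R)) :
  (forall i, measurable (A i)) ->
  lebesgue_rV n [set x | forall i, A i (x ord0 i)] =
  (\prod_(i < n) lebesgue_measure (A i))%E.
Proof.
elim: n A => [|n ih] A mA.
  rewrite big_ord0 /= diracE mem_set//.
  by move=> [].
have mB : measurable [set x : 'rV[R]_n | forall i, A (lift ord0 i) (x ord0 i)].
  rewrite (_ : mkset _ = \bigcap_(i in setT)
      ((fun x : 'rV[R]_n => x ord0 i) @^-1` A (lift ord0 i))); last first.
    by apply/seteqP; split => [x Ax i _|x Ax i]; [exact: Ax|exact: (Ax i)].
  apply: fin_bigcap_measurable; first exact: finite_finset.
  move=> i _; rewrite -[X in measurable X]setTI.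
  by apply: (measurable_coord_rV i); [exact: measurableT|exact: mA].
rewrite big_ord_recl -ih//= /lebesgue_rV_step /pushforward -product_measure1E//.
congr (product_measure1 _ _ _); apply/seteqP; split => -[a v] /=.
  move=> Av; split; first by have := Av ord0; rewrite mxE unlift_none.
  by move=> i; have := Av (lift ord0 i); rewrite mxE liftK.
move=> [Aa Av] i; rewrite mxE.
by case: (unliftP ord0 i) => [j|] -> /=.
Qed.
End lebesgue_rV.

Section euclidean_space.
Context {R : realType} {d : nat}.
Implicit Types u v x : 'rV[R]_d.

Definition dotp u v : R := \sum_i u ord0 i * v ord0 i.

(* The norm [`|x|] of the library on row vectors is the sup norm. *)
Definition enorm x : R := Num.sqrt (dotp x x).

(* Area of a hypersurface of R^d as its Minkowski content: the limit of
   |{x : dist(x, A) < h}| / (2h) as h tends to 0+. *)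
Definition surface_area (A : set 'rV[R]_d) : \bar R :=
  lim ((lebesgue_rV d [set x | exists2 a, A a & (enorm (x - a) < h)%R]
        * ((2 * h)^-1)%:E)%E @[h --> 0^'+]).

End euclidean_space.

Definition omega (R : realType) (d : nat) : R :=
  fine (surface_area [set x : 'rV[R]_d | enorm x = 1]).

Section space_time.
Context {R : realType} {d : nat}.
Local Notation space := 'rV[R]_d.

Definition C1 (W : normedModType R) (phi : R * space -> W) : Prop :=
  (forall z, differentiable phi z) /\
  (forall v, continuous (fun z => 'd phi z v)).

(* C^1_c(D; W) for D = I x R^d, I an interval closed or half-open: its elements
   are represented as restrictions to D of C^1 functions on R x R^d, whose
   values outside D are irrelevant; the support is compact in D, but phi need
   not vanish at the endpoints belonging to I. *)
Definition test_function (D : set (R * space)) (W : normedModType R)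
    (phi : R * space -> W) : Prop :=
  C1 phi /\
  exists2 K, compact K /\ K `<=` D & forall z, D z -> ~ K z -> phi z = 0.

Definition dt (W : normedModType R) (phi : R * space -> W) t x : W :=
  'D_((1, 0) : R * space) phi (t, x).

Definition dx (W : normedModType R) (j : 'I_d) (phi : R * space -> W) t x : W :=
  'D_((0, delta_mx ord0 j) : R * space) phi (t, x).

Definition grad (phi : R * space -> R) t x : space := \row_j dx j phi t x.

Definition divx (psi : R * space -> space) t x : R :=
  \sum_j dx j psi t x ord0 j.

(* The contraction (u (x) u) : grad psi. *)
Definition tensor_grad (u : space) (psi : R * space -> space) t x : R :=
  \sum_i \sum_j u ord0 i * u ord0 j * dx j psi t x ord0 i.

(* [0, T) *)
Definition lifespan (T : \bar R) : set R := [set t | 0 <= t /\ (t%:E < T)%E].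

Definition continuous_L1loc (T : \bar R) (f : R -> space -> R) : Prop :=
  forall K : set space, compact K ->
    (forall t, lifespan T t -> (lebesgue_rV d).-integrable K (EFin \o f t)) /\
    (forall t0, lifespan T t0 ->
      (\int[lebesgue_rV d]_(x in K) `|f t x - f t0 x|%:E)%E
        @[t --> within (lifespan T) (nbhs t0)] --> 0%E).

Definition ess_bounded (T : \bar R) (f : R -> space -> R) : Prop :=
  let D := lifespan T `*` [set: space] in
  let F := fun z : measurableTypeR R * space => f z.1 z.2 in
  measurable_fun D F /\
  ('N[lebesgue_measure \x lebesgue_rV d]_+oo[(EFin \o F) \_ D] < +oo)%E.

End space_time.

Section euler.
Context {R : realType} {d : nat}.
Local Notation space := 'rV[R]_d.
Local Notation mu := (lebesgue_rV d).
Implicit Types (gamma : R) (T : \bar R).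

Definition pressure gamma (r : R) : R := r `^ gamma.

Definition potential gamma (r : R) : R := (gamma - 1)^-1 * r `^ gamma.

Definition energy gamma (r : R) (v : space) : R :=
  r * enorm v ^+ 2 / 2 + potential gamma r.

Record weak_solution gamma T
    (rho : R -> space -> R) (u : R -> space -> space) : Prop := WeakSolution {
  weak_density_ge0 : forall t, lifespan T t ->
    {ae mu, forall x, 0 <= rho t x} ;
  weak_density_L1loc : continuous_L1loc T rho ;
  weak_velocity_L1loc : forall i,
    continuous_L1loc T (fun t x => u t x ord0 i) ;
  weak_density_bounded : ess_bounded T rho ;
  weak_velocity_bounded : forall i, ess_bounded T (fun t x => u t x ord0 i) ;
  weak_mass : forall t1 t2, 0 <= t1 -> t1 < t2 -> (t2%:E < T)%E ->
    forall phi : R * space -> R, test_function (`[t1, t2] `*` setT) phi ->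
    \int[mu]_x (rho t2 x * phi (t2, x)) - \int[mu]_x (rho t1 x * phi (t1, x)) =
    \int[lebesgue_measure]_(t in `[t1, t2]) \int[mu]_x
      (rho t x * dt phi t x + rho t x * dotp (u t x) (grad phi t x)) ;
  weak_momentum : forall t1 t2, 0 <= t1 -> t1 < t2 -> (t2%:E < T)%E ->
    forall psi : R * space -> space, test_function (`[t1, t2] `*` setT) psi ->
    \int[mu]_x (rho t2 x * dotp (u t2 x) (psi (t2, x))) -
      \int[mu]_x (rho t1 x * dotp (u t1 x) (psi (t1, x))) =
    \int[lebesgue_measure]_(t in `[t1, t2]) \int[mu]_x
      (rho t x * dotp (u t x) (dt psi t x) +
       rho t x * tensor_grad (u t x) psi t x +
       pressure gamma (rho t x) * divx psi t x) }.

Record admissible_solution gamma T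
    (rho : R -> space -> R) (u : R -> space -> space)
    (rho0 : space -> R) (u0 : space -> space) : Prop := AdmissibleSolution {
  admissible_weak : weak_solution gamma T rho u ;
  admissible_density0 : rho0 = rho 0 ;
  admissible_velocity0 : u0 = u 0 ;
  admissible_energy : forall phi : R * space -> R,
    test_function (lifespan T `*` setT) phi ->
    (forall t x, lifespan T t -> 0 <= phi (t, x)) ->
    0 <= \int[lebesgue_measure]_(t in lifespan T) \int[mu]_x
           (energy gamma (rho t x) (u t x) * dt phi t x +
            (energy gamma (rho t x) (u t x) + pressure gamma (rho t x)) *
              dotp (u t x) (grad phi t x)) +
         \int[mu]_x (energy gamma (rho0 x) (u0 x) * phi (0, x)) }.

End euler.

(* Main.v *)
From HB Require Import structures.
Require Import Defs.
From mathcomp Require Import all_boot all_order all_algebra.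
From mathcomp Require Import all_classical all_reals all_analysis.
From mathcomp Require Import measurable_realfun ess_sup_inf ring lra.

(** A flow that exists for all times is shown to be impossible. Write p for the
pressure, B(t) = R + sigma t, V for the volume of the unit ball, M for the
essential supremum of the initial density, and eta for the relative energy
density: the energy density minus its first-order expansion at the background
state (rhobar, 0), as a function of density and momentum. Convexity gives
eta >= 0, with equality only at the background.

Finite speed of propagation: the state is the background state wherever
|x| > B(t). Subtracting multiples of the mass equation from the energy
inequality yields the inequality for eta ([relative_energy]), whose flux is
(eta + p - p(rhobar)) u. The sound speed sigma controls this flux only near the
background: |flux| <= k eta for every k > sigma when the state is close enough
to the background ([flux_local]). Now take a backward cone of slope k that
starts over the region where the initial state is constant, and the first time at
which the cone contains a state that is not close to the background. Until then
the flux bound holds in the cone, so testing with a function supported there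
makes eta vanish ([cone_lemma]); by continuity eta vanishes at that first time
too, so there is no such time ([finite_propagation]). The slope k is arbitrary
above sigma, hence the exact speed.

Growth: let F(t) be the integral of rho u.x. Testing the momentum equation with
x, cut off outside B(t), gives F' = Q + d Pi, with Q the integral of rho |u|^2 and
Pi that of p - p(rhobar) ([radial_momentum_balance]). Pi >= 0, because
p lies above its tangent and the excess mass is conserved and nonnegative. The mass
in the ball of radius B(t) is at most M V B(t)^d, so that the integral of
rho |u - l x|^2 being nonnegative yields Q >= 2 l F - l^2 M V B^(d+2) for every l
([kinetic_lower]). With l = k / B and k = (d+1) sigma this is a linear
differential inequality for F, in which k M V B^(d+1) attains equality. As
omega = d V ([omegaE]) and d >= 1, the hypothesis puts F(0) above it. Therefore
F >= k M V B^(d+1) for all times ([radial_growth]), and then Q >= k^2 M V B^d,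
which grows at least linearly.

Contradiction: Q is at most twice the integral of eta, and a weighted time
average of that integral is bounded by its initial value ([energy_average]).
This covers equality in the hypothesis in dimension one, where the differential
inequality by itself does not exclude F = k M V B^(d+1). *)

Set Implicit Arguments.
Unset Strict Implicit.
Unset Printing Implicit Defensive.

Import Order.TTheory GRing.Theory Num.Def Num.Theory.
Import numFieldNormedType.Exports.
Local Open Scope classical_set_scope.
Local Open Scope ring_scope.

(** * C1 functions of time and space through their partial derivatives *)

Lemma continuous_bigsum {R : realType} (T : topologicalType)
    (V : normedModType R) (I : Type) (s : seq I) (F : I -> T -> V) :
  (forall i, continuous (F i)) -> continuous (fun z => \sum_(i <- s) F i z).
Proof.
move=> cF; elim: s => [|i s ih].
  rewrite (_ : (fun z => _) = cst 0); first exact: cst_continuous.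
  by apply/funext => z; rewrite big_nil.
rewrite (_ : (fun z => _) = F i \+ (fun z => \sum_(j <- s) F j z)).
  by move=> z; apply: cvgD; [exact: cF|exact: ih].
by apply/funext => z; rewrite big_cons.
Qed.

Section continuous_arith.
Context {R : realType} (T : topologicalType).
Implicit Types f g : T -> R.

Lemma continuous_add f g : continuous f -> continuous g ->
  continuous (fun z => f z + g z).
Proof. by move=> cf cg z; apply: (@continuousD _ _ _ f g); [exact: cf|exact: cg]. Qed.

Lemma continuous_sub f g : continuous f -> continuous g ->
  continuous (fun z => f z - g z).
Proof. by move=> cf cg z; apply: (@continuousB _ _ _ f g); [exact: cf|exact: cg]. Qed.

Lemma continuous_mul f g : continuous f -> continuous g ->
  continuous (fun z => f z * g z).
Proof. by move=> cf cg z; apply: (@continuousM _ _ f g); [exact: cf|exact: cg]. Qed.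

Lemma continuous_expn f n : continuous f -> continuous (fun z => f z ^+ n).
Proof.
move=> cf; elim: n => [|n ih].
  by rewrite (_ : (fun z => _) = cst 1)//; exact: cst_continuous.
rewrite (_ : (fun z => _) = (fun z => f z * f z ^+ n)).
  exact: continuous_mul.
by apply/funext => z; rewrite exprS.
Qed.

End continuous_arith.

Section C1calc.
Context {R : realType} {d : nat}.
Local Notation space := 'rV[R]_d.
Implicit Types (f ft g gt : R * space -> R) (fx gx : 'I_d -> R * space -> R).

Definition total_diff (ft : R * space -> R) (fx : 'I_d -> R * space -> R)
  (z v : R * space) : R := v.1 * ft z + \sum_j v.2 ord0 j * fx j z.

(** Test functions enter the weak formulation only through their partial
derivatives. Carrying these along makes C1 a matter of closure rules, and turns [dt]
and [dx] of an explicit test function into explicit formulas. *)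
Record C1_with f ft fx : Prop := C1With {
  C1_is_diff : forall z, is_diff z f (total_diff ft fx z);
  C1_cont_t : continuous ft;
  C1_cont_x : forall j, continuous (fx j) }.

Lemma C1_with_ext f ft fx g gt gx : C1_with f ft fx -> f =1 g -> ft =1 gt ->
  (forall j, fx j =1 gx j) -> C1_with g gt gx.
Proof.
move=> + /funext <- /funext <- H; suff -> : fx = gx by [].
by apply/funext => j; apply/funext.
Qed.

Lemma C1_with_cont f ft fx : C1_with f ft fx -> continuous f.
Proof.
move=> [h _ _] z; have := h z => hz.
by apply: differentiable_continuous; apply: ex_diff.
Qed.

Lemma C1_with_cst c : C1_with (cst c) (cst 0) (fun=> cst 0).
Proof.
split=> [z||j]; try exact: cst_continuous.
apply: is_diff_eq; apply/funext => v; rewrite /total_diff /= mulr0 add0r.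
by rewrite big1// => j _; rewrite mulr0.
Qed.

Lemma C1_with_time : C1_with fst (cst 1) (fun=> cst 0).
Proof.
split=> [z||j]; try exact: cst_continuous.
have -> : total_diff (cst 1) (fun=> cst 0) z = fst.
  apply/funext => v; rewrite /total_diff /= mulr1.
  by rewrite big1 ?addr0// => j _; rewrite mulr0.
have cf : continuous (fst : R * space -> R) by move=> w; apply: cvg_fst.
by apply: DiffDef; [exact: linear_differentiable|exact: diff_lin].
Qed.

Lemma continuous_coord (j : 'I_d) :
  continuous (fun z : R * space => z.2 ord0 j).
Proof.
move=> z; apply: (@continuous_comp _ _ _ snd (fun M : space => M ord0 j)).
  exact: cvg_snd.
exact: coord_continuous.
Qed.

(** A named function is needed for the linear structure to be attached to it. *)
Definition space_coord (i : 'I_d) (v : R * space) : R := v.2 ord0 i.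

Lemma space_coord_linear i : linear (space_coord i).
Proof. by move=> k u v; rewrite /space_coord /= !mxE. Qed.

HB.instance Definition _ i := GRing.isLinear.Build R (R * space)%type R _
  (space_coord i) (space_coord_linear i).

Lemma C1_with_coord i :
  C1_with (fun z => z.2 ord0 i) (cst 0) (fun j => cst (i == j)%:R).
Proof.
split=> [z||j]; try exact: cst_continuous.
have -> : total_diff (cst 0) (fun j => cst (i == j)%:R) z = (fun v => v.2 ord0 i).
  apply/funext => v; rewrite /total_diff /= mulr0 add0r (bigD1 i)//= eqxx mulr1.
  by rewrite big1 ?addr0// => j /negPf; rewrite eq_sym => ->; rewrite mulr0.
have cf : continuous (space_coord i) by exact: continuous_coord.
change (is_diff z (space_coord i) (space_coord i)).
by apply: DiffDef; [exact: linear_differentiable|exact: diff_lin].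
Qed.

Lemma C1_with_add f ft fx g gt gx : C1_with f ft fx -> C1_with g gt gx ->
  C1_with (f \+ g) (ft \+ gt) (fun j => fx j \+ gx j).
Proof.
move=> [fd fct fcx] [gd gct gcx]; split => [z|z|j z].
- have Hf := fd z; have Hg := gd z.
  apply: (@is_diff_eq _ _ _ (f + g)); apply/funext => v; rewrite /total_diff /=.
  rewrite fctE mulrDr addrACA -big_split/=; congr (_ + _).
  by apply: eq_bigr => j _; rewrite mulrDr.
- by apply: cvgD; [exact: fct|exact: gct].
- by apply: cvgD; [exact: fcx|exact: gcx].
Qed.

Lemma C1_with_mul f ft fx g gt gx : C1_with f ft fx -> C1_with g gt gx ->
  C1_with (f \* g) (fun z => f z * gt z + g z * ft z)
    (fun j z => f z * gx j z + g z * fx j z).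
Proof.
move=> Cf Cg; move: (Cf) (Cg) => [fd fct fcx] [gd gct gcx]; split => [z|z|j z].
- have Hf := fd z; have Hg := gd z.
  apply: (@is_diff_eq _ _ _ (f * g)); apply/funext => v; rewrite /total_diff.
  rewrite !fctE !scalerDr addrACA !scaler_sumr -big_split/=; congr (_ + _).
    by rewrite /GRing.scale/=; ring.
  by apply: eq_bigr => j _; rewrite /GRing.scale/=; ring.
- by apply: cvgD; apply: cvgM; try exact: fct; try exact: gct;
    [exact: (C1_with_cont Cf)|exact: (C1_with_cont Cg)].
- by apply: cvgD; apply: cvgM; try exact: fcx; try exact: gcx;
    [exact: (C1_with_cont Cf)|exact: (C1_with_cont Cg)].
Qed.

Lemma C1_with_comp f ft fx (h h' : R -> R) : C1_with f ft fx ->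
  (forall s : R, is_derive s (1 : R) h (h' s)) -> continuous h' ->
  C1_with (h \o f) (fun z => h' (f z) * ft z) (fun j z => h' (f z) * fx j z).
Proof.
move=> Cf hd ch'; move: (Cf) => [fd fct fcx].
have ch'f : continuous (h' \o f).
  move=> z; apply: continuous_comp; [exact: (C1_with_cont Cf)|exact: ch'].
split => [z|z|j z].
- have Hf := fd z.
  have Hh : is_diff (f z) h ( *:%R ^~ (h' (f z))).
    have dh : differentiable h (f z) by apply/derivable1_diffP; apply: ex_derive.
    apply: DiffDef => //; rewrite diff1E// derive1E.
    by rewrite derive_val.
  apply: is_diff_eq; apply/funext => v; rewrite /total_diff/= /GRing.scale/=.
  rewrite mulrDl mulr_suml; congr (_ + _); first by ring.
  by apply: eq_bigr => j _; ring.
- by apply: cvgM; [exact: ch'f|exact: fct].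
- by apply: cvgM; [exact: ch'f|exact: fcx].
Qed.

Lemma C1_with_scale f ft fx (c : R) : C1_with f ft fx ->
  C1_with (fun z => c * f z) (fun z => c * ft z) (fun j z => c * fx j z).
Proof.
move=> Cf; apply: (C1_with_ext (C1_with_mul (C1_with_cst c) Cf)) => // [z|j z] /=;
by rewrite mulr0 addr0.
Qed.

Lemma C1_with_sum (n : nat) (F : 'I_n -> R * space -> R) Ft Fx :
  (forall i, C1_with (F i) (Ft i) (Fx i)) ->
  C1_with (fun z => \sum_i F i z) (fun z => \sum_i Ft i z)
    (fun j z => \sum_i Fx i j z).
Proof.
elim: n F Ft Fx => [|n ih] F Ft Fx Cf.
  by apply: (C1_with_ext (C1_with_cst 0)) => [z|z|j z] /=; rewrite big_ord0.
have := C1_with_add (Cf ord0) (ih _ _ _ (fun i => Cf (lift ord0 i))).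
by move/C1_with_ext; apply => [z|z|j z] /=; rewrite big_ord_recl.
Qed.

Lemma C1_with_C1 f ft fx : C1_with f ft fx -> C1 f.
Proof.
move=> [fd fct fcx]; split => [z|v].
  by have Hf := fd z; apply: ex_diff.
have -> : (fun z => 'd f z v) = (fun z => total_diff ft fx z v).
  by apply/funext => z; have Hf := fd z; rewrite diff_val.
move=> z; apply: cvgD.
  by apply: cvgM; [exact: cvg_cst|exact: fct].
apply: continuous_bigsum => j {}z.
by apply: cvgM; [exact: cvg_cst|exact: fcx].
Qed.

Lemma C1_with_dt f ft fx : C1_with f ft fx -> forall t x, dt f t x = ft (t, x).
Proof.
move=> [fd _ _] t x; have Hf := fd (t, x).
rewrite /dt deriveE; last exact: ex_diff.
rewrite diff_val /total_diff /= mul1r big1 ?addr0// => j _.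
by rewrite mxE mul0r.
Qed.

Lemma C1_with_dx f ft fx j : C1_with f ft fx -> forall t x, dx j f t x = fx j (t, x).
Proof.
move=> [fd _ _] t x; have Hf := fd (t, x).
rewrite /dx deriveE; last exact: ex_diff.
rewrite diff_val /total_diff /= mul0r add0r (bigD1 j)//= mxE !eqxx mul1r.
rewrite big1 ?addr0// => i /negPf ij.
by rewrite mxE ij mul0r.
Qed.

(** Vector test functions are built from scalar ones times basis vectors, so that the
scalar closure rules suffice. *)
Definition vect_of (F : 'I_d -> R * space -> R) : R * space -> space :=
  fun z => \sum_i F i z *: delta_mx ord0 i.

Lemma vect_ofE F z i : vect_of F z ord0 i = F i z.
Proof.
rewrite /vect_of summxE (bigD1 i)//= !mxE !eqxx mulr1.
by rewrite big1 ?addr0// => j /negPf ij; rewrite !mxE eq_sym ij andbF mulr0.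
Qed.

Lemma vect_of_is_diff (F : 'I_d -> R * space -> R) Ft Fx :
  (forall i, C1_with (F i) (Ft i) (Fx i)) -> forall z,
  is_diff z (vect_of F) (fun v => vect_of (fun i => total_diff (Ft i) (Fx i) ^~ v) z).
Proof.
move=> Cf z; rewrite /vect_of.
elim: (index_enum _) => [|i s ih].
  have -> : (fun z0 => \sum_(i <- [::]) F i z0 *: delta_mx ord0 i) = cst (0 : space).
    by apply/funext => y; rewrite big_nil.
  by apply: is_diff_eq; apply/funext => y /=; rewrite big_nil.
have -> : (fun z0 => \sum_(j <- i :: s) F j z0 *: delta_mx ord0 j) =
    (( *:%R ^~ (delta_mx ord0 i)) \o F i) + (fun z0 => \sum_(j <- s) F j z0 *: delta_mx ord0 j) :> (_ -> space).
  by apply/funext => y; rewrite big_cons.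
have Hi := C1_is_diff (Cf i) z.
have H := is_diff_comp Hi (is_diff_scalel (F i z) (delta_mx ord0 i : space)).
apply: (is_diff_eq (is_diffD H ih)); apply/funext => y /=.
by rewrite big_cons.
Qed.

Lemma vect_of_C1 (F : 'I_d -> R * space -> R) Ft Fx :
  (forall i, C1_with (F i) (Ft i) (Fx i)) -> C1 (vect_of F).
Proof.
move=> Cf; have fd := vect_of_is_diff Cf.
split => [z|v]; first by have Hf := fd z; apply: ex_diff.
have -> : (fun z => 'd (vect_of F) z v) =
    (fun z => \sum_i total_diff (Ft i) (Fx i) z v *: delta_mx ord0 i).
  by apply/funext => z; have Hf := fd z; rewrite diff_val.
move=> z; apply: continuous_bigsum => i {}z.
apply: cvgZr_tmp => /=.
have [_ fct fcx] := Cf i.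
apply: cvgD.
  by apply: cvgM; [exact: cvg_cst|exact: fct].
apply: continuous_bigsum => j {}z.
by apply: cvgM; [exact: cvg_cst|exact: fcx].
Qed.

Lemma vect_of_dt (F : 'I_d -> R * space -> R) Ft Fx :
  (forall i, C1_with (F i) (Ft i) (Fx i)) ->
  forall t x i, dt (vect_of F) t x ord0 i = Ft i (t, x).
Proof.
move=> Cf t x i; have Hf := vect_of_is_diff Cf (t, x).
rewrite /dt deriveE; last exact: ex_diff.
rewrite diff_val vect_ofE /total_diff /= mul1r big1 ?addr0// => j _.
by rewrite mxE mul0r.
Qed.

Lemma vect_of_dx (F : 'I_d -> R * space -> R) Ft Fx :
  (forall i, C1_with (F i) (Ft i) (Fx i)) ->
  forall j t x i, dx j (vect_of F) t x ord0 i = Fx i j (t, x).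
Proof.
move=> Cf j t x i; have Hf := vect_of_is_diff Cf (t, x).
rewrite /dx deriveE; last exact: ex_diff.
rewrite diff_val vect_ofE /total_diff /= mul0r add0r (bigD1 j)//= mxE !eqxx mul1r.
rewrite big1 ?addr0// => k /negPf ij.
by rewrite mxE ij mul0r.
Qed.

End C1calc.

(** * The Euclidean norm and the Borel sets of row vectors *)

Section euclid.
Context {R : realType} {d : nat}.
Implicit Types (x y : 'rV[R]_d).

Lemma dotpC x y : dotp x y = dotp y x.
Proof. by apply: eq_bigr => i _; rewrite mulrC. Qed.

Lemma dotpDr x y z : dotp x (y + z) = dotp x y + dotp x z.
Proof. by rewrite /dotp -big_split; apply: eq_bigr => i _; rewrite mxE mulrDr. Qed.

Lemma dotpZr (a : R) x y : dotp x (a *: y) = a * dotp x y.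
Proof. by rewrite /dotp mulr_sumr; apply: eq_bigr => i _; rewrite mxE mulrCA. Qed.

Lemma dotpDl x y z : dotp (x + y) z = dotp x z + dotp y z.
Proof. by rewrite dotpC dotpDr !(dotpC z). Qed.

Lemma dotpZl (a : R) x y : dotp (a *: x) y = a * dotp x y.
Proof. by rewrite dotpC dotpZr dotpC. Qed.

Lemma dotp0l x : dotp 0 x = 0.
Proof. by rewrite -(scale0r (0 : 'rV[R]_d)) dotpZl mul0r. Qed.

Lemma dotp0r x : dotp x 0 = 0.
Proof. by rewrite dotpC dotp0l. Qed.

Lemma dotp_ge0 x : 0 <= dotp x x.
Proof. by apply: sumr_ge0 => i _; rewrite -expr2 sqr_ge0. Qed.

Lemma enorm_ge0 x : 0 <= enorm x.
Proof. exact: sqrtr_ge0. Qed.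

Lemma sqr_enorm x : enorm x ^+ 2 = dotp x x.
Proof. by rewrite sqr_sqrtr ?dotp_ge0. Qed.

Lemma enorm0 : enorm (0 : 'rV[R]_d) = 0.
Proof. by rewrite /enorm dotp0l sqrtr0. Qed.

Lemma sqr_coord_le_dotp x i : x ord0 i ^+ 2 <= dotp x x.
Proof.
rewrite /dotp (bigD1 i)//= -expr2 lerDl.
by apply: sumr_ge0 => j _; rewrite -expr2 sqr_ge0.
Qed.

Lemma coord_le_enorm x i : `|x ord0 i| <= enorm x.
Proof.
rewrite -(@ler_pXn2r _ 2)// ?nnegrE ?enorm_ge0// sqr_enorm.
by rewrite real_normK ?num_real// sqr_coord_le_dotp.
Qed.

Lemma enorm_eq0 x : enorm x = 0 -> x = 0.
Proof.
move=> x0; apply/rowP => i; rewrite mxE.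
by apply/eqP; rewrite -normr_le0 -x0 coord_le_enorm.
Qed.

Lemma enormZ (a : R) x : enorm (a *: x) = `|a| * enorm x.
Proof.
by rewrite /enorm dotpZl dotpZr mulrA -expr2 sqrtrM ?sqr_ge0// sqrtr_sqr.
Qed.

Lemma dotp_le_enorm x y : dotp x y <= enorm x * enorm y.
Proof.
have [x0|/eqP x0] := eqVneq (enorm x) 0.
  by rewrite x0 mul0r (enorm_eq0 x0) dotp0l.
have [y0|/eqP y0] := eqVneq (enorm y) 0.
  by rewrite y0 mulr0 (enorm_eq0 y0) dotp0r.
have px : 0 < enorm x by rewrite lt_neqAle enorm_ge0 andbT eq_sym; apply/eqP.
have py : 0 < enorm y by rewrite lt_neqAle enorm_ge0 andbT eq_sym; apply/eqP.
have := dotp_ge0 (enorm y *: x + (- enorm x) *: y).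
rewrite !(dotpDl, dotpDr, dotpZl, dotpZr) -!sqr_enorm (dotpC y x) => H.
rewrite -(ler_pM2l (mulr_gt0 px py)); nra.
Qed.

Lemma enormD x y : enorm (x + y) <= enorm x + enorm y.
Proof.
rewrite -(@ler_pXn2r _ 2)// ?nnegrE ?addr_ge0 ?enorm_ge0//.
rewrite sqr_enorm !(dotpDl, dotpDr) -!sqr_enorm (dotpC y x).
by have := dotp_le_enorm x y; nra.
Qed.

Lemma enormN x : enorm (- x) = enorm x.
Proof. by rewrite -scaleN1r enormZ normrN1 mul1r. Qed.

Lemma enorm_distr x y : enorm x - enorm y <= enorm (x - y).
Proof. by have := enormD (x - y) y; rewrite subrK lerBlDr. Qed.

Lemma continuous_coord_rV (i : 'I_d) : continuous (fun x : 'rV[R]_d => x ord0 i).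
Proof. by move=> x; exact: coord_continuous. Qed.

End euclid.

Section rV_topology.
Context {R : realType}.

(** The sigma-algebra on row vectors is generated by the coordinates. An open set is a
countable union of the boxes with rational centers and radii 1/(k+1) that it
contains, and such boxes are finite intersections of coordinate preimages. *)
Lemma open_measurable_rV n (U : set 'rV[R]_n) : open U ->
  @measurable _ 'rV[R]_n U.
Proof.
move=> oU.
pose box (p : 'rV[rat]_n * nat) : set 'rV[R]_n :=
  [set x | forall i, `|x ord0 i - ratr (p.1 ord0 i)| < p.2.+1%:R^-1].
have mbox p : @measurable _ 'rV[R]_n (box p).
  rewrite (_ : box p = \bigcap_(i in setT)
      ((fun x : 'rV[R]_n => x ord0 i) @^-1`
        [set y | `|y - ratr (p.1 ord0 i)| < p.2.+1%:R^-1])); last first.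
    by apply/seteqP; split => [x h i _|x h i]; [exact: h|exact: (h i)].
  apply: fin_bigcap_measurable; first exact: finite_finset.
  move=> i _; rewrite -[X in measurable X]setTI.
  apply: (@measurable_coord_rV _ R) => //.
  rewrite (_ : mkset _ = ball (ratr (p.1 ord0 i) : R) (p.2.+1%:R^-1)).
    by apply: open_measurable; apply: ball_open; rewrite invr_gt0.
  by apply/seteqP; split => y /=; rewrite /ball/= distrC.
have -> : U = \bigcup_p (if `[< box p `<=` U >] then box p else set0).
  apply/seteqP; split => [x Ux|x [p _]]; last first.
    by case: asboolP => // h; apply: h.
  have /nbhs_ballP[e /= e0 xeU] := open_nbhs_nbhs (conj oU Ux).
  have [k ke] : exists k : nat, k.+1%:R^-1 < e / 2.
    have e2 : 0 < e / 2 by rewrite divr_gt0.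
    exists (truncn (e / 2)^-1).
    by rewrite invf_plt ?posrE// truncnS_gt.
  have k0 : 0 < k.+1%:R^-1 :> R by rewrite invr_gt0.
  have /choice[q qP] : forall i, exists q, `|x ord0 i - ratr q| < k.+1%:R^-1.
    move=> i.
    have [|q] := @rat_in_itvoo R (x ord0 i - k.+1%:R^-1) (x ord0 i + k.+1%:R^-1).
      by rewrite ltrBlDr -addrA ltrDl addr_gt0.
    rewrite in_itv/= => /andP[]; move: (_^-1) => c ? ?; exists q.
    by rewrite ltr_norml; lra.
  exists (\row_i q i, k) => //.
  case: asboolP => [_|]; first by move=> i; rewrite /= mxE.
  case=> y By; apply: xeU; split => // i j; rewrite ord1.
  have := By j; have := qP j; rewrite /= mxE /ball/=.
  move: (_^-1) ke => c ke h1 h2.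
  rewrite (_ : x ord0 j - y ord0 j = (x ord0 j - ratr (q j)) - (y ord0 j - ratr (q j))); last by ring.
  rewrite (le_lt_trans (ler_normB _ _))//; lra.
apply: countable_bigcupT_measurable; first exact: countableP.
by move=> p; case: asboolP.
Qed.

Lemma continuous_measurable_rV n (f : 'rV[R]_n -> R) : continuous f ->
  measurable_fun [set: 'rV[R]_n] f.
Proof.
move=> cf; apply: (measurability _ (RGenOpens.measurableE R)).
move=> _ [_ [a [b ->] <-]]; rewrite setTI; apply: open_measurable_rV.
by apply: open_comp; [move=> x _; exact: cf|exact: interval_open].
Qed.

End rV_topology.

(** * Integrals of continuous compactly supported functions *)

Section integration.
Context {R : realType} {d : nat}.
Local Notation space := 'rV[R]_d.
Local Notation mu := (@lebesgue_rV R d).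
Implicit Types (f g : space -> R) (A : R).

Definition cube (c : space) A : set space :=
  [set x | forall i, `[c ord0 i - A, c ord0 i + A]%classic (x ord0 i)].

Lemma measurable_cube c A : @measurable _ 'rV[R]_d (cube c A).
Proof.
rewrite (_ : cube c A = \bigcap_(i in setT)
    ((fun x : 'rV[R]_d => x ord0 i) @^-1`
      `[c ord0 i - A, c ord0 i + A]%classic)); last first.
  by apply/seteqP; split => [x h i _|x h i]; [exact: h|exact: (h i)].
apply: fin_bigcap_measurable; first exact: finite_finset.
move=> i _; rewrite -[X in measurable X]setTI.
by apply: (@measurable_coord_rV _ R) => //; exact: measurable_itv.
Qed.

Lemma lebesgue_cube c A : 0 < A -> mu (cube c A) = ((2 * A) ^+ d)%:E.
Proof.
move=> A0.
rewrite (@lebesgue_rV_box R d (fun i => `[c ord0 i - A, c ord0 i + A]%classic)); last first.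
  by move=> i; exact: measurable_itv.
rewrite (eq_bigr (fun=> (2 * A)%:E)).
  by rewrite prodEFin prodr_const card_ord.
move=> i _; rewrite lebesgue_measure_itv/= lte_fin ltrD2l gtrN//.
by rewrite -EFinD; congr (_%:E); ring.
Qed.

Lemma compact_cube c A : compact (cube c A).
Proof.
by apply: (@rV_compact _ _ (fun i => `[c ord0 i - A, c ord0 i + A]%classic));
  move=> i; exact: segment_compact.
Qed.

(** Supports are measured with the Euclidean norm, unlike the sup norm that defines the
topology. *)
Definition supp_in A f := forall x, A < enorm x -> f x = 0.

Lemma supp_in_cube A f : supp_in A f -> forall x, ~ cube 0 A x -> f x = 0.
Proof.
move=> sf x ncx; apply: sf; rewrite ltNge; apply: contra_notN ncx => xA i.
rewrite /= in_itv/= mxE -ler_distl subr0.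
exact: le_trans (coord_le_enorm x i) xA.
Qed.

Lemma supp_in_cubeE A f : supp_in A f -> f \_ (cube 0 A) = f.
Proof.
move=> sf; apply/funext => x; rewrite patchE; case: ifPn => //.
by move=> /negP xc; rewrite (supp_in_cube sf)// => cx; apply: xc; rewrite inE.
Qed.

Lemma supp_in_le A B f : A <= B -> supp_in A f -> supp_in B f.
Proof. by move=> AB sf x Bx; apply: sf; exact: le_lt_trans Bx. Qed.

Lemma lebesgue_cube_lty c A : (mu (cube c A) < +oo)%E.
Proof.
have [A0|A0] := ltP 0 A; first by rewrite lebesgue_cube// ltry.
apply: (@le_lt_trans _ _ (mu (cube c 1))); last by rewrite lebesgue_cube// ltry.
apply: le_measure; rewrite ?inE; try exact: measurable_cube.
move=> x cx i; have := cx i; rewrite /= !in_itv/= => /andP[h1 h2]; lra.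
Qed.

Lemma integrable_restrict_cube f A (M : R) :
  measurable_fun [set: 'rV[R]_d] f ->
  (forall x, cube 0 A x -> `|f x| <= M) ->
  mu.-integrable setT (EFin \o (f \_ (cube 0 A))).
Proof.
move=> mf fM; rewrite -restrict_EFin.
apply: (iffLR (integrable_mkcond (EFin \o f) (measurable_cube 0 A))).
apply: measurable_bounded_integrable => //.
- exact: measurable_cube.
- exact: lebesgue_cube_lty.
- exact: measurable_funTS.
- exists M; split; rewrite ?num_real // => x Mx y cy.
  by apply: le_trans (ltW Mx); exact: fM.
Qed.

Lemma integrable_supp f A : continuous f -> supp_in A f ->
  mu.-integrable setT (EFin \o f).
Proof.
move=> cf sf; rewrite -(supp_in_cubeE sf).
have /compact_bounded[M [_ mrt]] :=
  continuous_compact (continuous_subspaceT cf) (@compact_cube 0 A).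
apply: (@integrable_restrict_cube _ _ (M + 1)).
  exact: continuous_measurable_rV.
by move=> x cx; apply: (mrt (M + 1)); [rewrite ltrDl|exists x].
Qed.

(** A nonempty open set contains a cube, which has positive measure. *)
Lemma open_negligible_eq0 (U : set space) : open U -> mu.-negligible U -> U = set0.
Proof.
move=> oU nU; apply/eqP/negP => /negP/set0P[x Ux].
have /nbhs_ballP[e /= e0 xeU] := open_nbhs_nbhs (conj oU Ux).
have e2 : 0 < e / 2 by rewrite divr_gt0.
have cU : cube x (e / 2) `<=` U.
  move=> y cy; apply: xeU; split=> // i j; rewrite ord1 /ball/=.
  have := cy j; rewrite /= in_itv/= -ler_distl distrC => h.
  by rewrite (le_lt_trans h)//; lra.
have := negligibleS cU nU.
move=> /(negligibleP mu (measurable_cube x (e / 2))) h.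
have := lebesgue_cube x e2; rewrite h.
by move=> [/esym/eqP]; rewrite expf_eq0 => /andP[_ /eqP]; lra.
Qed.

(** Turns the almost everywhere information on continuous solutions into pointwise
information. *)
Lemma ae_ge0_continuous f : continuous f -> {ae mu, forall x, 0 <= f x} ->
  forall x, 0 <= f x.
Proof.
move=> cf aef x; rewrite leNgt; apply/negP => fx0.
suff H : [set y | f y < 0] = set0.
  by have : [set y | f y < 0] x by []; rewrite H.
apply: open_negligible_eq0.
  rewrite (_ : mkset _ = f @^-1` [set y | y < 0])//.
  by apply: open_comp; [move=> y _; exact: cf|exact: open_lt].
by apply: negligibleS aef => y /= fy; apply/negP; rewrite -ltNge.
Qed.

Lemma Rintegral_eq0_continuous f A : continuous f -> supp_in A f ->
  (forall x, 0 <= f x) -> \int[mu]_x f x <= 0 -> forall x, f x = 0.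
Proof.
move=> cf sf f0 if0 x; apply/eqP; rewrite eq_le f0 andbT -oppr_ge0.
have cNf : continuous (\- f) by move=> y; apply: continuousN; exact: cf.
move: x; apply: (ae_ge0_continuous cNf).
have intf := integrable_supp cf sf.
have : (\int[mu]_x `|(EFin \o f) x| = 0)%E.
  rewrite (eq_integral (EFin \o f)); last first.
    by move=> x _ /=; rewrite ger0_norm.
  have fi : (\int[mu]_x (EFin \o f) x)%E \is a fin_num by exact: integrable_fin_num.
  rewrite -(fineK fi); congr (_%:E); apply/eqP; rewrite eq_le if0/=.
  by apply: Rintegral_ge0 => x _; exact: f0.
have mf : measurable_fun setT (EFin \o f) by exact: measurable_int intf.
move/(ae_eq_integral_abs mu measurableT mf); apply: filterS => x /= /(_ I).
by move=> [->]; rewrite oppr0.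
Qed.

Lemma slab_bounded (g : R -> space -> R) (a b : R) A :
  continuous (fun z : R * space => g z.1 z.2) ->
  exists M : R, forall t x, `[a, b]%classic t -> cube 0 A x -> `|g t x| <= M.
Proof.
move=> cg.
have cK : compact (`[a, b]%classic `*` cube 0 A).
  by apply: compact_setX; [exact: segment_compact|exact: compact_cube].
have /compact_bounded[M [_ mrt]] := continuous_compact (continuous_subspaceT cg) cK.
exists (M + 1) => t x tab xA; apply: (mrt (M + 1)); first by rewrite ltrDl.
by exists (t, x).
Qed.

Lemma continuous_pairing (T U V : topologicalType) (f : T -> U) (g : T -> V) :
  continuous f -> continuous g -> continuous (fun x => (f x, g x)).
Proof. by move=> cf cg x; exact: (cvg_pair (cf x) (cg x)). Qed.

Lemma continuous_section (g : R -> space -> R) t :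
  continuous (fun z : R * space => g z.1 z.2) -> continuous (g t).
Proof.
move=> cg x; apply: (@continuous_comp _ _ _ (fun x => (t, x)) (fun z : R * space => g z.1 z.2)).
  by apply: continuous_pairing; [exact: cst_continuous|move=> y; apply: cvg_id].
exact: cg.
Qed.

Lemma continuous_section1 (g : R -> space -> R) x :
  continuous (fun z : R * space => g z.1 z.2) -> continuous (g ^~ x).
Proof.
move=> cg t; apply: (@continuous_comp _ _ _ (fun t => (t, x)) (fun z : R * space => g z.1 z.2)).
  by apply: continuous_pairing; [move=> y; apply: cvg_id|exact: cst_continuous].
exact: cg.
Qed.

(** The constant dominating function on a cube that continuity and differentiation
under the integral sign ask for. *)
Lemma slab_dominated (g : R -> space -> R) (a b : R) A :
  continuous (fun z : R * space => g z.1 z.2) ->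
  (forall t, a < t < b -> supp_in A (g t)) ->
  exists G : space -> R, [/\ forall x, 0 <= G x, mu.-integrable setT (EFin \o G) &
     forall t x, a < t < b -> `|g t x| <= G x].
Proof.
move=> cg sg; have [M gM] := slab_bounded a b A cg.
exists (cst (Num.max M 0) \_ (cube 0 A)); split.
- by move=> x; rewrite patchE; case: ifP => // _; rewrite le_max lexx orbT.
- apply: (@integrable_restrict_cube _ _ (Num.max M 0)).
    exact: measurable_cst.
  by move=> x _; rewrite /= ger0_norm// le_max lexx orbT.
- move=> t x tab; rewrite patchE; case: ifPn => [|/negP nx].
    rewrite inE => xA; rewrite le_max gM//= in_itv/=.
    by case/andP: tab => /ltW -> /ltW ->.
  rewrite (supp_in_cube (sg _ tab)) ?normr0// => cx.
  by apply: nx; rewrite inE.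
Qed.

Lemma continuous_Rintegral (g : R -> space -> R) (a b : R) A :
  continuous (fun z : R * space => g z.1 z.2) ->
  (forall t, a < t < b -> supp_in A (g t)) ->
  forall t, a < t < b -> {for t, continuous (fun s => \int[mu]_x g s x)}.
Proof.
move=> cg sg t tab; have [G [G0 iG gG]] := slab_dominated cg sg.
have tI : t \in `]a, b[%classic by rewrite inE /= in_itv.
apply: (@continuity_under_integral _ _ _ _ _ _ measurableT a b _ _ G) => //.
- move=> s; rewrite /= in_itv/= => sab; apply: integrable_supp (sg _ sab).
  exact: continuous_section.
- by apply: aeW => x _ s _; exact: continuous_section1.
- by move=> s; rewrite /= in_itv/= => sab; apply: aeW => x _; exact: gG.
Qed.

Lemma is_derive_Rintegral (g g' : R -> space -> R) (a b : R) A :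
  continuous (fun z : R * space => g z.1 z.2) ->
  continuous (fun z : R * space => g' z.1 z.2) ->
  (forall (t : R) x, a < t < b -> is_derive t (1 : R) (g ^~ x) (g' t x)) ->
  (forall t, a < t < b -> supp_in A (g t)) ->
  (forall t, a < t < b -> supp_in A (g' t)) ->
  forall t, a < t < b ->
    is_derive t (1 : R) (fun s => \int[mu]_x g s x) (\int[mu]_x g' t x).
Proof.
move=> cg cg' dg sg sg' t tab; have [G [G0 iG gG]] := slab_dominated cg' sg'.
have tI : `]a, b[%classic t by rewrite /= in_itv.
have d1E s x : a < s < b -> partial1of2 g s x = g' s x.
  by move=> sab; rewrite partial1of2E; have := dg s x sab => H; rewrite derive_val.
have H1 s : `]a, b[%classic s -> mu.-integrable setT (EFin \o g s).
  rewrite /= in_itv/= => sab; apply: integrable_supp (sg _ sab).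
  exact: continuous_section.
have H2 s x : `]a, b[%classic s -> setT x -> derivable (g ^~ x) s 1.
  by rewrite /= in_itv/= => sab _; have H := dg s x sab; exact: ex_derive.
have H3 s x : `]a, b[%classic s -> setT x -> `|partial1of2 g s x| <= G x.
  by rewrite /= in_itv/= => sab _; rewrite d1E// gG.
apply: DeriveDef.
  exact: (derivable_under_integral measurableT tI H1 H2 G0 iG H3).
rewrite -derive1E.
rewrite (differentiation_under_integral measurableT tI H1 H2 G0 iG H3).
by apply: eq_Rintegral => x _; rewrite d1E.
Qed.

End integration.

(** * Dilations, volumes of balls, area of the sphere *)

Section scaling.
Context {R : realType}.
Local Notation leb := (@lebesgue_measure R).
Variables (c : R) (c0 : 0 < c).

Let cn n : {nonneg R} := NngNum (exprn_ge0 n (ltW c0)).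

Lemma measurable_scale1 : measurable_fun setT
  (fun x : measurableTypeR R => c * x : measurableTypeR R).
Proof. exact: mulrl_measurable. Qed.

Lemma lebesgue_measure_scale (A : set (measurableTypeR R)) : measurable A ->
  leb A = (c%:E * leb ((fun x => (c * x)%R) @^-1` A))%E.
Proof.
move=> mA.
have H := @lebesgue_measure_unique R
  (mscale (cn 1) (pushforward leb (fun x : measurableTypeR R => c * x : measurableTypeR R))).
rewrite (H measurable_scale1 _ _ mA).
  by [].
move=> _ [[a b] _ <-]; rewrite /mscale /pushforward /=.
have E : (fun x : R => c * x) @^-1` `]a, b]%classic = `]a / c, b / c]%classic.
  apply/seteqP; split => x /=; rewrite !in_itv/=;
    by rewrite ltr_pdivrMr// ler_pdivlMr// mulrC.
transitivity (c%:E * leb [set` `](a / c)%R, (b / c)%R]])%E; last by rewrite -E.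
rewrite !lebesgue_measure_itv/= !lte_fin ltr_pM2r ?invr_gt0//.
case: ifPn => // _; last by rewrite mule0.
by rewrite -!EFinD -EFinM; congr (_%:E); field; rewrite gt_eqF.
Qed.

Definition scale_rV n (x : 'rV[R]_n) : 'rV[R]_n :=
  \row_i (c * x ord0 i).

Lemma measurable_scale_rV n : measurable_fun setT (@scale_rV n).
Proof.
apply: measurable_fun_rVP => i; under eq_fun do rewrite mxE.
exact: (measurableT_comp measurable_scale1 (measurable_coord_rV i)).
Qed.

(** By induction on the dimension: the dilated product measure agrees with the product
of the dilated measures on rectangles, and this determines it. *)
Lemma lebesgue_rV_scale n (A : set 'rV[R]_n) : measurable A ->
  @lebesgue_rV R n A = ((c ^+ n)%:E * @lebesgue_rV R n (@scale_rV n @^-1` A))%E.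
Proof.
elim: n A => [|n ih] A mA.
  rewrite expr0 mul1e; congr (_ _); apply/seteqP.
  by split => x /=; rewrite (_ : scale_rV x = x)//; apply/rowP => -[].
pose T (p : measurableTypeR R * 'rV[R]_n) :
  measurableTypeR R * 'rV[R]_n := (c * p.1, scale_rV p.2).
have mT : measurable_fun setT T.
  apply/measurable_fun_pairP; split.
    exact: (measurableT_comp measurable_scale1 measurable_fst).
  exact: (measurableT_comp (@measurable_scale_rV n) measurable_snd).
have mB : measurable (@rV_cons R n @^-1` A).
  by rewrite -[X in measurable X]setTI; exact: measurable_rV_cons.
rewrite /= /lebesgue_rV_step /pushforward.
have H := @product_measure_unique _ _ _ _ R leb (@lebesgue_rV R n)
  (mscale (cn n.+1) (pushforward (leb \x (@lebesgue_rV R n))%E T)).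
apply: (etrans (H mT _ _ mB)).
  move=> B C mB' mC.
  have mB2 : measurable ((fun x : measurableTypeR R => (c * x)%R) @^-1` B).
    by rewrite -[X in measurable X]setTI; exact: measurable_scale1.
  have mC2 : measurable (@scale_rV n @^-1` C).
    by rewrite -[X in measurable X]setTI; exact: measurable_scale_rV.
  transitivity ((c ^+ n.+1)%:E * (leb \x @lebesgue_rV R n)
      (((fun x => (c * x)%R) @^-1` B) `*` (@scale_rV n @^-1` C)))%E; first by [].
  rewrite product_measure1E// [in RHS](ih C mC).
  have /= -> := lebesgue_measure_scale mB'.
  by rewrite exprS EFinM muleACA.
have E : T @^-1` (@rV_cons R n @^-1` A) = @rV_cons R n @^-1` (@scale_rV n.+1 @^-1` A).
  have E a v : rV_cons (T (a, v)) = scale_rV (rV_cons (a, v)).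
    by apply/rowP => i; rewrite !mxE; case: (unliftP ord0 i) => [j|] _ //=; rewrite mxE.
  by apply/seteqP; split => -[a v] /=; rewrite E.
transitivity ((c ^+ n.+1)%:E * (leb \x @lebesgue_rV R n)
  (T @^-1` (@rV_cons R n @^-1` A)))%E; first by [].
by rewrite E.
Qed.

End scaling.

Section balls.
Context {R : realType} {d : nat}.
Local Notation space := 'rV[R]_d.
Local Notation mu := (@lebesgue_rV R d).

Lemma scale_rVE (c : R) (x : space) : scale_rV c x = c *: x.
Proof. by apply/rowP => i; rewrite !mxE. Qed.

Lemma ge0_Rintegral_scale (c : R) (f : space -> R) : 0 < c ->
  measurable_fun [set: space] f -> (forall x, 0 <= f x) ->
  \int[mu]_x f x = c ^+ d * \int[mu]_x f (c *: x).
Proof.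
move=> c0 mf f0.
have ms : measurable_fun setT (@scale_rV R c d) by exact: measurable_scale_rV.
have mEf : measurable_fun [set: space] (EFin \o f) by exact/measurable_EFinP.
rewrite /Rintegral.
have r0 := exprn_ge0 d (ltW c0).
have -> : (\int[mu]_x (f x)%:E = (c ^+ d)%:E * \int[mu]_x (f (c *: x))%:E)%E.
  have -> : (\int[mu]_x (f (c *: x))%:E =
      \int[pushforward mu (@scale_rV R c d)]_x (f x)%:E)%E.
    rewrite ge0_integral_pushforward//=; last by move=> x _; rewrite lee_fin.
    by rewrite preimage_setT; apply: eq_integral => x _ /=; rewrite scale_rVE.
  rewrite -[(c ^+ d)%:E]/(((NngNum r0)%:num)%:E).
  rewrite -ge0_integral_mscale//; last by move=> x _; rewrite lee_fin.
  apply: eq_measure_integral => A mA _.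
  exact: (lebesgue_rV_scale c0 mA).
have [->|] := eqVneq (\int[mu]_x (f (c *: x))%:E)%E (+oo)%E.
  by rewrite gt0_muley ?mulr0// lte_fin exprn_gt0.
move=> ny; rewrite fineM// fin_numE ny andbT gt_eqF//.
by apply: (@lt_le_trans _ _ 0%E) => //; apply: integral_ge0 => x _; rewrite lee_fin.
Qed.

Definition cball (r : R) : set space := [set x | enorm x <= r].
Definition oball (r : R) : set space := [set x | enorm x < r].
Definition ball_vol : R := fine (mu (cball 1)).

Lemma continuous_enorm : continuous (@enorm R d).
Proof.
move=> x; apply: (@continuous_comp _ _ _ (fun x : space => dotp x x) (@Num.sqrt R)).
  suff : continuous (fun x : space => dotp x x) by apply.
  apply: continuous_bigsum => i.
  by apply: continuous_mul; exact: continuous_coord_rV.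
exact: sqrt_continuous.
Qed.

Lemma measurable_cball r : measurable (cball r).
Proof.
rewrite -[cball r]setCK; apply: measurableC; apply: open_measurable_rV.
apply: closed_openC; rewrite (_ : cball r = (@enorm R d) @^-1` [set y | y <= r])//.
by apply: closed_comp; [move=> x _; exact: continuous_enorm|exact: closed_le].
Qed.

Lemma measurable_oball r : measurable (oball r).
Proof.
apply: open_measurable_rV; rewrite (_ : oball r = (@enorm R d) @^-1` [set y | y < r])//.
by apply: open_comp; [move=> x _; exact: continuous_enorm|exact: open_lt].
Qed.

Lemma cball_sub_cube r : cball r `<=` cube 0 r.
Proof.
move=> x xr i; rewrite /= in_itv/= mxE -ler_distl subr0.
exact: le_trans (coord_le_enorm x i) xr.
Qed.

Lemma cball_lty r : (mu (cball r) < +oo)%E.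
Proof.
apply: le_lt_trans (lebesgue_cube_lty 0 r).
apply: le_measure; rewrite ?inE; [exact: measurable_cball|exact: measurable_cube|].
exact: cball_sub_cube.
Qed.

Lemma lebesgue_cball1 : mu (cball 1) = ball_vol%:E.
Proof. by rewrite fineK// ge0_fin_numE// cball_lty. Qed.

Lemma lebesgue_cball r : 0 < r -> mu (cball r) = (r ^+ d * ball_vol)%:E.
Proof.
move=> r0; apply: (etrans (lebesgue_rV_scale r0 (measurable_cball r))).
rewrite EFinM -lebesgue_cball1; congr (_ * _)%E; congr (mu _).
have E x : (r * enorm x <= r) = (enorm x <= 1) by rewrite -{2}(mulr1 r) ler_pM2l.
by apply/seteqP; split => x; rewrite /cball /= scale_rVE enormZ gtr0_norm// E.
Qed.

Lemma lebesgue_oball_scale r : 0 < r -> mu (oball r) = ((r ^+ d)%:E * mu (oball 1))%E.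
Proof.
move=> r0; apply: (etrans (lebesgue_rV_scale r0 (measurable_oball r))).
congr (_ * _)%E; congr (mu _).
have E x : (r * enorm x < r) = (enorm x < 1) by rewrite -{2}(mulr1 r) ltr_pM2l.
by apply/seteqP; split => x; rewrite /oball /= scale_rVE enormZ gtr0_norm// E.
Qed.

Lemma ball_vol_gt0 : 0 < ball_vol.
Proof.
have d0 : 0 < d%:R + 1 :> R by rewrite ltr_wpDl.
have e0 : 0 < (d%:R + 1)^-1 :> R by rewrite invr_gt0.
rewrite -lte_fin -lebesgue_cball1.
apply: (@lt_le_trans _ _ (mu (cube 0 (d%:R + 1)^-1))).
  by rewrite lebesgue_cube// lte_fin exprn_gt0// mulr_gt0.
apply: le_measure; rewrite ?inE; [exact: measurable_cube|exact: measurable_cball|].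
move=> x cx; rewrite /cball /= -(@ler_pXn2r _ 2)// ?nnegrE ?enorm_ge0// sqr_enorm.
apply: (@le_trans _ _ (\sum_(i < d) (d%:R + 1)^-1)).
  apply: ler_sum => i _; have := cx i; rewrite /= in_itv/= mxE -ler_distl subr0.
  move=> h; rewrite -expr2 -real_normK ?num_real//.
  apply: (@le_trans _ _ (`|x ord0 i| * 1)).
    rewrite expr2 ler_wpM2l// (le_trans h)// invf_le1//.
    by rewrite lerDr.
  by rewrite mulr1.
rewrite sumr_const card_ord expr1n -[X in X <= _]mulr_natl.
rewrite ler_pdivrMr//.
by rewrite mul1r lerDl.
Qed.

(** The closed ball of radius 1 - s is inside the open unit ball for 0 < s < 1, and its
volume tends to that of the closed unit ball; thus spheres are null sets. *)
Lemma lebesgue_oball r : 0 < r -> mu (oball r) = (r ^+ d * ball_vol)%:E.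
Proof.
move=> r0; rewrite lebesgue_oball_scale// EFinM; congr (_ * _)%E.
apply/eqP; rewrite eq_le; apply/andP; split.
  rewrite -lebesgue_cball1; apply: le_measure; rewrite ?inE;
    [exact: measurable_oball|exact: measurable_cball|].
  by move=> x /ltW.
have ofin : mu (oball 1) \is a fin_num.
  rewrite ge0_fin_numE//; apply: le_lt_trans (cball_lty 1).
  apply: le_measure; rewrite ?inE;
    [exact: measurable_oball|exact: measurable_cball|].
  by move=> x /ltW.
rewrite -(fineK ofin) lee_fin; apply/ler_addgt0Pl => e e0.
have V0 := ball_vol_gt0.
pose s := Num.min (1 / 2) (e / (d%:R * ball_vol + 1)).
have D0 : 0 < d%:R * ball_vol + 1 by rewrite ltr_wpDl// mulr_ge0// ltW.
have s0 : 0 < s by rewrite lt_min divr_gt0//= divr_gt0.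
have s1 : s <= 1 / 2 by rewrite ge_min lexx.
have se : s * (d%:R * ball_vol + 1) <= e by rewrite -ler_pdivlMr// ge_min lexx orbT.
have : (mu (cball (1 - s)) <= mu (oball 1))%E.
  apply: le_measure; rewrite ?inE;
    [exact: measurable_cball|exact: measurable_oball|].
  by move=> x; rewrite /cball/oball/= => /le_lt_trans; apply; rewrite ltrBlDr ltrDl.
rewrite lebesgue_cball; last by lra.
rewrite -(fineK ofin) lee_fin.
have : 1 - d%:R * s <= (1 - s) ^+ d.
  elim: (d) => [|n ih]; first by rewrite mul0r subr0 expr0.
  rewrite exprS -natr1; apply: (@le_trans _ _ ((1 - s) * (1 - n%:R * s))).
    have := mulr_ge0 (mulr_ge0 (ler0n R n) (ltW s0)) (ltW s0); nra.
  by rewrite ler_wpM2l//; lra.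
move=> h1 h2; nra.
Qed.

(** The radial projection x / |x| is the point of the unit sphere closest to x. *)
Lemma sphere_nbhd h : 0 < h < 1 ->
  [set x : space | exists2 a, enorm a = 1 & enorm (x - a) < h] =
  oball (1 + h) `\` cball (1 - h).
Proof.
move=> /andP[h0 h1]; apply/seteqP; split => x.
  move=> [a a1 xa]; rewrite /oball/cball; split => /=.
    by have := enormD (x - a) a; rewrite subrK; lra.
  apply/negP; rewrite -ltNge.
  by have := enormD (a - x) x; rewrite subrK -(enormN (a - x)) opprB; lra.
rewrite /oball/cball => -[/= xh /negP]; rewrite -ltNge => hx.
have x0 : 0 < enorm x by lra.
exists ((enorm x)^-1 *: x).
  by rewrite enormZ gtr0_norm ?invr_gt0// mulVf// gt_eqF.
rewrite -[X in enorm (X - _)](scale1r x) -scalerBl enormZ.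
rewrite -[X in _ * X]gtr0_norm// -normrM mulrBl mul1r mulVf ?gt_eqF//.
by rewrite ltr_norml; lra.
Qed.

(** The h-neighbourhood of the unit sphere is a shell of volume
V ((1 + h)^d - (1 - h)^d), so the Minkowski content is half the derivative at h = 0
of that expression. *)
Lemma omegaE : omega R d = d%:R * ball_vol.
Proof.
rewrite /omega /surface_area.
suff -> : lim ((mu [set x : space | exists2 a, [set x : space | (enorm x = 1)%R] a & (enorm (x - a) < h)%R]
        * ((2 * h)^-1)%:E)%E @[h --> 0^'+]) = (d%:R * ball_vol)%:E by [].
apply/cvg_lim; first exact: ereal_hausdorff.
pose p (h : R) := (\sum_(i < d) (1 + h) ^+ (d.-1 - i) * (1 - h) ^+ i) * ball_vol.
have pc : continuous p.
  move=> h; apply: cvgM; last exact: cvg_cst.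
  suff : continuous (fun h : R => \sum_(i < d) (1 + h) ^+ (d.-1 - i) * (1 - h) ^+ i) by apply.
  apply: continuous_bigsum => i; apply: continuous_mul; apply: continuous_expn.
    by apply: continuous_add; [exact: cst_continuous|move=> ?; exact: cvg_id].
  by apply: continuous_sub; [exact: cst_continuous|move=> ?; exact: cvg_id].
have p0 : p 0 = d%:R * ball_vol.
  rewrite /p; congr (_ * _); rewrite addr0 subr0.
  rewrite (eq_bigr (fun=> 1)); last by move=> i _; rewrite !expr1n mulr1.
  by rewrite sumr_const card_ord.
rewrite -p0.
apply: (@cvg_trans _ ((p h)%:E @[h --> 0^'+])); last first.
  apply: cvg_EFin; first exact: nearW.
  by apply: cvg_at_right_filter; exact: pc.
apply: near_eq_cvg; near=> h.
have h0 : 0 < h by near: h; exact: nbhs_right_gt.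
have h1 : h < 1 by near: h; exact: nbhs_right_lt.
rewrite sphere_nbhd ?h0//.
have hm : cball (1 - h) `<=` oball (1 + h).
  by move=> x; rewrite /cball/oball/= => /le_lt_trans; apply; lra.
have hp : 0 < 1 + h by lra.
have hq : 0 < 1 - h by lra.
have -> : mu (oball (1 + h) `\` cball (1 - h)) =
    ((1 + h) ^+ d * ball_vol - (1 - h) ^+ d * ball_vol)%:E.
  apply: (etrans (measureD (measurable_oball (1 + h)) (measurable_cball (1 - h)) _)).
    by have /= -> := lebesgue_oball hp; rewrite ltry.
  rewrite setIidr// EFinB; congr (_ - _)%E; [exact: lebesgue_oball|exact: lebesgue_cball].
rewrite -EFinM; congr (_%:E); rewrite -mulrBl /p subrXX.
have -> : (1 + h) - (1 - h) = 2 * h by ring.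
by field; rewrite gt_eqF.
Unshelve. all: by end_near. Qed.

End balls.

(** * C1 cutoffs of one variable *)

Section cutoff.
Context {R : realType}.

(** The square of the positive part: the simplest C1 function that vanishes on a
half-line and is positive on the other. *)
Definition possq (s : R) : R := Num.max s 0 ^+ 2.
Definition dpossq (s : R) : R := 2 * Num.max s 0.

Lemma possq_ge0 s : 0 <= possq s. Proof. exact: sqr_ge0. Qed.

Lemma dpossq_ge0 s : 0 <= dpossq s.
Proof. by rewrite mulr_ge0// le_max lexx orbT. Qed.

Lemma possq_le0 s : s <= 0 -> possq s = 0.
Proof. by move=> s0; rewrite /possq (max_idPr s0) expr0n. Qed.

Lemma dpossq_le0 s : s <= 0 -> dpossq s = 0.
Proof. by move=> s0; rewrite /dpossq (max_idPr s0) mulr0. Qed.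

Lemma possq_ge s : 0 <= s -> possq s = s ^+ 2.
Proof. by move=> s0; rewrite /possq (max_idPl s0). Qed.

Lemma dpossq_ge s : 0 <= s -> dpossq s = 2 * s.
Proof. by move=> s0; rewrite /dpossq (max_idPl s0). Qed.

(** A first-order expansion with a quadratic remainder on the whole line avoids a case
distinction between the sides of the kink of [possq]. *)
Lemma is_derive_quadratic (f : R -> R) (s l : R) :
  (forall h, `|f (h + s) - f s - l * h| <= h ^+ 2) -> is_derive s (1 : R) f l.
Proof.
move=> H.
have fl : h^-1 *: (f (h *: (1 : R) + s) - f s) @[h --> (0 : R)^'] --> l.
  apply/cvgrPdist_le => e e0; near=> h.
  have h0 : h != 0 by near: h; exact: nbhs_dnbhs_neq.
  have he : `|h| <= e.
    by near: h; apply: dnbhs0_le.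
  rewrite /GRing.scale/= mulr1 distrC.
  have -> : h^-1 * (f (h + s) - f s) - l = h^-1 * (f (h + s) - f s - l * h).
    by field.
  rewrite normrM normfV ler_pdivrMl ?normr_gt0// (le_trans (H h))//.
  by rewrite -real_normK ?num_real// expr2 ler_wpM2l.
by apply: DeriveDef; [apply/cvg_ex; exists l|exact/cvg_lim].
Unshelve. all: by end_near. Qed.

Lemma is_derive_possq s : is_derive s (1 : R) possq (dpossq s).
Proof.
apply: is_derive_quadratic => h; rewrite /possq /dpossq.
rewrite ler_norml.
by have [?|?] := leP (h + s) 0; have [?|?] := leP s 0; apply/andP; split; nra.
Qed.

Lemma continuous_dpossq : continuous dpossq.
Proof.
apply: continuous_mul; first exact: cst_continuous.
move=> s; apply: (@continuous_max _ _ id (cst 0)); [exact: cvg_id|exact: cvg_cst].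
Qed.

Lemma continuous_possq : continuous possq.
Proof.
apply: continuous_expn => s.
apply: (@continuous_max _ _ id (cst 0)); [exact: cvg_id|exact: cvg_cst].
Qed.

(** Applying [possq] twice turns the half-line cutoff into a transition from 1 to 0
over the unit interval. *)
Definition plateau (s : R) : R := possq (1 - possq s).
Definition dplateau (s : R) : R := - (dpossq (1 - possq s) * dpossq s).

Lemma plateau_le0 s : s <= 0 -> plateau s = 1.
Proof. by move=> s0; rewrite /plateau (possq_le0 s0) subr0 possq_ge ?expr1n. Qed.

Lemma dplateau_le0 s : s <= 0 -> dplateau s = 0.
Proof. by move=> s0; rewrite /dplateau (dpossq_le0 s0) mulr0 oppr0. Qed.

Lemma plateau_ge1 s : 1 <= s -> plateau s = 0.
Proof.
by move=> s1; rewrite /plateau (possq_ge (le_trans ler01 s1)) possq_le0//; nra.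
Qed.

Lemma dplateau_ge1 s : 1 <= s -> dplateau s = 0.
Proof.
move=> s1; rewrite /dplateau (possq_ge (le_trans ler01 s1)) dpossq_le0 ?mul0r ?oppr0//.
by nra.
Qed.

Lemma plateau_ge0 s : 0 <= plateau s. Proof. exact: possq_ge0. Qed.

Lemma is_derive_plateau s : is_derive s (1 : R) plateau (dplateau s).
Proof.
have H1 := is_derive_possq s.
have H2 := is_derive_possq (1 - possq s).
have H3 : is_derive s (1 : R) (fun s => 1 - possq s) (- dpossq s).
  have H : is_derive s (1 : R) (cst 1 - possq) (0 - dpossq s) by apply: is_deriveB.
  by rewrite sub0r in H.
have := @is_derive1_comp _ possq (fun s => 1 - possq s) s _ _ H2 H3.
by rewrite mulrN.
Qed.

Lemma continuous_dplateau : continuous dplateau.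
Proof.
have H : continuous (fun s => dpossq (1 - possq s) * dpossq s).
  apply: continuous_mul; last exact: continuous_dpossq.
  move=> s; apply: (@continuous_comp _ _ _ (fun s => 1 - possq s) dpossq).
    by apply: continuous_sub; [exact: cst_continuous|exact: continuous_possq].
  exact: continuous_dpossq.
have -> : dplateau = (fun s => -1 * (dpossq (1 - possq s) * dpossq s)).
  by apply/funext => s; rewrite mulN1r.
by apply: continuous_mul; first exact: cst_continuous.
Qed.

End cutoff.

(** * The state equation near and far from the background *)

Section thermo.
Context {R : realType}.
Variables (gamma rb : R).
Hypotheses (gamma1 : 1 < gamma) (rb0 : 0 < rb).

(** The internal energy minus its tangent at rb. *)
Definition relpot (r : R) : R :=
  (gamma - 1)^-1 * (r `^ gamma - rb `^ gamma - gamma * rb `^ (gamma - 1) * (r - rb)).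

Let gamma0 : 0 < gamma. Proof. exact: lt_trans gamma1. Qed.

(** Convexity of the pressure. This is Young's inequality for r and rb^(gamma - 1) with
exponents gamma and gamma / (gamma - 1). *)
Lemma pressure_tangent r : 0 <= r ->
  gamma * rb `^ (gamma - 1) * (r - rb) <= r `^ gamma - rb `^ gamma.
Proof.
move=> r0.
have q0 : 0 < gamma / (gamma - 1) by rewrite divr_gt0// subr_gt0.
have g1 : gamma - 1 != 0 by rewrite subr_eq0 gt_eqF.
have gn : gamma != 0 by rewrite gt_eqF.
have := @conjugate_powR _ r (rb `^ (gamma - 1)) gamma (gamma / (gamma - 1)) r0
  (powR_ge0 _ _) gamma0 q0.
have -> : gamma^-1 + (gamma / (gamma - 1))^-1 = 1 by field; rewrite g1 gn.
move=> /(_ erefl).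
rewrite -powRrM (_ : (gamma - 1) * (gamma / (gamma - 1)) = gamma); last by field.
have <- := mulr_powRB1 (ltW rb0) gamma0.
have -> : rb * rb `^ (gamma - 1) / (gamma / (gamma - 1)) =
  (gamma - 1) / gamma * (rb * rb `^ (gamma - 1)) by field; rewrite g1 gn.
rewrite -(ler_pM2l gamma0) mulrDr.
have -> : gamma * (r `^ gamma / gamma) = r `^ gamma by field.
have -> : gamma * ((gamma - 1) / gamma * (rb * rb `^ (gamma - 1))) =
  (gamma - 1) * (rb * rb `^ (gamma - 1)) by field.
by lra.
Qed.

Lemma relpot_ge0 r : 0 <= r -> 0 <= relpot r.
Proof.
move=> r0; apply: mulr_ge0; first by rewrite invr_ge0 subr_ge0 ltW.
by rewrite subr_ge0; exact: pressure_tangent.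
Qed.

(** The mean value theorem with an endpoint c, on either side of c. The sign condition
places z on the same side of c as x. *)
Lemma is_derive_nbhs_MVT (f df : R -> R) (c e : R) :
  (forall s, `|s - c| < e -> is_derive s (1 : R) f (df s)) ->
  forall x, `|x - c| < e ->
  exists2 z, `|z - c| <= `|x - c| /\ 0 <= (z - c) * (x - c) &
    f x - f c = df z * (x - c).
Proof.
move=> fd x xe.
have fc s : `|s - c| < e -> {for s, continuous f}.
  move=> sc; have H := fd _ sc.
  by apply: differentiable_continuous; apply/derivable1_diffP; apply: ex_derive.
have [xc|xc] := leP c x.
  have [||z zI ->] := @MVT_segment _ f df c x xc.
  - move=> s; rewrite in_itv/= => /andP[cs sx]; apply: fd.
    rewrite gtr0_norm ?subr_gt0//; rewrite ger0_norm ?subr_ge0// in xe; lra.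
  - apply: continuous_in_subspaceT => s; rewrite inE/= in_itv/= => /andP[cs sx].
    apply: fc; rewrite ger0_norm ?subr_ge0//; rewrite ger0_norm ?subr_ge0// in xe; lra.
  exists z => //; move: zI; rewrite in_itv/= => /andP[cz zx].
  by rewrite !ger0_norm ?subr_ge0// mulr_ge0 ?subr_ge0//; split => //; lra.
have [||z zI e1] := @MVT_segment _ f df x c (ltW xc).
- move=> s; rewrite in_itv/= => /andP[cs sx]; apply: fd.
  rewrite ltr0_norm ?subr_lt0//; rewrite ltr0_norm ?subr_lt0// in xe; lra.
- apply: continuous_in_subspaceT => s; rewrite inE/= in_itv/= => /andP[cs sx].
  apply: fc; rewrite ler0_norm ?subr_le0//; rewrite ltr0_norm ?subr_lt0// in xe; lra.
exists z; last by rewrite -(opprB (f c)) e1; ring.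
move: zI; rewrite in_itv/= => /andP[cz zx].
rewrite (ler0_norm (_ : z - c <= 0)) ?subr_le0// (ltr0_norm (_ : x - c < 0)) ?subr_lt0//.
by split; [lra|nra].
Qed.

Definition sound_speed : R := Num.sqrt gamma * rb `^ ((gamma - 1) / 2).

Lemma sound_speed_gt0 : 0 < sound_speed.
Proof. by rewrite mulr_gt0 ?sqrtr_gt0// powR_gt0. Qed.

Lemma sqr_sound_speed : sound_speed ^+ 2 = gamma * rb `^ (gamma - 1).
Proof.
rewrite exprMn sqr_sqrtr ?(ltW gamma0)//; congr (_ * _).
by rewrite -powR_mulrn ?powR_ge0// -powRrM divfK.
Qed.

(** At r = rb, the derivative of the pressure is sigma^2 and the second derivative of
the internal energy is sigma^2 / rb. By continuity, near rb these are at most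
(1 + eta) sigma^2 and at least (1 - eta) sigma^2 / rb. Hence
|p - p(rb)| <= (1 + eta) sigma^2 |r - rb| and
[relpot] >= (1 - eta) sigma^2 (r - rb)^2 / (2 rb), and eta is chosen so that the strict
inequality sigma < k absorbs the errors. *)
Lemma relpot_local k : sound_speed < k -> exists2 a, 0 < a & exists2 e, 0 < e &
  forall r, `|r - rb| < e -> [/\ 0 < r, a * (r - rb) ^+ 2 <= relpot r &
    (r `^ gamma - rb `^ gamma) ^+ 2 <= 2 * r * k ^+ 2 * relpot r].
Proof.
move=> sk; have s0 := sound_speed_gt0.
set s := sound_speed in sk s0.
(* The solution of (1 + eta) s = (1 - eta) k. *)
pose eta := (k - s) / (k + s).
have ks : 0 < k + s by lra.
have eta0 : 0 < eta by rewrite divr_gt0// subr_gt0.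
have eta1 : eta < 1 by rewrite ltr_pdivrMr//; lra.
have etaE : (1 + eta) * s = (1 - eta) * k by rewrite /eta; field; rewrite gt_eqF.
pose g (x : R) := gamma * x `^ (gamma - 1).
have grb : g rb = s ^+ 2 by rewrite sqr_sound_speed.
have dg (x : R) : 0 < x -> is_derive x (1 : R) (@powR R ^~ gamma) (g x) by move=> x0; exact: is_derive1_powR.
pose g2 (x : R) := gamma * x `^ (gamma - 1 - 1).
have dg2 (x : R) : 0 < x -> is_derive x (1 : R) (fun x => (gamma - 1)^-1 * g x) (g2 x).
  move=> x0; have H := is_derive1_powR (gamma - 1) x0.
  have H2 : is_derive x (1 : R) ((gamma - 1)^-1 *: (gamma *: (@powR R ^~ (gamma - 1))))
    ((gamma - 1)^-1 *: (gamma *: ((gamma - 1) * x `^ (gamma - 1 - 1)))).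
    by apply: is_deriveZ.
  rewrite (_ : g2 x = ((gamma - 1)^-1 *: (gamma *: ((gamma - 1) * x `^ (gamma - 1 - 1)))))//.
  by rewrite /g2 /GRing.scale/=; field; rewrite subr_eq0 gt_eqF.
have g2rb : g2 rb = s ^+ 2 / rb.
  rewrite -grb /g /g2 -(mulr_powRB1 (ltW rb0) (_ : 0 < gamma - 1)) ?subr_gt0//.
  by field; rewrite gt_eqF.
have cpow p : {for rb, continuous (fun x : R => gamma * x `^ p)}.
  apply: (@continuousM _ _ (cst gamma) (@powR R ^~ p)); first exact: cvg_cst.
  apply: differentiable_continuous; apply/derivable1_diffP.
  by have H := is_derive1_powR p rb0; apply: ex_derive.
have s20 : 0 < s ^+ 2 by rewrite exprn_gt0.
have a0 : 0 < s ^+ 2 / rb by rewrite divr_gt0.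
have [e1 /= e10 He1] : \forall x \near rb, g x < (1 + eta) * s ^+ 2.
  have /cvgr_lt H : g x @[x --> rb] --> g rb by exact: cpow.
  by apply: H; rewrite grb; nra.
have [e2 /= e20 He2] : \forall x \near rb, (1 - eta) * (s ^+ 2 / rb) < g2 x.
  have /cvgr_gt H : g2 x @[x --> rb] --> g2 rb by exact: cpow.
  by apply: H; rewrite g2rb; nra.
pose e := Num.min (Num.min e1 e2) (eta * rb).
have er : e <= eta * rb by rewrite /e ge_min lexx orbT.
have ele1 : e <= e1 by rewrite /e !ge_min lexx.
have ele2 : e <= e2 by rewrite /e !ge_min lexx orbT.
have e0 : 0 < e by rewrite !lt_min e10 e20 mulr_gt0.
have near_rb (x : R) : `|x - rb| < e -> [/\ (1 - eta) * rb < x, 0 < x,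
    g x < (1 + eta) * s ^+ 2 & (1 - eta) * (s ^+ 2 / rb) < g2 x].
  move=> xe.
  have x1 : (1 - eta) * rb < x by move: xe; rewrite ltr_norml => /andP[? ?]; nra.
  split => //; first by apply: lt_trans x1; rewrite mulr_gt0// subr_gt0.
    by apply: He1; rewrite /= distrC (lt_le_trans xe).
  by apply: He2; rewrite /= distrC (lt_le_trans xe).
exists ((1 - eta) * (s ^+ 2 / rb) / 2); first by rewrite divr_gt0// mulr_gt0// subr_gt0.
exists e => // r re; have [r1 r0 _ _] := near_rb r re.
set a := (1 - eta) * (s ^+ 2 / rb).
have relpot_lb : a / 2 * (r - rb) ^+ 2 <= relpot r.
  pose F x := relpot x - a / 2 * (x - rb) ^+ 2.
  pose dF x := (gamma - 1)^-1 * g x - (gamma - 1)^-1 * g rb - a * (x - rb).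
  have dF_ (x : R) : `|x - rb| < e -> is_derive x (1 : R) F (dF x).
    move=> xe; have [_ x0 _ _] := near_rb x xe.
    have H := dg _ x0.
    rewrite /F /relpot.
    have H2 : is_derive x (1 : R)
      ((gamma - 1)^-1 *: ((@powR R ^~ gamma) - cst (rb `^ gamma) -
         (gamma * rb `^ (gamma - 1)) *: (id - cst rb)) -
       (a / 2) *: ((id - cst rb) ^+ 2)) (dF x); last exact: H2.
    apply: is_derive_eq.
    rewrite /dF /GRing.scale/= /g; rewrite !fctE; field.
    by rewrite subr_eq0 gt_eqF.
  have [z [zr1 zr2] Fz] := is_derive_nbhs_MVT dF_ re.
  have ze := le_lt_trans zr1 re.
  have dh (x : R) : `|x - rb| < e -> is_derive x (1 : R) (fun x => (gamma - 1)^-1 * g x) (g2 x).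
    by move=> xe; have [_ x0 _ _] := near_rb x xe; exact: dg2.
  have [w [wz _] hw] := is_derive_nbhs_MVT dh ze.
  have [_ _ _ g2w] := near_rb w (le_lt_trans wz ze).
  have : 0 <= F r - F rb.
    rewrite Fz /dF hw -mulrBl -mulrA mulr_ge0// subr_ge0 ltW//.
  by rewrite /F /relpot !subrr !(mulr0, subr0) expr0n /= !(mulr0, subr0) subr_ge0.
split => //.
have dp (x : R) : `|x - rb| < e -> is_derive x (1 : R) (@powR R ^~ gamma) (g x).
  by move=> xe; have [_ x0 _ _] := near_rb x xe; exact: dg.
have [z [zr1 _] ->] := is_derive_nbhs_MVT dp re.
have [_ z0 gz _] := near_rb z (le_lt_trans zr1 re).
have gz0 : 0 <= g z by rewrite mulr_ge0 ?powR_ge0// ltW.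
rewrite exprMn.
apply: (@le_trans _ _ (((1 + eta) * s ^+ 2) ^+ 2 * (r - rb) ^+ 2)).
  by rewrite ler_wpM2r ?sqr_ge0// ler_pXn2r// ?nnegrE ?ltW//; lra.
have -> : ((1 + eta) * s ^+ 2) ^+ 2 * (r - rb) ^+ 2 =
    2 * ((1 - eta) * rb) * k ^+ 2 * (a / 2 * (r - rb) ^+ 2).
  have -> : ((1 + eta) * s ^+ 2) ^+ 2 = ((1 + eta) * s) ^+ 2 * s ^+ 2 by ring.
  by rewrite etaE /a; field; rewrite gt_eqF.
have k2 : 0 <= k ^+ 2 by exact: sqr_ge0.
have r2 : 0 <= 1 - eta by lra.
have k0 : 0 <= k by lra.
have rb0' := ltW rb0; have a0' := ltW a0.
apply: ler_pM => //.
- by rewrite !mulr_ge0.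
- by rewrite mulr_ge0 ?sqr_ge0// divr_ge0// mulr_ge0.
- by apply: ler_wpM2r => //; apply: ler_wpM2l => //; exact: ltW.
Qed.

(** The relative energy of a state with density r and speed U. *)
Definition relen (r U : R) : R := r * U ^+ 2 / 2 + relpot r.

Lemma relen_ge0 r U : 0 <= r -> 0 <= relen r U.
Proof. by move=> r0; rewrite addr_ge0 ?relpot_ge0// divr_ge0// mulr_ge0// sqr_ge0. Qed.

(** In |p - p(rb)| U <= k' (r U^2 / 2 + [relpot]), with sigma < k' < k, the right-hand side
dominates a geometric mean that [relpot_local] compares with the left-hand side. The
remaining part of the flux, U times the relative energy, is absorbed by k - k' when U is
small. *)
Lemma flux_local k : sound_speed < k -> exists2 e, 0 < e &
  forall r U, `|r - rb| < e -> 0 <= U < e ->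
   `|relen r U + (r `^ gamma - rb `^ gamma)| * U <= k * relen r U /\
   (relen r U = 0 -> r = rb /\ U = 0).
Proof.
move=> sk; pose k' := (sound_speed + k) / 2.
have sk' : sound_speed < k' by rewrite /k'; lra.
have [a a0 [e e0 He]] := relpot_local sk'.
exists (Num.min e (k - k')); first by rewrite lt_min e0 /k'; lra.
move=> r U; rewrite lt_min => /andP[re _] /andP[U0]; rewrite lt_min => /andP[_ Uk].
have [r0 Hl pl] := He r re.
have H0 : 0 <= relpot r by apply: le_trans Hl; rewrite mulr_ge0 ?sqr_ge0 ?ltW.
have E0 : 0 <= relen r U by apply: relen_ge0; exact: ltW.
have k'0 : 0 < k' by apply: lt_trans sk'; exact: sound_speed_gt0.
set X := r `^ gamma - rb `^ gamma in pl *.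
split.
  have XU : `|X| * U <= k' * relen r U.
    have kr : 0 < 2 * (k' * r) by rewrite pmulr_rgt0// mulr_gt0.
    rewrite -(ler_pM2l kr).
    have := sqr_ge0 (`|X| - k' * r * U).
    have : `|X| ^+ 2 = X ^+ 2 by rewrite real_normK ?num_real.
    rewrite /relen; nra.
  apply: (@le_trans _ _ ((relen r U + `|X|) * U)).
    apply: ler_wpM2r => //; apply: le_trans (ler_normD _ _) _.
    by rewrite (ger0_norm E0).
  rewrite mulrDl; have : U * relen r U <= (k - k') * relen r U.
    by apply: ler_wpM2r => //; exact: ltW.
  move: XU; rewrite (mulrC U) mulrBl; lra.
rewrite /relen => E.
have : 0 <= r * U ^+ 2 / 2 by rewrite divr_ge0// mulr_ge0 ?sqr_ge0 ?ltW.
move=> h1; have h2 : relpot r = 0 by lra.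
have h3 : r * U ^+ 2 / 2 = 0 by lra.
split.
  apply/eqP; rewrite -subr_eq0 -sqrf_eq0.
  have := sqr_ge0 (r - rb); rewrite h2 in Hl => h4.
  by rewrite eq_le h4 andbT -(ler_pM2l a0) mulr0.
move/eqP: h3; rewrite !mulf_eq0 invr_eq0 pnatr_eq0 orbF (gt_eqF r0)/=.
by rewrite orbb => /eqP.
Qed.

End thermo.

(** * Space-time integrals *)

Section double_integrals.
Context {R : realType} {d : nat}.
Local Notation space := 'rV[R]_d.
Local Notation mu := (@lebesgue_rV R d).
Local Notation leb := (@lebesgue_measure R).
Implicit Types (g h : R -> space -> R).

(** Integrands that are jointly continuous and, for a < t < b, supported in the ball of
radius A. For these, space integrals depend continuously on time and space-time
integrals are linear. *)
Definition slab A a b g := continuous (fun z : R * space => g z.1 z.2) /\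
  (forall t, a < t < b -> supp_in A (g t)).

Lemma slab_integrable A a b g t : slab A a b g -> a < t < b ->
  mu.-integrable setT (EFin \o g t).
Proof.
by move=> [cg sg] tab; apply: integrable_supp (sg _ tab); exact: continuous_section.
Qed.

Lemma slab_add A a b g h : slab A a b g -> slab A a b h ->
  slab A a b (fun t x => g t x + h t x).
Proof.
move=> [cg sg] [ch sh]; split; first exact: continuous_add.
by move=> t tab x xA; rewrite sg// sh// addr0.
Qed.

Lemma slab_scale A a b g c : slab A a b g -> slab A a b (fun t x => c * g t x).
Proof.
move=> [cg sg]; split.
  by apply: (@continuous_mul _ _ (cst c) (fun z : R * space => g z.1 z.2)) => //; exact: cst_continuous.
by move=> t tab x xA; rewrite sg// mulr0.
Qed.

Lemma slab_mul A a b (f g : R -> space -> R) :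
  continuous (fun z : R * space => f z.1 z.2) -> slab A a b g ->
  slab A a b (fun t x => f t x * g t x).
Proof.
move=> cf [cg sg]; split.
  exact: (@continuous_mul _ _ (fun z : R * space => f z.1 z.2) (fun z : R * space => g z.1 z.2)).
by move=> t tab x xA; rewrite sg// mulr0.
Qed.

Lemma slab_sum A a b (n : nat) (F : 'I_n -> R -> space -> R) :
  (forall i, slab A a b (F i)) -> slab A a b (fun t x => \sum_i F i t x).
Proof.
move=> sF; split.
  by apply: (@continuous_bigsum _ _ _ _ _ (fun i (z : R * space) => F i z.1 z.2)) => i; have [] := sF i.
by move=> t tab x xA; rewrite big1// => i _; have [_ ->] := sF i.
Qed.

Lemma RintegralD2 A a b g h t : slab A a b g -> slab A a b h -> a < t < b ->
  \int[mu]_x (g t x + h t x) = \int[mu]_x g t x + \int[mu]_x h t x.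
Proof. by move=> sg sh tab; rewrite RintegralD//; [exact: (slab_integrable sg tab)|exact: (slab_integrable sh tab)]. Qed.

Lemma RintegralZ2 A a b g c t : slab A a b g -> a < t < b ->
  \int[mu]_x (c * g t x) = c * \int[mu]_x g t x.
Proof. by move=> sg tab; rewrite RintegralZl//; exact: (slab_integrable sg tab). Qed.

Lemma slab_integral_continuous A a b g t : slab A a b g -> a < t < b ->
  {for t, continuous (fun s => \int[mu]_x g s x)}.
Proof. by move=> [cg sg] tab; exact: (continuous_Rintegral cg sg tab). Qed.

Lemma slab_integral_within A a b g s1 s2 : slab A a b g -> a < s1 -> s2 < b ->
  {within `[s1, s2], continuous (fun s => \int[mu]_x g s x)}.
Proof.
move=> sg as1 s2b; apply: continuous_in_subspaceT => t; rewrite inE/= in_itv/=.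
move=> /andP[s1t ts2]; apply: (slab_integral_continuous sg).
by rewrite (lt_le_trans as1 s1t) (le_lt_trans ts2 s2b).
Qed.

Lemma slab_time_integrable A a b g s1 s2 : slab A a b g -> a < s1 -> s2 < b ->
  leb.-integrable `[s1, s2] (EFin \o (fun s => \int[mu]_x g s x)).
Proof.
move=> sg as1 s2b; apply: continuous_compact_integrable; first exact: segment_compact.
exact: (slab_integral_within sg as1 s2b).
Qed.

Definition dblint s1 s2 g : R := \int[leb]_(t in `[s1, s2]) \int[mu]_x g t x.

Lemma eq_dblint s1 s2 g h :
  (forall t x, s1 <= t <= s2 -> g t x = h t x) -> dblint s1 s2 g = dblint s1 s2 h.
Proof.
move=> gh; apply: eq_Rintegral => t; rewrite inE/= in_itv/= => ts.
by apply: eq_Rintegral => x _; exact: gh.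
Qed.

Lemma dblintD A a b g h s1 s2 : slab A a b g -> slab A a b h -> a < s1 -> s2 < b ->
  dblint s1 s2 (fun t x => g t x + h t x) = dblint s1 s2 g + dblint s1 s2 h.
Proof.
move=> sg sh as1 s2b; rewrite /dblint -RintegralD//;
  [|exact: (slab_time_integrable sg as1 s2b)|exact: (slab_time_integrable sh as1 s2b)].
apply: eq_Rintegral => t; rewrite inE/= in_itv/= => /andP[s1t ts2].
by apply: (RintegralD2 sg sh); rewrite (lt_le_trans as1 s1t) (le_lt_trans ts2 s2b).
Qed.

Lemma dblintZ A a b g c s1 s2 : slab A a b g -> a < s1 -> s2 < b ->
  dblint s1 s2 (fun t x => c * g t x) = c * dblint s1 s2 g.
Proof.
move=> sg as1 s2b; rewrite /dblint -RintegralZl//;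
  last exact: (slab_time_integrable sg as1 s2b).
apply: eq_Rintegral => t; rewrite inE/= in_itv/= => /andP[s1t ts2].
by apply: (RintegralZ2 _ sg); rewrite (lt_le_trans as1 s1t) (le_lt_trans ts2 s2b).
Qed.

(** Differentiation under the integral sign combined with the fundamental theorem of
calculus; it replaces Fubini's theorem for the time derivative of a test function. *)
Lemma dblint_FTC A a b g g' s1 s2 : slab A a b g -> slab A a b g' ->
  (forall (t : R) x, a < t < b -> is_derive t (1 : R) (g ^~ x) (g' t x)) ->
  a < s1 -> s1 < s2 -> s2 < b ->
  dblint s1 s2 g' = \int[mu]_x g s2 x - \int[mu]_x g s1 x.
Proof.
move=> sg sg' dg as1 s12 s2b.
have tab t : s1 <= t <= s2 -> a < t < b.
  by move=> /andP[h1 h2]; rewrite (lt_le_trans as1 h1) (le_lt_trans h2 s2b).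
have dI t : a < t < b ->
    is_derive t (1 : R) (fun s => \int[mu]_x g s x) (\int[mu]_x g' t x).
  by case: sg => cg ssg; case: sg' => cg' ssg'; exact: (is_derive_Rintegral cg cg' dg ssg ssg').
rewrite /dblint /Rintegral.
have := @continuous_FTC2 R (fun t => \int[mu]_x g' t x) (fun t => \int[mu]_x g t x) s1 s2 s12.
rewrite /Rintegral => ->//.
- exact: (slab_integral_within sg' as1 s2b).
- split.
  + move=> t; rewrite in_itv/= => /andP[h1 h2].
    have tt : a < t < b by apply: tab; rewrite !ltW.
    by have H := dI t tt; apply: ex_derive.
  + apply: cvg_at_right_filter; apply: (slab_integral_continuous sg); apply: tab.
    by rewrite lexx ltW.
  + apply: cvg_at_left_filter; apply: (slab_integral_continuous sg); apply: tab.
    by rewrite lexx ltW.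
- move=> t; rewrite in_itv/= => /andP[h1 h2].
  have tt : a < t < b by apply: tab; rewrite !ltW.
  have H := dI t tt.
  by rewrite derive1E derive_val.
Qed.

End double_integrals.

(** * The Euler system against C1 functions with known partial derivatives *)

Section flow.
Context {R : realType} {d : nat}.
Local Notation space := 'rV[R]_d.
Local Notation mu := (@lebesgue_rV R d).
Local Notation leb := (@lebesgue_measure R).

(** The content of the Euler system used below, for an infinite life span. Fields are
defined and continuous for all real times, which removes the one-sided continuity
at t = 0; the equations are only required for nonnegative times. Radii A bound the
supports of the test functions. *)
Record euler_flow (gamma : R) (r : R -> space -> R) (v : R -> space -> space) : Prop := EulerFlow {
  flow_cont_density : continuous (fun z : R * space => r z.1 z.2);
  flow_cont_velocity : forall j, continuous (fun z : R * space => v z.1 z.2 ord0 j);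
  flow_density_ge0 : forall t x, 0 <= r t x;
  flow_mass : forall t1 t2 A phi phit phix, 0 <= t1 -> t1 < t2 ->
    C1_with phi phit phix ->
    (forall t x, t1 <= t <= t2 -> A < enorm x -> phi (t, x) = 0) ->
    \int[mu]_x (r t2 x * phi (t2, x)) - \int[mu]_x (r t1 x * phi (t1, x)) =
    dblint t1 t2 (fun t x => r t x * phit (t, x) +
      r t x * \sum_j v t x ord0 j * phix j (t, x));
  flow_momentum : forall t1 t2 A psi psit psix, 0 <= t1 -> t1 < t2 ->
    (forall i, C1_with (psi i) (psit i) (psix i)) ->
    (forall i t x, t1 <= t <= t2 -> A < enorm x -> psi i (t, x) = 0) ->
    \int[mu]_x (r t2 x * \sum_i v t2 x ord0 i * psi i (t2, x)) -
      \int[mu]_x (r t1 x * \sum_i v t1 x ord0 i * psi i (t1, x)) =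
    dblint t1 t2 (fun t x => r t x * (\sum_i v t x ord0 i * psit i (t, x)) +
      r t x * (\sum_i \sum_j v t x ord0 i * v t x ord0 j * psix i j (t, x)) +
      r t x `^ gamma * \sum_j psix j j (t, x));
  flow_energy : forall tau A phi phit phix, 0 < tau -> C1_with phi phit phix ->
    (forall t x, 0 <= t -> 0 <= phi (t, x)) ->
    (forall t x, 0 <= t -> A < enorm x -> phi (t, x) = 0) ->
    (forall t x, tau <= t -> phi (t, x) = 0 /\ phit (t, x) = 0 /\
       forall j, phix j (t, x) = 0) ->
    0 <= dblint 0 tau (fun t x => energy gamma (r t x) (v t x) * phit (t, x) +
        (energy gamma (r t x) (v t x) + r t x `^ gamma) *
          \sum_j v t x ord0 j * phix j (t, x)) +
      \int[mu]_x (energy gamma (r 0 x) (v 0 x) * phi (0, x)) }.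

Lemma compact_cball A : compact (cball A : set space).
Proof.
have cA : closed (cball A : set space).
  rewrite (_ : cball A = (@enorm R d) @^-1` [set y | y <= A])//.
  by apply: closed_comp; [move=> x _; exact: continuous_enorm|exact: closed_le].
exact: (subclosed_compact cA (@compact_cube R d 0 A) (@cball_sub_cube R d A)).
Qed.

Lemma continuous_max0 (T : topologicalType) (D : set (R * space)) (f : R * space -> T) :
  D = lifespan +oo%E `*` setT -> {within D, continuous f} ->
  continuous (fun z : R * space => f (Num.max z.1 0, z.2)).
Proof.
move=> DE cf z.
pose p (z : R * space) := (Num.max z.1 0, z.2).
have cp : continuous p.
  apply: continuous_pairing; last by move=> w; apply: cvg_snd.
  move=> w; apply: (@continuous_max _ _ fst (cst 0)); [exact: cvg_fst|exact: cvg_cst].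
have pD w : D (p w).
  by rewrite DE; split => //=; split; rewrite ?le_max ?lexx ?orbT// ltry.
have /subspace_continuousP := cf; move=> /(_ (p z) (pD z)) fp.
apply: (@cvg_comp _ _ _ p f _ _ _ _ fp).
move=> A hA; change (nbhs z (p @^-1` A)); have := cp z _ hA.
by apply: (@filterS _ (nbhs z)) => w h; exact: (h (pD w)).
Qed.

Lemma max0_ge0 (t : R) : 0 <= t -> Num.max t 0 = t.
Proof. by move=> t0; apply/max_idPl. Qed.

Lemma test_slab (W : normedModType R) (s1 s2 A : R) (phi : R * space -> W) :
  C1 phi -> (forall t x, s1 <= t <= s2 -> A < enorm x -> phi (t, x) = 0) ->
  test_function (`[s1, s2] `*` setT) phi.
Proof.
move=> cphi sphi; split => //; exists (`[s1, s2] `*` cball A).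
  split; first by apply: compact_setX; [exact: segment_compact|exact: compact_cball].
  by move=> z [].
move=> [t x] [/= ts _] nK; apply: sphi; first by move: ts; rewrite in_itv.
by rewrite ltNge; apply/negP => xA; apply: nK.
Qed.

Lemma solution_flow_ext gamma (rho : R -> space -> R) (u : R -> space -> space) rho0 u0
    (r : R -> space -> R) (v : R -> space -> space) :
  (forall t, 0 <= t -> r t = rho t) -> (forall t, 0 <= t -> v t = u t) ->
  (forall t, exists2 s, 0 <= s & r t = r s) ->
  continuous (fun z : R * space => r z.1 z.2) ->
  continuous (fun z : R * space => v z.1 z.2) ->
  admissible_solution gamma +oo%E rho u rho0 u0 ->
  euler_flow gamma r v.
Proof.
move=> Er Ev rs cr cv [weak rho0E u0E adm].
split.
- exact: cr.
- move=> j z; apply: (@continuous_comp _ _ _ (fun z : R * space => v z.1 z.2) (fun x : space => x ord0 j)).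
    exact: cv.
  exact: continuous_coord_rV.
- move=> t x; have [s s0 ->] := rs t.
  apply: (ae_ge0_continuous (continuous_section (t := s) cr)); rewrite Er//.
  by apply: (weak_density_ge0 weak); split => //; exact: ltry.
- move=> t1 t2 A phi phit phix t10 t12 Cphi sphi.
  have t20 : 0 <= t2 by apply: le_trans t10 (ltW t12).
  have := weak_mass weak t10 t12 (ltry t2) (test_slab (C1_with_C1 Cphi) sphi).
  rewrite -(Er t1 t10) -(Er t2 t20) => ->.
  apply: eq_dblint => t x /andP[t1t _]; have t0 := le_trans t10 t1t.
  rewrite Er// Ev// (C1_with_dt Cphi); congr (_ + _ * _).
  by apply: eq_bigr => j _; rewrite mxE (C1_with_dx _ Cphi).
- move=> t1 t2 A psi psit psix t10 t12 Cpsi spsi.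
  have t20 : 0 <= t2 by apply: le_trans t10 (ltW t12).
  have spsi' t x : t1 <= t <= t2 -> A < enorm x -> vect_of psi (t, x) = 0.
    by move=> tt xA; apply/rowP => i; rewrite vect_ofE mxE; exact: (spsi i).
  have dotE (w : space) t x : dotp w (vect_of psi (t, x)) = \sum_i w ord0 i * psi i (t, x).
    by apply: eq_bigr => i _; rewrite vect_ofE.
  have intE t : \int[mu]_x (r t x * \sum_i v t x ord0 i * psi i (t, x)) =
      \int[mu]_x (r t x * dotp (v t x) (vect_of psi (t, x))).
    by apply: eq_Rintegral => x _; rewrite dotE.
  have := weak_momentum weak t10 t12 (ltry t2) (test_slab (vect_of_C1 Cpsi) spsi').
  rewrite !intE -(Er t1 t10) -(Er t2 t20) -(Ev t1 t10) -(Ev t2 t20) => ->.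
  apply: eq_dblint => t x /andP[t1t _]; have t0 := le_trans t10 t1t.
  rewrite Er// Ev//; congr (_ * _ + _ * _ + _ * _).
  + by apply: eq_bigr => j _; rewrite (vect_of_dt Cpsi).
  + by apply: eq_bigr => i _; apply: eq_bigr => j _; rewrite (vect_of_dx Cpsi).
  + by apply: eq_bigr => j _; rewrite (vect_of_dx Cpsi).
- move=> tau A phi phit phix tau0 Cphi phi0 sphi tphi.
  have tf : test_function (lifespan +oo%E `*` setT) phi.
    split; first exact: C1_with_C1 Cphi.
    exists (`[0, tau] `*` cball A).
      split; first by apply: compact_setX; [exact: segment_compact|exact: compact_cball].
      move=> [t x] [/= ts _]; split => //=; split; last exact: ltry.
      by move: ts; rewrite in_itv/= => /andP[].
    move=> [t x] [/= [t0 _] _] nK; have [tt|tt] := leP tau t; first by have [] := tphi t x tt.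
    apply: sphi => //; rewrite ltNge; apply/negP => xA; apply: nK; split => //=.
    by rewrite in_itv/= t0 ltW.
  have phi0' t x : @lifespan R +oo t -> 0 <= phi (t, x) by move=> [t0 _]; exact: phi0.
  have := adm _ tf phi0'.
  have -> : \int[mu]_x (energy gamma (rho0 x) (u0 x) * phi (0, x)) =
      \int[mu]_x (energy gamma (r 0 x) (v 0 x) * phi (0, x)).
    by rewrite rho0E u0E (Er 0 (lexx 0)) (Ev 0 (lexx 0)).
  set I1 := (X in X + _); set I2 := dblint _ _ _; suff -> : I1 = I2 by [].
  rewrite {}/I1 {}/I2 /dblint Rintegral_mkcond [RHS]Rintegral_mkcond.
  apply: eq_Rintegral => t _; rewrite !patchE.
  have [tl|tl] := pselect (0 <= t <= tau).
    have /andP[t0 _] := tl.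
    rewrite !mem_set//=; last by split => //; exact: ltry.
    apply: eq_Rintegral => x _; rewrite Er// Ev// (C1_with_dt Cphi).
    congr (_ + _ * _); by apply: eq_bigr => j _; rewrite mxE (C1_with_dx _ Cphi).
  rewrite [X in _ = if X then _ else _]memNset//.
  case: ifPn => //; rewrite inE /= => -[t0 _].
  have tt : tau <= t by rewrite leNgt; apply/negP => h; apply: tl; rewrite t0 ltW.
  transitivity (\int[mu]_x (cst 0 x : R)); last by rewrite Rintegral_cst// mul0r.
  apply: eq_Rintegral => x _; have [_ [h1 h2]] := tphi t x tt.
  rewrite (C1_with_dt Cphi) h1 mulr0 add0r /dotp big1 ?mulr0// => j _.
  by rewrite mxE (C1_with_dx _ Cphi) h2 mulr0.
Qed.

(** A solution on nonnegative times is extended to negative times by its initial state. *)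
Lemma solution_flow gamma (rho : R -> space -> R) (u : R -> space -> space) rho0 u0 :
  {within lifespan +oo%E `*` [set: space], continuous (fun z : R * space => rho z.1 z.2)} ->
  {within lifespan +oo%E `*` [set: space], continuous (fun z : R * space => u z.1 z.2)} ->
  admissible_solution gamma +oo%E rho u rho0 u0 ->
  euler_flow gamma (fun t => rho (Num.max t 0)) (fun t => u (Num.max t 0)).
Proof.
move=> crho cu; apply: solution_flow_ext.
- by move=> t t0; rewrite (max0_ge0 t0).
- by move=> t t0; rewrite (max0_ge0 t0).
- have m0 (t : R) : 0 <= Num.max t 0 by rewrite le_max lexx orbT.
  by move=> t; exists (Num.max t 0) => //; rewrite (max0_ge0 (m0 t)).
- exact: (continuous_max0 erefl crho).
- exact: (continuous_max0 erefl cu).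
Qed.

End flow.

(** * Test functions for cones and balls *)

Section C1_examples.
Context {R : realType} {d : nat}.
Local Notation space := 'rV[R]_d.

Lemma C1_with_is_derive_t (f ft : R * space -> R) fx : C1_with f ft fx ->
  forall (t : R) x, is_derive t (1 : R) (fun s => f (s, x)) (ft (t, x)).
Proof.
move=> Cf t x; have Hf := C1_is_diff Cf (t, x).
have Hp := is_diff_pair (is_diff_id t) (is_diff_cst x t).
have H := @is_diff_comp _ _ _ _ (fun s : R => (id s, cst x s)) _ f _ t Hp Hf.
rewrite (_ : (fun s => f (s, x)) = f \o (fun s : R => (id s, cst x s)))//.
apply: DeriveDef.
  by apply/derivable1_diffP; apply: ex_diff.
rewrite -derive1E derive1E'; last exact: ex_diff.
rewrite diff_val /= /total_diff /= mul1r big1 ?addr0// => j _.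
by rewrite mxE mul0r.
Qed.

Lemma C1_with_sqdist (x0 : space) :
  C1_with (fun z : R * space => dotp (z.2 - x0) (z.2 - x0)) (cst 0)
    (fun j z => 2 * (z.2 ord0 j - x0 ord0 j)).
Proof.
have H (i : 'I_d) := C1_with_add (@C1_with_coord R d i) (C1_with_cst (- x0 ord0 i)).
have := C1_with_sum (fun i => C1_with_mul (H i) (H i)).
move/C1_with_ext; apply => [z|z|j z] /=.
- by apply: eq_bigr => i _; rewrite !mxE.
- by rewrite big1// => i _; rewrite !addr0 !mulr0 addr0.
- rewrite (bigD1 j)//= big1; first by rewrite !addr0 eqxx mulr1; ring.
  by move=> i /negPf ->; rewrite !addr0 !mulr0 addr0.
Qed.

(** For 0 <= t <= tau <= r1 / k this is supported in the backward cone
|x - x0| <= r1 - k t. Squared radii keep it C1 at the axis of the cone. *)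
Definition cone_fun (tau r1 k : R) (x0 : space) (z : R * space) : R :=
  possq (tau - z.1) * possq ((r1 - k * z.1) ^+ 2 - dotp (z.2 - x0) (z.2 - x0)).

Definition cone_fun_t (tau r1 k : R) (x0 : space) (z : R * space) : R :=
  let s := (r1 - k * z.1) ^+ 2 - dotp (z.2 - x0) (z.2 - x0) in
  - (dpossq (tau - z.1) * possq s) +
  possq (tau - z.1) * dpossq s * (- 2 * k * (r1 - k * z.1)).

Definition cone_fun_x (tau r1 k : R) (x0 : space) (j : 'I_d) (z : R * space) : R :=
  let s := (r1 - k * z.1) ^+ 2 - dotp (z.2 - x0) (z.2 - x0) in
  possq (tau - z.1) * dpossq s * (- 2 * (z.2 ord0 j - x0 ord0 j)).

Lemma C1_with_possq_time tau : C1_with (fun z : R * space => possq (tau - z.1))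
  (fun z => - dpossq (tau - z.1)) (fun=> cst 0).
Proof.
have T := C1_with_add (C1_with_cst tau) (C1_with_scale (-1) (@C1_with_time R d)).
have := C1_with_comp T (@is_derive_possq R) (@continuous_dpossq R).
move/C1_with_ext; apply => [z|z|j z] /=; rewrite ?mulN1r//.
  by rewrite add0r mulrN mulr1.
by rewrite oppr0 addr0 mulr0.
Qed.

Lemma C1_with_cone_fun tau r1 k x0 : C1_with (cone_fun tau r1 k x0)
  (cone_fun_t tau r1 k x0) (cone_fun_x tau r1 k x0).
Proof.
have T := C1_with_add (C1_with_cst r1) (C1_with_scale (- k) (@C1_with_time R d)).
have S := C1_with_add (C1_with_mul T T) (C1_with_scale (-1) (C1_with_sqdist x0)).
have P := C1_with_comp S (@is_derive_possq R) (@continuous_dpossq R).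
have := C1_with_mul (C1_with_possq_time tau) P.
have sE (z : R * space) : (r1 + - k * z.1) * (r1 + - k * z.1) + -1 * dotp (z.2 - x0) (z.2 - x0)
  = (r1 - k * z.1) ^+ 2 - dotp (z.2 - x0) (z.2 - x0) by ring.
move/C1_with_ext; apply => [z|z|j z] /=; rewrite /cone_fun /cone_fun_t /cone_fun_x /= sE //.
- by ring.
- by ring.
Qed.

Definition bump_fun (A : R) (z : R * space) : R := plateau (dotp z.2 z.2 - A ^+ 2).
Definition bump_fun_x (A : R) (j : 'I_d) (z : R * space) : R :=
  dplateau (dotp z.2 z.2 - A ^+ 2) * (2 * z.2 ord0 j).

Lemma C1_with_bump_fun A : C1_with (bump_fun A) (cst 0) (bump_fun_x A).
Proof.
have S := C1_with_add (C1_with_sqdist 0) (C1_with_cst (- A ^+ 2)).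
have := C1_with_comp S (@is_derive_plateau R) (@continuous_dplateau R).
move/C1_with_ext; apply => [z|z|j z] /=; rewrite /bump_fun /bump_fun_x ?subr0//.
  by rewrite addr0 mulr0.
by rewrite mxE subr0 addr0.
Qed.

Lemma bump_fun_in A x t : 0 <= A -> enorm x <= A -> bump_fun A (t, x) = 1.
Proof.
move=> A0 xA; rewrite /bump_fun plateau_le0//= -sqr_enorm subr_le0.
by rewrite ler_pXn2r// nnegrE enorm_ge0.
Qed.

Lemma bump_fun_x_in A j x t : 0 <= A -> enorm x <= A -> bump_fun_x A j (t, x) = 0.
Proof.
move=> A0 xA; rewrite /bump_fun_x dplateau_le0 ?mul0r//= -sqr_enorm subr_le0.
by rewrite ler_pXn2r// nnegrE enorm_ge0.
Qed.

Lemma bump_out A (x : space) : 0 <= A -> A + 1 < enorm x -> 1 <= dotp x x - A ^+ 2.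
Proof. by move=> A0 xA; rewrite -sqr_enorm; nra. Qed.

Lemma bump_fun_out A x t : 0 <= A -> A + 1 < enorm x -> bump_fun A (t, x) = 0.
Proof. by move=> A0 xA; rewrite /bump_fun plateau_ge1//; exact: bump_out. Qed.

Lemma bump_fun_x_out A j x t : 0 <= A -> A + 1 < enorm x -> bump_fun_x A j (t, x) = 0.
Proof.
by move=> A0 xA; rewrite /bump_fun_x dplateau_ge1 ?mul0r//; exact: bump_out.
Qed.

End C1_examples.

(** * The relative energy inequality *)

(** At a zero of f, the power is squeezed between 0 and f, as p >= 1. *)
Lemma continuous_powR_ge1 {R : realType} (T : topologicalType) (f : T -> R) (p : R) :
  1 < p -> continuous f -> (forall z, 0 <= f z) -> continuous (fun z => f z `^ p).
Proof.
move=> p1 cf f0 z; have p0 : 0 < p by exact: lt_trans p1.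
have := f0 z; rewrite le_eqVlt => /predU1P[fz|fz]; last first.
  apply: (@continuous_comp _ _ _ f (@powR R ^~ p)); first exact: cf.
  apply: differentiable_continuous; apply/derivable1_diffP.
  by have H := is_derive1_powR p fz; apply: ex_derive.
rewrite /continuous_at -fz powR0 ?gt_eqF//.
apply/cvgrPdist_lt => e e0; near=> w.
rewrite sub0r normrN ger0_norm ?powR_ge0//.
have fw1 : f w < 1.
  by near: w; move/cvgr_lt : (cf z); apply; rewrite -fz.
have fwe : f w < e.
  by near: w; move/cvgr_lt : (cf z); apply; rewrite -fz.
have := f0 w; rewrite le_eqVlt => /predU1P[<-|fw]; first by rewrite powR0 ?gt_eqF.
by apply: le_lt_trans fwe; apply: ge1r_powR; [rewrite fw ltW|exact: ltW].
Unshelve. all: by end_near. Qed.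

Section relative_energy.
Context {R : realType} {d : nat}.
Local Notation space := 'rV[R]_d.
Local Notation mu := (@lebesgue_rV R d).
Local Notation leb := (@lebesgue_measure R).
Variables (gamma rb : R) (r : R -> space -> R) (v : R -> space -> space).
Hypotheses (gamma1 : 1 < gamma) (rb0 : 0 < rb) (F : euler_flow gamma r v).

Definition relative_energy_density t x : R := relen gamma rb (r t x) (enorm (v t x)).
Definition overpressure_density t x : R := r t x `^ gamma - rb `^ gamma.
Local Notation eta := relative_energy_density.
Local Notation overpressure := overpressure_density.

Let cr := flow_cont_density F.
Let cv := flow_cont_velocity F.

Lemma continuous_pressure : continuous (fun z : R * space => r z.1 z.2 `^ gamma).
Proof.
apply: (@continuous_powR_ge1 _ _ (fun z : R * space => r z.1 z.2)) => //.
by move=> z; exact: (flow_density_ge0 F).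
Qed.

Lemma continuous_overpressure : continuous (fun z : R * space => overpressure z.1 z.2).
Proof. by apply: continuous_sub; [exact: continuous_pressure|exact: cst_continuous]. Qed.

Lemma continuous_sqr_speed : continuous (fun z : R * space => enorm (v z.1 z.2) ^+ 2).
Proof.
under eq_fun do rewrite sqr_enorm.
by apply: continuous_bigsum => j; apply: continuous_mul; exact: cv.
Qed.

Lemma continuous_eta : continuous (fun z : R * space => eta z.1 z.2).
Proof.
apply: continuous_add.
  apply: continuous_mul; last exact: cst_continuous.
  by apply: continuous_mul; [exact: cr|exact: continuous_sqr_speed].
apply: continuous_mul; first exact: cst_continuous.
apply: continuous_sub; first exact: continuous_overpressure.
apply: continuous_mul; first exact: cst_continuous.
by apply: continuous_sub; [exact: cr|exact: cst_continuous].
Qed.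

Lemma eta_ge0 t x : 0 <= eta t x.
Proof. by apply: relen_ge0 => //; exact: (flow_density_ge0 F). Qed.

Lemma energyE t x : energy gamma (r t x) (v t x) =
  eta t x + (gamma - 1)^-1 * gamma * rb `^ (gamma - 1) * r t x - rb `^ gamma.
Proof.
rewrite /energy /potential /relative_energy_density /relen /relpot.
rewrite -(mulr_powRB1 (ltW rb0) (lt_trans ltr01 gamma1)).
by field; rewrite subr_eq0 gt_eqF.
Qed.

(** The energy inequality, minus a multiple of the mass equation, plus a multiple of the
fundamental theorem of calculus for phi; the multiples are those of [energyE]. Times
above -1 are used so that [0, tau] lies in the interior of the slab. *)
Lemma relative_energy tau A phi phit phix : 0 < tau -> C1_with phi phit phix ->
  (forall t x, 0 <= t -> 0 <= phi (t, x)) ->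
  (forall t x, -1 < t -> A < enorm x -> [/\ phi (t, x) = 0, phit (t, x) = 0 &
    forall j, phix j (t, x) = 0]) ->
  (forall t x, tau <= t -> [/\ phi (t, x) = 0, phit (t, x) = 0 &
    forall j, phix j (t, x) = 0]) ->
  0 <= dblint 0 tau (fun t x => eta t x * phit (t, x) +
      (eta t x + overpressure t x) * \sum_j v t x ord0 j * phix j (t, x)) +
    \int[mu]_x (eta 0 x * phi (0, x)).
Proof.
move=> tau0 C phi0 sphi tphi.
have [_ Ct Cx] := C.
have etaC (f : R * space -> R) : (fun z : R * space => f (z.1, z.2)) = f.
  by apply/funext => -[].
have Sphi : slab A (-1) (tau + 1) (fun t x => phi (t, x)).
  split; first by rewrite etaC; exact: C1_with_cont C.
  by move=> t /andP[t1 _] x xA; have [] := sphi t x t1 xA.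
have Sphit : slab A (-1) (tau + 1) (fun t x => phit (t, x)).
  split; first by rewrite etaC.
  by move=> t /andP[t1 _] x xA; have [] := sphi t x t1 xA.
have Sphix j : slab A (-1) (tau + 1) (fun t x => phix j (t, x)).
  split; first by rewrite etaC.
  by move=> t /andP[t1 _] x xA; have [_ _ ->] := sphi t x t1 xA.
have Svx : slab A (-1) (tau + 1) (fun t x => \sum_j v t x ord0 j * phix j (t, x)).
  by apply: slab_sum => j; apply: slab_mul => //; exact: cv.
pose a := (gamma - 1)^-1 * gamma * rb `^ (gamma - 1).
have Fm := @flow_mass _ _ _ _ _ F 0 tau A _ _ _ (lexx 0) tau0 C.
have /Fm {}Fm : forall t x, 0 <= t <= tau -> A < enorm x -> phi (t, x) = 0.
  move=> t x /andP[t0 _] xA; have [] // := sphi t x _ xA.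
  by apply: lt_le_trans t0; rewrite oppr_lt0.
have Fe := @flow_energy _ _ _ _ _ F tau A _ _ _ tau0 C phi0.
have /Fe {}Fe : forall t x, 0 <= t -> A < enorm x -> phi (t, x) = 0.
  move=> t x t0 xA; have [] // := sphi t x _ xA.
  by apply: lt_le_trans t0; rewrite oppr_lt0.
have /Fe {}Fe : forall t x, tau <= t -> phi (t, x) = 0 /\ phit (t, x) = 0 /\
    forall j, phix j (t, x) = 0.
  by move=> t x tt; have [] := tphi t x tt.
have b1 : -1 < (0 : R) by rewrite oppr_lt0.
have b2 : tau < tau + 1 by rewrite ltrDl.
have Fc := dblint_FTC Sphi Sphit (fun t x _ => C1_with_is_derive_t C t x) b1 tau0 b2.
have tauE (f : space -> R) : \int[mu]_x (f x * phi (tau, x)) = 0.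
  transitivity (\int[mu]_x (cst 0 x : R)); last by rewrite Rintegral_cst// mul0r.
  by apply: eq_Rintegral => x _; have [-> _ _] := tphi tau x (lexx _); rewrite mulr0.
have tauE1 : \int[mu]_x (phi (tau, x)) = 0.
  transitivity (\int[mu]_x (cst 0 x : R)); last by rewrite Rintegral_cst// mul0r.
  by apply: eq_Rintegral => x _; have [-> _ _] := tphi tau x (lexx _).
rewrite tauE in Fm; rewrite tauE1 in Fc.
pose G1 t x := eta t x * phit (t, x) +
      (eta t x + overpressure t x) * \sum_j v t x ord0 j * phix j (t, x).
pose G2 t x := r t x * phit (t, x) + r t x * \sum_j v t x ord0 j * phix j (t, x).
pose G3 t x := phit (t, x).
have SG1 : slab A (-1) (tau + 1) G1.
  apply: slab_add; apply: slab_mul => //; first exact: continuous_eta.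
  by apply: continuous_add; [exact: continuous_eta|exact: continuous_overpressure].
have SG2 : slab A (-1) (tau + 1) G2.
  by apply: slab_add; apply: slab_mul.
have EG : dblint 0 tau (fun t x => energy gamma (r t x) (v t x) * phit (t, x) +
        (energy gamma (r t x) (v t x) + r t x `^ gamma) *
          \sum_j v t x ord0 j * phix j (t, x)) =
    dblint 0 tau G1 + a * dblint 0 tau G2 - rb `^ gamma * dblint 0 tau G3.
  rewrite -mulNr -(dblintZ a SG2 b1 b2) -(dblintZ (- rb `^ gamma) Sphit b1 b2).
  rewrite -(dblintD SG1 (slab_scale a SG2) b1 b2).
  rewrite -(dblintD (slab_add SG1 (slab_scale a SG2)) (slab_scale _ Sphit) b1 b2).
  apply: eq_dblint => t x _; rewrite energyE /G1 /G2 /G3 /a /overpressure_density; ring.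
have z0 : -1 < (0 : R) < tau + 1 by rewrite b1 addr_gt0.
have S1 : slab A (-1) (tau + 1) (fun t x => eta t x * phi (t, x)).
  by apply: slab_mul => //; exact: continuous_eta.
have S2 : slab A (-1) (tau + 1) (fun t x => r t x * phi (t, x)).
  by apply: slab_mul.
have E0 : \int[mu]_x (energy gamma (r 0 x) (v 0 x) * phi (0, x)) =
    \int[mu]_x (eta 0 x * phi (0, x)) + a * \int[mu]_x (r 0 x * phi (0, x)) -
      rb `^ gamma * \int[mu]_x (phi (0, x)).
  rewrite -mulNr -(RintegralZ2 a S2 z0) -(RintegralZ2 (- rb `^ gamma) Sphi z0).
  rewrite -(RintegralD2 S1 (slab_scale a S2) z0).
  rewrite -(RintegralD2 (slab_add S1 (slab_scale a S2)) (slab_scale _ Sphi) z0).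
  by apply: eq_Rintegral => x _; rewrite energyE /a; ring.
rewrite EG E0 in Fe.
have -> : dblint 0 tau G1 + \int[mu]_x (eta 0 x * phi (0, x)) =
  dblint 0 tau G1 + a * dblint 0 tau G2 - rb `^ gamma * dblint 0 tau G3 +
  (\int[mu]_x (eta 0 x * phi (0, x)) + a * \int[mu]_x (r 0 x * phi (0, x)) -
      rb `^ gamma * \int[mu]_x (phi (0, x))); last by exact: Fe.
rewrite -[dblint 0 tau G2]Fm [dblint 0 tau G3]Fc; ring.
Qed.

End relative_energy.

(** * Finite speed of propagation *)

Section monotone.
Context {R : realType} {d : nat}.
Local Notation space := 'rV[R]_d.
Local Notation mu := (@lebesgue_rV R d).
Local Notation leb := (@lebesgue_measure R).

Lemma le_dblint A a b (g h : R -> space -> R) s1 s2 :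
  slab A a b g -> slab A a b h -> a < s1 -> s2 < b ->
  (forall t x, s1 <= t <= s2 -> g t x <= h t x) ->
  dblint s1 s2 g <= dblint s1 s2 h.
Proof.
move=> sg sh as1 s2b gh; apply: le_Rintegral => //.
- exact: (slab_time_integrable sg as1 s2b).
- exact: (slab_time_integrable sh as1 s2b).
- move=> t; rewrite /= in_itv/= => ts; have /andP[s1t ts2] := ts.
  have tab : a < t < b by rewrite (lt_le_trans as1 s1t) (le_lt_trans ts2 s2b).
  apply: le_Rintegral => //; [exact: (slab_integrable sg tab)|exact: (slab_integrable sh tab)|].
  by move=> x _; exact: gh.
Qed.

Lemma Rintegral_itv_eq0 (f : R -> R) (s1 s2 : R) :
  {within `[s1, s2], continuous f} -> (forall t, s1 <= t <= s2 -> 0 <= f t) ->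
  \int[leb]_(t in `[s1, s2]) f t <= 0 -> forall t, s1 < t < s2 -> {for t, continuous f} ->
  f t = 0.
Proof.
move=> cf f0 if0 t /andP[s1t ts2] ct; apply/eqP; rewrite eq_le; apply/andP; split; last first.
  by apply: f0; rewrite !ltW.
rewrite leNgt; apply/negP => ft.
pose c := f t / 2.
have c0 : 0 < c by rewrite divr_gt0.
have [e /= e0 He] : \forall s \near t, c < f s.
  have /cvgr_gt H : f s @[s --> t] --> f t by exact: ct.
  by apply: H; rewrite /c; lra.
pose p := Num.min (e / 2) (Num.min (t - s1) (s2 - t)).
have p0 : 0 < p by rewrite !lt_min !subr_gt0 s1t ts2 divr_gt0.
have pe : p <= e / 2 by rewrite /p ge_min lexx.
have p1 : p <= t - s1 by rewrite /p !ge_min lexx orbT.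
have p2 : p <= s2 - t by rewrite /p !ge_min lexx !orbT.
have intf : leb.-integrable `[s1, s2] (EFin \o f).
  by apply: continuous_compact_integrable => //; exact: segment_compact.
have mfi : measurable_fun `[s1, s2] (fun s => (f s)%:E) by case/integrableP: intf.
have sub : `[t - p, t + p]%classic `<=` `[s1, s2]%classic.
  by move=> s; rewrite /= !in_itv/= => /andP[? ?]; apply/andP; split; lra.
have H1 : (\int[leb]_(s in `[(t - p)%R, (t + p)%R]) (cst c s)%:E <= \int[leb]_(s in `[s1, s2]) (f s)%:E)%E.
  apply: (@le_trans _ _ (\int[leb]_(s in `[(t - p)%R, (t + p)%R]) (f s)%:E)%E).
    apply: ge0_le_integral => //.
    - by move=> s _; rewrite lee_fin ltW.
    - by apply/measurable_EFinP; exact: measurable_cst.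
    - exact: (measurable_funS (measurable_itv _) sub mfi).
    - move=> s; rewrite /= in_itv/= => /andP[h1 h2]; rewrite lee_fin ltW//.
      apply: He => /=; rewrite ltr_norml; lra.
  apply: ge0_subset_integral; [exact: measurable_itv|exact: measurable_itv|exact: mfi| |exact: sub].
  by move=> s; rewrite /= in_itv/= => ss; rewrite lee_fin f0.
have E : (\int[leb]_(s in `[(t - p)%R, (t + p)%R]) (cst c s)%:E =
    (c * (t + p - (t - p)))%:E)%E.
  apply: (etrans (integral_cst leb (measurable_itv `[t - p, t + p]) c%:E)).
  rewrite [RHS]EFinM; congr (_ * _)%E.
  apply: (etrans (lebesgue_measure_itv `[t - p, t + p])); rewrite /= lte_fin.
  by have -> : t - p < t + p by lra.
move: H1; rewrite E.
have fi : (\int[leb]_(s in `[s1, s2]) (f s)%:E)%E \is a fin_num by exact: integrable_fin_num.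
rewrite -(fineK fi) lee_fin => H1.
have : 0 < c * (t + p - (t - p)) by rewrite mulr_gt0//; lra.
by rewrite ltNge (le_trans H1 if0).
Qed.

Lemma left_limit_eq0 (f : R -> R) (s : R) : 0 < s -> {for s, continuous f} ->
  (forall t, 0 <= t < s -> f t = 0) -> f s = 0.
Proof.
move=> s0 cf f0; apply/eqP/negPn/negP => fs.
have [e /= e0 He] : \forall w \near s, f w != 0.
  have H : f w @[w --> s] --> f s by exact: cf.
  by apply: (cvgr_neq0 _ H).
pose w := Num.max (s - e / 2) (s / 2).
have w1 : s - e / 2 <= w by rewrite le_max lexx.
have w2 : s / 2 <= w by rewrite le_max lexx orbT.
have w3 : w < s by rewrite gt_max; apply/andP; split; lra.
have := He w; rewrite f0 ?eqxx; last by apply/andP; split; lra.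
by move=> h; suff : false by []; apply: h => /=; rewrite gtr0_norm; lra.
Qed.

End monotone.

Section propagation.
Context {R : realType} {d : nat}.
Local Notation space := 'rV[R]_d.
Local Notation mu := (@lebesgue_rV R d).
Variables (gamma rb : R) (r : R -> space -> R) (v : R -> space -> space).
Hypotheses (gamma1 : 1 < gamma) (rb0 : 0 < rb) (F : euler_flow gamma r v).
Local Notation eta := (relative_energy_density gamma rb r v).
Local Notation overpressure := (overpressure_density gamma rb r).

(** With phi = [cone_fun], the time derivative of the factor that describes the cone is
-2 k (r1 - k t) times a nonnegative weight, and the gradient is -2 (x - x0) times the
same weight. So the assumed flux bound makes the corresponding terms nonpositive, and the
relative energy inequality leaves the decreasing factor possq (tau - t): the integral
of eta against a weight that is positive inside the cone is nonpositive. *)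
Lemma cone_lemma (x0 : space) (k r1 tau : R) : 0 <= k -> 0 < tau -> k * tau <= r1 ->
  (forall t x, 0 <= t < tau -> enorm (x - x0) < r1 - k * t ->
    `|eta t x + overpressure t x| * enorm (v t x) <= k * eta t x) ->
  (forall x, enorm (x - x0) < r1 -> eta 0 x = 0) ->
  forall t x, 0 <= t < tau -> enorm (x - x0) < r1 - k * t -> eta t x = 0.
Proof.
move=> k0 tau0 ktau hflux eta00.
pose s t (x : space) := (r1 - k * t) ^+ 2 - dotp (x - x0) (x - x0).
have kt t : t < tau -> 0 <= r1 - k * t.
  by move=> tt; have := ler_wpM2l k0 (ltW tt); lra.
have s_gt0 t x : t < tau -> (0 < s t x) = (enorm (x - x0) < r1 - k * t).
  move=> tt; rewrite /s -sqr_enorm subr_gt0 ltr_pXn2r// nnegrE ?enorm_ge0//.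
  exact: kt.
(* Also valid for times slightly below 0, where the cone is wider than its base. *)
pose A := enorm x0 + `|r1| + k * (tau + 1) + 1.
have sA t x : -1 < t < tau + 1 -> A < enorm x -> s t x <= 0.
  move=> /andP[t1 t2] xA; rewrite /s -sqr_enorm subr_le0.
  have h1 := enorm_distr x x0.
  have h2 : `|r1 - k * t| <= enorm (x - x0).
    apply: le_trans (ler_normB _ _) _; rewrite normrM (ger0_norm k0).
    have : k * `|t| <= k * (tau + 1).
      by apply: ler_wpM2l => //; rewrite ler_norml; lra.
    by rewrite /A in xA; lra.
  by rewrite -(real_normK (num_real (r1 - k * t))) ler_pXn2r// nnegrE ?enorm_ge0.
have late t x : tau <= t -> [/\ cone_fun tau r1 k x0 (t, x) = 0,
    cone_fun_t tau r1 k x0 (t, x) = 0 & forall j, cone_fun_x tau r1 k x0 j (t, x) = 0].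
  move=> tt; have t0 : tau - t <= 0 by lra.
  by rewrite /cone_fun /cone_fun_t /cone_fun_x /= (possq_le0 t0) (dpossq_le0 t0)
    !mul0r oppr0 addr0; split => // j; rewrite mul0r.
have out t x : -1 < t -> A < enorm x -> [/\ cone_fun tau r1 k x0 (t, x) = 0,
    cone_fun_t tau r1 k x0 (t, x) = 0 & forall j, cone_fun_x tau r1 k x0 j (t, x) = 0].
  move=> t1 xA; have [tt|tt] := leP tau t; first exact: late.
  have st : s t x <= 0 by apply: sA => //; rewrite t1/=; lra.
  rewrite /cone_fun /cone_fun_t /cone_fun_x /= -/(s t x) (possq_le0 st) (dpossq_le0 st).
  by rewrite !mulr0 !mul0r oppr0 addr0; split => // j; rewrite mul0r.
have RE := relative_energy gamma1 rb0 F tau0 (C1_with_cone_fun tau r1 k x0) _ out late.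
have {}RE := RE (fun t x _ => mulr_ge0 (possq_ge0 _) (possq_ge0 _)).
pose g t x := eta t x * (dpossq (tau - t) * possq (s t x)).
have cs : continuous (fun z : R * space => s z.1 z.2).
  apply: continuous_sub.
    apply: continuous_expn; apply: continuous_sub; first exact: cst_continuous.
    by apply: continuous_mul; [exact: cst_continuous|move=> z; apply: cvg_fst].
  exact: (C1_with_cont (C1_with_sqdist x0)).
have ctau : continuous (fun z : R * space => tau - z.1).
  by apply: continuous_sub; [exact: cst_continuous|move=> z; apply: cvg_fst].
have Sg : slab A (-1) (tau + 1) g.
  split.
    apply: continuous_mul; first exact: (continuous_eta gamma1 F).
    apply: continuous_mul => z.
      by apply: (@continuous_comp _ _ _ (fun z : R * space => tau - z.1) dpossq);
        [exact: ctau|exact: continuous_dpossq].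
    by apply: (@continuous_comp _ _ _ (fun z : R * space => s z.1 z.2) possq);
      [exact: cs|exact: continuous_possq].
  by move=> t tt x xA; rewrite /g possq_le0 ?mulr0//; exact: sA.
have g0 t x : 0 <= g t x.
  exact: (mulr_ge0 (eta_ge0 gamma1 rb0 F t x) (mulr_ge0 (dpossq_ge0 _) (possq_ge0 _))).
have b1 : -1 < (0 : R) by rewrite oppr_lt0.
have b2 : tau < tau + 1 by rewrite ltrDl.
have int0 : \int[mu]_x (eta 0 x * cone_fun tau r1 k x0 (0, x)) = 0.
  transitivity (\int[mu]_x (cst 0 x : R)); last by rewrite Rintegral_cst// mul0r.
  apply: eq_Rintegral => x _.
  have [sx|sx] := leP (s 0 x) 0.
    by rewrite /cone_fun /= -/(s 0 x) (possq_le0 sx) !mulr0.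
  by rewrite eta00 ?mul0r//; move: sx; rewrite s_gt0// mulr0 subr0.
rewrite int0 addr0 in RE.
pose G t x := eta t x * cone_fun_t tau r1 k x0 (t, x) +
  (eta t x + overpressure t x) * \sum_j v t x ord0 j * cone_fun_x tau r1 k x0 j (t, x).
have cGf : continuous (fun z : R * space => G z.1 z.2).
  have [_ Ct Cx] := C1_with_cone_fun tau r1 k x0.
  have etaC (f : R * space -> R) : continuous f -> continuous (fun z : R * space => f (z.1, z.2)).
    by move=> cf; rewrite (_ : (fun z => _) = f)//; apply/funext => -[].
  apply: continuous_add; apply: continuous_mul.
  - exact: (continuous_eta gamma1 F).
  - exact: etaC.
  - apply: continuous_add; first exact: (continuous_eta gamma1 F).
    exact: (continuous_overpressure gamma1 F).
  - apply: continuous_bigsum => j; apply: continuous_mul; last exact: etaC.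
    exact: (flow_cont_velocity F).
have SG : slab A (-1) (tau + 1) G.
  split; first exact: cGf.
  move=> t /andP[t1 _] x xA; have [_ h1 h2] := out t x t1 xA.
  by rewrite /G h1 mulr0 add0r big1 ?mulr0// => j _; rewrite h2 mulr0.
have GE t x : G t x = - g t x + possq (tau - t) * dpossq (s t x) * 2 *
    (- (k * (r1 - k * t) * eta t x) -
      (eta t x + overpressure t x) * dotp (v t x) (x - x0)).
  rewrite /G /g /cone_fun_t /cone_fun_x /= -/(s t x).
  have -> : \sum_j v t x ord0 j * (possq (tau - t) * dpossq (s t x) *
      (-2 * (x ord0 j - x0 ord0 j))) =
      -2 * (possq (tau - t) * dpossq (s t x)) * dotp (v t x) (x - x0).
    rewrite /dotp mulr_sumr; apply: eq_bigr => j _; rewrite !mxE; ring.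
  ring.
have Gg t x : 0 <= t <= tau -> G t x <= -1 * g t x.
  move=> /andP[t0 tt]; rewrite GE mulN1r gerDl.
  move: tt; rewrite le_eqVlt => /predU1P[->|tt].
    by rewrite subrr possq_le0// !mul0r.
  have [st|st] := leP (s t x) 0; first by rewrite (dpossq_le0 st) mulr0 !mul0r.
  apply: mulr_ge0_le0; first by exact: (mulr_ge0 (mulr_ge0 (possq_ge0 _) (dpossq_ge0 _)) (ler0n _ _)).
  have xs : enorm (x - x0) < r1 - k * t by rewrite -s_gt0.
  have h1 := hflux t x; rewrite t0 tt in h1; have {}h1 := h1 isT xs.
  rewrite -opprD oppr_le0.
  have h2 : `|(eta t x + overpressure t x) * dotp (v t x) (x - x0)| <=
      k * eta t x * (r1 - k * t).
    rewrite normrM.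
    have h3 : `|dotp (v t x) (x - x0)| <= enorm (v t x) * enorm (x - x0).
      rewrite ler_norml dotp_le_enorm andbT lerNl.
      have := dotp_le_enorm (- v t x) (x - x0).
      by rewrite enormN -scaleN1r dotpZl mulN1r.
    apply: le_trans (ler_wpM2l (normr_ge0 _) h3) _; rewrite mulrA.
    by apply: ler_pM => //; rewrite ?mulr_ge0 ?enorm_ge0// ltW.
  by move: h2; rewrite ler_norml => /andP[h2 _]; lra.
have RE2 : dblint 0 tau G <= -1 * dblint 0 tau g.
  rewrite -(dblintZ (-1) Sg b1 b2).
  exact: (le_dblint SG (slab_scale (-1) Sg) b1 b2 Gg).
have g_le0 : dblint 0 tau g <= 0 by have := le_trans RE RE2; lra.
have cI := slab_integral_within Sg b1 b2.
have I0 t : 0 < t < tau -> \int[mu]_x g t x = 0.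
  move=> tt; apply: (Rintegral_itv_eq0 cI _ g_le0 tt).
    by move=> w _; apply: Rintegral_ge0 => x _; exact: g0.
  apply: (slab_integral_continuous Sg); have /andP[? ?] := tt; lra.
move=> t x /andP[]; rewrite le_eqVlt => /predU1P[<-|t0] tt xs.
  by apply: eta00; rewrite mulr0 subr0 in xs.
have tab : -1 < t < tau + 1 by lra.
have [cg sg] := Sg.
have : g t x = 0.
  apply: (Rintegral_eq0_continuous (continuous_section (t := t) cg) (sg t tab) (g0 t)).
  by rewrite I0// t0 tt.
have st : 0 < s t x by rewrite s_gt0.
have tt0 : 0 < tau - t by lra.
rewrite /g (possq_ge (ltW st)) (dpossq_ge (ltW tt0)) => /eqP.
rewrite !mulf_eq0 (gt_eqF st) (gt_eqF tt0) pnatr_eq0 !orbF.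
by move/eqP.
Qed.

End propagation.

Section finite_speed.
Context {R : realType} {d : nat}.
Local Notation space := 'rV[R]_d.
Local Notation mu := (@lebesgue_rV R d).
Variables (gamma rb : R) (r : R -> space -> R) (v : R -> space -> space).
Hypotheses (gamma1 : 1 < gamma) (rb0 : 0 < rb) (F : euler_flow gamma r v).
Local Notation eta := (relative_energy_density gamma rb r v).
Local Notation overpressure := (overpressure_density gamma rb r).
Local Notation sigma := (sound_speed gamma rb).

Definition deviation t x : R := Num.max `|r t x - rb| (enorm (v t x)).

Lemma deviation_eq0 t x : deviation t x = 0 -> r t x = rb /\ v t x = 0.
Proof.
move=> D0; split.
  apply/eqP; rewrite -subr_eq0 -normr_le0 -D0.
  by rewrite /deviation le_max lexx.
apply: enorm_eq0; apply/eqP; rewrite eq_le enorm_ge0 andbT -D0.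
by rewrite /deviation le_max lexx orbT.
Qed.

Lemma deviation0 t x : r t x = rb -> v t x = 0 -> deviation t x = 0.
Proof. by move=> h1 h2; rewrite /deviation h1 h2 subrr normr0 enorm0 maxxx. Qed.

Lemma eta_background t x : r t x = rb -> v t x = 0 -> eta t x = 0.
Proof.
move=> h1 h2; rewrite /relative_energy_density h1 h2 enorm0 /relen /relpot !subrr.
by rewrite expr0n/= !mulr0 subrr mulr0 mul0r addr0.
Qed.

Lemma continuous_deviation : continuous (fun z : R * space => deviation z.1 z.2).
Proof.
have c1 : continuous (fun z : R * space => `|r z.1 z.2 - rb|).
  move=> z; apply: (@continuous_comp _ _ _ (fun z : R * space => r z.1 z.2 - rb) (fun y : R => `|y|)).
    by apply: continuous_sub; [exact: (flow_cont_density F)|exact: cst_continuous].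
  exact: norm_continuous.
have c2 : continuous (fun z : R * space => enorm (v z.1 z.2)).
  move=> z; apply: (@continuous_comp _ _ _ (fun z : R * space => dotp (v z.1 z.2) (v z.1 z.2)) (@Num.sqrt R)).
    have H : continuous (fun z : R * space => dotp (v z.1 z.2) (v z.1 z.2)).
      apply: continuous_bigsum => j.
      by apply: continuous_mul; exact: (flow_cont_velocity F).
    exact: H.
  exact: sqrt_continuous.
move=> z; apply: (@continuous_max _ _ (fun z : R * space => `|r z.1 z.2 - rb|)
  (fun z : R * space => enorm (v z.1 z.2))); [exact: c1|exact: c2].
Qed.

(** The cone |x - x0| <= r1 - k t has (t0, x0) on its axis. The base radius
r1 = |x0| - R0 places the base in the region of constant initial state, and k between
sigma and r1 / t0 makes the cone reach beyond time t0. *)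
Lemma finite_propagation (R0 : R) :
  (forall x, R0 <= enorm x -> r 0 x = rb /\ v 0 x = 0) ->
  forall t x, 0 <= t -> R0 + sigma * t < enorm x -> r t x = rb /\ v t x = 0.
Proof.
move=> bg0 t0 x0; rewrite le_eqVlt => /predU1P[<-|t00] x0R.
  by apply: bg0; rewrite mulr0 addr0 in x0R; exact: ltW.
pose r1 := enorm x0 - R0.
(* Strictly between sigma and r1 / t0. *)
pose k := (sigma + r1 / t0) / 2.
have s0 : 0 < sigma by exact: (sound_speed_gt0 gamma1 rb0).
have r1t : sigma < r1 / t0 by rewrite ltr_pdivlMr// /r1; lra.
have sk : sigma < k by rewrite /k; lra.
have kt0 : k * t0 < r1 by rewrite -ltr_pdivlMr// /k; lra.
have k0 : 0 < k by lra.
have [e e0 He] := flux_local gamma1 rb0 sk.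
have ball_bg x : enorm (x - x0) <= r1 -> r 0 x = rb /\ v 0 x = 0.
  move=> xx; apply: bg0; have := enorm_distr x0 x.
  by rewrite -(enormN (x0 - x)) opprB; move: xx; rewrite /r1; lra.
have key T : 0 < T -> T <= t0 ->
    (forall t x, 0 <= t < T -> enorm (x - x0) <= r1 - k * t -> deviation t x < e) ->
    forall x, enorm (x - x0) <= r1 - k * T -> deviation T x = 0.
  move=> T0 Tt0 dev x xT.
  have kT : k * T <= r1 by apply: le_trans (ltW kt0); apply: ler_wpM2l => //; exact: ltW.
  have loc t y : 0 <= t < T -> enorm (y - x0) < r1 - k * t ->
      `|eta t y + overpressure t y| * enorm (v t y) <= k * eta t y /\
      (eta t y = 0 -> r t y = rb /\ enorm (v t y) = 0).
    move=> tT yt; have := dev t y tT (ltW yt).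
    rewrite /deviation gt_max => /andP[h1 h2].
    by apply: He => //; rewrite enorm_ge0.
  have E0 := @cone_lemma R d gamma rb r v gamma1 rb0 F x0 k r1 T (ltW k0) T0 kT
    (fun t y tT yt => (loc t y tT yt).1) _.
  have {}E0 := E0 (fun y yr => let: conj h1 h2 := ball_bg y (ltW yr) in eta_background h1 h2).
  have cT : continuous (fun t => deviation t x).
    by apply: (@continuous_section1 R d deviation x); exact: continuous_deviation.
  apply: (left_limit_eq0 T0 (cT T)) => t tT.
  have xt : enorm (x - x0) < r1 - k * t.
    have /andP[_ tT'] := tT; have : k * t < k * T by rewrite ltr_pM2l.
    lra.
  have [_ h] := loc t x tT xt; have [h1 h2] := h (E0 t x tT xt).
  by apply: deviation0 => //; exact: enorm_eq0.
suff Bempty t x : 0 <= t < t0 -> enorm (x - x0) <= r1 - k * t -> deviation t x < e.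
  apply: deviation_eq0; apply: (key t0 t00 (lexx _) Bempty).
  by rewrite subrr enorm0 subr_ge0 ltW.
pose K := `[0, t0]%classic `*` cube x0 r1.
pose B := [set z : R * space | enorm (z.2 - x0) + k * z.1 <= r1] `&`
  [set z : R * space | e <= deviation z.1 z.2].
have clB : closed B.
  apply: closedI.
    rewrite (_ : mkset _ = (fun z : R * space => enorm (z.2 - x0) + k * z.1) @^-1` [set y | y <= r1])//.
    apply: closed_comp; last exact: closed_le.
    move=> z _.
    have c : continuous (fun z : R * space => enorm (z.2 - x0) + k * z.1).
      apply: continuous_add.
        move=> w; apply: (@continuous_comp _ _ _ (fun z : R * space => dotp (z.2 - x0) (z.2 - x0)) (@Num.sqrt R)).
          exact: (C1_with_cont (C1_with_sqdist x0)).
        exact: sqrt_continuous.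
      by apply: continuous_mul; [exact: cst_continuous|move=> w; apply: cvg_fst].
    exact: c.
  rewrite (_ : mkset _ = (fun z : R * space => deviation z.1 z.2) @^-1` [set y | e <= y])//.
  apply: closed_comp; last exact: closed_ge.
  by move=> z _; exact: continuous_deviation.
have cK : compact K by apply: compact_setX; [exact: segment_compact|exact: compact_cube].
have cKB : compact (K `&` B).
  by apply: compact_closedI.
have inK t' x' : 0 <= t' <= t0 -> enorm (x' - x0) <= r1 - k * t' -> K (t', x').
  move=> tt xt; split => //=.
  move=> i; rewrite /= in_itv/= -ler_distl.
  have := coord_le_enorm (x' - x0) i; rewrite !mxE => h.
  apply: (le_trans h); apply: (le_trans xt).
  by have /andP[h0 _] := tt; have := mulr_ge0 (ltW k0) h0; lra.
have [KB0|/eqP KBn] := eqVneq (K `&` B) set0.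
  move=> /andP[h1 h2] xt; rewrite ltNge; apply/negP => de.
  have : (K `&` B) (t, x).
    split; first by apply: inK => //; rewrite h1 ltW.
    by split => //=; lra.
  by rewrite KB0.
exfalso.
have KBne : K `&` B !=set0 by apply/set0P/eqP.
have cfst : {within (K `&` B), continuous (fun z : R * space => z.1)}.
  by apply: continuous_subspaceT => z; apply: cvg_fst.
(* The first time at which the cone contains a large deviation. *)
have [[ts xs] /set_mem[[/= + _] [/= xts Ds]] tmin] := compact_EVT_min KBne cKB cfst.
rewrite in_itv/= => /andP[ts0 tst0].
have xts' : enorm (xs - x0) <= r1 - k * ts by lra.
have ts00 : 0 < ts.
  rewrite lt_neqAle ts0 andbT; apply/eqP => ts0E.
  have [h1 h2] : r 0 xs = rb /\ v 0 xs = 0.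
    by apply: ball_bg; rewrite -ts0E mulr0 subr0 in xts'.
  by move: Ds; rewrite -ts0E (deviation0 h1 h2) leNgt e0.
suff D0 : deviation ts xs = 0 by move: Ds; rewrite D0 leNgt e0.
apply: (key ts ts00 tst0) => // w y /andP[w0 wts] yw.
rewrite ltNge; apply/negP => de.
have KBw : (K `&` B) (w, y).
  split; first by apply: inK => //; rewrite w0 (le_trans (ltW wts)).
  by split => //=; lra.
have := tmin (w, y) (mem_set KBw).
by rewrite /= leNgt wts.
Qed.

End finite_speed.

(** * Bounds by balls, and the divergence of the truncated position field *)

Lemma is_derive_expn {R : realType} n (s : R) :
  is_derive s (1 : R) (fun s : R => s ^+ n) (n%:R * s ^+ n.-1).
Proof.
have H := @is_deriveX _ _ (@idfun R) n s 1 1 (is_derive_id _ _).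
rewrite (_ : (fun s : R => s ^+ n) = (@idfun R) ^+ n).
  by apply: (is_derive_eq H); rewrite /GRing.scale/= mulr1.
by apply/funext => w; elim: n {H} => [|n ih]; rewrite ?expr0// !exprS ih.
Qed.

Section integrals.
Context {R : realType} {d : nat}.
Local Notation space := 'rV[R]_d.
Local Notation mu := (@lebesgue_rV R d).

Definition ind_ball (s : R) : space -> R := \1_(cball s).

Lemma integrable_indic_cball (s : R) : mu.-integrable setT (EFin \o ind_ball s).
Proof.
have -> : ind_ball s = ind_ball s \_ (cube 0 s).
  apply/funext => x; rewrite patchE; case: ifPn => // /negP nx.
  rewrite /ind_ball indicE memNset// => xs; apply: nx; rewrite inE.
  exact: (cball_sub_cube xs).
apply: (@integrable_restrict_cube R d _ s 1).
  by apply: measurable_indic; exact: measurable_cball.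
by move=> x _; rewrite /ind_ball indicE; case: (_ \in _); rewrite ?normr1 ?normr0.
Qed.

Lemma Rintegral_indic_cball (s : R) : 0 < s ->
  \int[mu]_x ind_ball s x = s ^+ d * @ball_vol R d.
Proof.
move=> s0; rewrite /Rintegral /ind_ball integral_indic//; last exact: measurable_cball.
by rewrite setIT; have /= -> := @lebesgue_cball R d s s0.
Qed.

Lemma Rintegral_le_cball (f : space -> R) A c s : continuous f -> supp_in A f ->
  0 < s -> (forall x, enorm x <= s -> f x <= c) -> (forall x, s < enorm x -> f x <= 0) ->
  \int[mu]_x f x <= c * (s ^+ d * @ball_vol R d).
Proof.
move=> cf sf s0 fc f0; rewrite -Rintegral_indic_cball//.
rewrite -RintegralZl//; last exact: integrable_indic_cball.
apply: le_Rintegral => //; first exact: integrable_supp sf.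
  have -> : (EFin \o (fun x : space => c * ind_ball s x)) =
      (fun x => c%:E * (EFin \o ind_ball s) x)%E.
    by apply/funext => x; rewrite /= EFinM.
  by apply: integrableZl => //; exact: integrable_indic_cball.
move=> x _; rewrite /ind_ball indicE; have [xs|xs] := leP (enorm x) s.
  by rewrite mem_set//= mulr1; exact: fc.
rewrite memNset ?mulr0; first exact: f0.
by rewrite /cball /= => h; move: xs; rewrite ltNge h.
Qed.

(** The divergence of x |-> [bump_fun] A (0, x) x. *)
Definition div_bump (A : R) (x : space) : R :=
  d%:R * bump_fun A (0, x) + dplateau (dotp x x - A ^+ 2) * (2 * dotp x x).

(** The integral over x of s^d chi(s x) is the same for all s > 0 by dilation, and its
derivative at s = 1 is the integral of div (chi(x) x). *)
Lemma Rintegral_div_bump A : 0 <= A -> \int[mu]_x div_bump A x = 0.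
Proof.
move=> A0.
pose p (s : R) (x : space) := s ^+ 2 * dotp x x - A ^+ 2.
pose g s x := s ^+ d * plateau (p s x).
pose g' s x := s ^+ d * (dplateau (p s x) * (2 * s * dotp x x)) + d%:R * s ^+ d.-1 * plateau (p s x).
have cdot : continuous (fun z : R * space => dotp z.2 z.2).
  have := C1_with_cont (@C1_with_sqdist R d 0).
  by under eq_fun do rewrite subr0.
have cf : continuous (fun z : R * space => z.1) by move=> z; apply: cvg_fst.
have cp : continuous (fun z : R * space => p z.1 z.2).
  apply: continuous_sub; last exact: cst_continuous.
  by apply: continuous_mul; [exact: continuous_expn|exact: cdot].
have cpl : continuous (fun z : R * space => plateau (p z.1 z.2)).
  move=> z; apply: (@continuous_comp _ _ _ (fun z : R * space => p z.1 z.2) plateau).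
    exact: cp.
  by have H := is_derive_plateau (p z.1 z.2);
    apply: differentiable_continuous; apply/derivable1_diffP; apply: ex_derive.
have cdpl : continuous (fun z : R * space => dplateau (p z.1 z.2)).
  move=> z; apply: (@continuous_comp _ _ _ (fun z : R * space => p z.1 z.2) dplateau).
    exact: cp.
  exact: continuous_dplateau.
have cg : continuous (fun z : R * space => g z.1 z.2).
  by apply: continuous_mul; [exact: continuous_expn|exact: cpl].
have cg' : continuous (fun z : R * space => g' z.1 z.2).
  apply: continuous_add; apply: continuous_mul.
  - exact: continuous_expn.
  - apply: continuous_mul; first exact: cdpl.
    apply: continuous_mul; last exact: cdot.
    by apply: continuous_mul; [exact: cst_continuous|exact: cf].
  - by apply: continuous_mul; [exact: cst_continuous|exact: continuous_expn].
  - exact: cpl.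
have far s x : 1 / 2 < s < 2 -> 2 * (A + 1) < enorm x -> 1 <= p s x.
  move=> /andP[s1 s2] xA; rewrite /p -sqr_enorm -exprMn.
  have h : A + 1 < s * enorm x.
    apply: (@lt_trans _ _ (1 / 2 * enorm x)); first by lra.
    by rewrite ltr_pM2r//; lra.
  nra.
have dg (s : R) x : 1 / 2 < s < 2 -> is_derive s (1 : R) (g ^~ x) (g' s x).
  move=> _.
  have Hp : is_derive s (1 : R) (p ^~ x) (2 * s * dotp x x).
    have H : is_derive s (1 : R) (dotp x x *: ((@idfun R) ^+ 2) - cst (A ^+ 2)) (2 * s * dotp x x).
      apply: is_derive_eq; rewrite /GRing.scale/= ; ring.
    rewrite (_ : p ^~ x = dotp x x *: ((@idfun R) ^+ 2) - cst (A ^+ 2))//.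
    by apply/funext => w; rewrite /p !fctE /GRing.scale/= mulrC.
  have Hpl := @is_derive1_comp _ plateau (p ^~ x) s _ _ (is_derive_plateau (p s x)) Hp.
  have Hs := is_derive_expn d s.
  have := @is_deriveM _ _ (fun s : R => s ^+ d) (plateau \o (p ^~ x)) s 1 _ _ Hs Hpl.
  move=> H; rewrite /g' /g.
  rewrite (_ : (fun s => s ^+ d * plateau (p s x)) = (fun s : R => s ^+ d) * (plateau \o (p ^~ x)))//.
  by apply: is_derive_eq; rewrite /GRing.scale/=; ring.
have sg s : 1 / 2 < s < 2 -> supp_in (2 * (A + 1)) (g s).
  by move=> ss x xA; rewrite /g plateau_ge1 ?mulr0//; exact: far.
have sg' s : 1 / 2 < s < 2 -> supp_in (2 * (A + 1)) (g' s).
  move=> ss x xA; rewrite /g' plateau_ge1 ?dplateau_ge1 ?mul0r ?mulr0 ?addr0//; exact: far.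
have I1 : 1 / 2 < (1 : R) < 2 by apply/andP; split; lra.
have D1 := is_derive_Rintegral cg cg' dg sg sg' I1.
have -> : \int[mu]_x div_bump A x = \int[mu]_x g' 1 x.
  apply: eq_Rintegral => x _; rewrite /div_bump /g' /p !expr1n !mul1r !mulr1.
  by rewrite addrC; congr (_ * _ + _ * _).
have c0 : continuous (fun x : space => bump_fun A (0, x)).
  apply: (@continuous_section R d (fun t x => bump_fun A (t, x)) 0).
  exact: (C1_with_cont (C1_with_bump_fun A)).
have const s : 1 / 2 < s < 2 -> \int[mu]_x g s x = \int[mu]_x bump_fun A (0, x).
  move=> ss; have s0 : 0 < s by have /andP[? _] := ss; lra.
  have pE x : plateau (p s x) = bump_fun A (0, s *: x).
    by rewrite /p /bump_fun /= dotpZl dotpZr; congr plateau; ring.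
  have ci : mu.-integrable setT (EFin \o (fun x => plateau (p s x))).
    apply: (@integrable_supp _ _ _ (2 * (A + 1))).
      exact: (@continuous_section R d (fun s x => plateau (p s x)) s cpl).
    by move=> x xA; rewrite plateau_ge1//; exact: far.
  rewrite (RintegralZl (s ^+ d) measurableT ci).
  rewrite (ge0_Rintegral_scale s0 (continuous_measurable_rV c0)); last first.
    by move=> x; exact: plateau_ge0.
  by congr (_ * _); apply: eq_Rintegral => x _; exact: pE.
(* The integral is locally constant in s, so its derivative at 1 vanishes. *)
have near1 : \forall s \near (1 : R), \int[mu]_x g s x = cst (\int[mu]_x bump_fun A (0, x)) s.
  near=> s; apply: const; apply/andP; split.
    by near: s; apply: lt_nbhsr; lra.
  by near: s; apply: lt_nbhsl; lra.
have := near_eq_derive (1 : R) near1.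
by rewrite derive_val derive_cst.
Unshelve. all: by end_near. Qed.

End integrals.

(** * Conservation of the excess mass, balance of the radial momentum *)

Section virial.
Context {R : realType} {d : nat}.
Local Notation space := 'rV[R]_d.
Local Notation mu := (@lebesgue_rV R d).
Local Notation leb := (@lebesgue_measure R).
Variables (gamma rb : R) (r : R -> space -> R) (v : R -> space -> space) (R0 : R).
Hypotheses (gamma1 : 1 < gamma) (rb0 : 0 < rb) (F : euler_flow gamma r v).
Hypotheses (R00 : 0 < R0)
  (bg0 : forall x, R0 <= enorm x -> r 0 x = rb /\ v 0 x = 0)
  (past : forall t, t <= 0 -> r t = r 0 /\ v t = v 0).
Local Notation eta := (relative_energy_density gamma rb r v).
Local Notation overpressure := (overpressure_density gamma rb r).
Local Notation sigma := (sound_speed gamma rb).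

Definition front t : R := R0 + sigma * t.

Let sigma_gt0 : 0 < sigma. Proof. exact: sound_speed_gt0. Qed.

Lemma front_gt0 t : 0 <= t -> 0 < front t.
Proof. by move=> t0; rewrite /front ltr_pwDl// mulr_ge0// ltW. Qed.

Lemma front_le s t : s <= t -> front s <= front t.
Proof. by move=> st; rewrite lerD2l ler_pM2l. Qed.

Lemma background t x : 0 <= t -> front t < enorm x -> r t x = rb /\ v t x = 0.
Proof. exact: (finite_propagation gamma1 rb0 F bg0). Qed.

Lemma background_before tau t x : 0 <= tau -> t <= tau -> front tau < enorm x ->
  r t x = rb /\ v t x = 0.
Proof.
move=> tau0 tt xB; have [t0|t0] := leP 0 t.
  by apply: background => //; apply: le_lt_trans xB; exact: front_le.
have [-> ->] := past (ltW t0); apply: bg0; apply: le_trans (ltW xB).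
by rewrite lerDl mulr_ge0// ltW.
Qed.

Lemma slab_background tau (g : R -> space -> R) : 0 <= tau ->
  continuous (fun z : R * space => g z.1 z.2) ->
  (forall t x, r t x = rb -> v t x = 0 -> g t x = 0) ->
  slab (front (tau + 1)) (-1) (tau + 1) g.
Proof.
move=> tau0 cg g0; split => // t /andP[_ tt] x xB.
have t1 : 0 <= tau + 1 by lra.
by have [h1 h2] := background_before t1 (ltW tt) xB; exact: g0.
Qed.

Let cr := flow_cont_density F.
Let cv := flow_cont_velocity F.

Lemma continuous_dotp_vel (w : R -> space -> space) :
  (forall j, continuous (fun z : R * space => w z.1 z.2 ord0 j)) ->
  continuous (fun z : R * space => dotp (v z.1 z.2) (w z.1 z.2)).
Proof. by move=> cw; apply: continuous_bigsum => j; apply: continuous_mul; [exact: cv|exact: cw]. Qed.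

Definition excess_density t x : R := r t x - rb.
Definition radial_momentum_density t (x : space) : R := r t x * dotp (v t x) x.
(** Twice the kinetic energy density, the form in which it enters the virial
identity. *)
Definition kinetic_density t x : R := r t x * dotp (v t x) (v t x).

Lemma continuous_excess : continuous (fun z : R * space => excess_density z.1 z.2).
Proof. by apply: continuous_sub; [exact: cr|exact: cst_continuous]. Qed.

Lemma continuous_kinetic : continuous (fun z : R * space => kinetic_density z.1 z.2).
Proof. by apply: continuous_mul; [exact: cr|exact: continuous_dotp_vel]. Qed.

Lemma continuous_radial : continuous (fun z : R * space => radial_momentum_density z.1 z.2).
Proof.
apply: continuous_mul; first exact: cr.
by apply: (@continuous_dotp_vel (fun _ x => x)) => j; exact: continuous_coord.
Qed.

Lemma slab_excess tau : 0 <= tau -> slab (front (tau + 1)) (-1) (tau + 1) excess_density.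
Proof.
move=> t0; apply: slab_background => //; first exact: continuous_excess.
by move=> t x h _; rewrite /excess_density h subrr.
Qed.

Lemma slab_radial tau : 0 <= tau -> slab (front (tau + 1)) (-1) (tau + 1) radial_momentum_density.
Proof.
move=> t0; apply: slab_background => //; first exact: continuous_radial.
by move=> t x _ h; rewrite /radial_momentum_density h dotp0l mulr0.
Qed.

Lemma slab_kinetic tau : 0 <= tau -> slab (front (tau + 1)) (-1) (tau + 1) kinetic_density.
Proof.
move=> t0; apply: slab_background => //; first exact: continuous_kinetic.
by move=> t x _ h; rewrite /kinetic_density h dotp0l mulr0.
Qed.

Lemma slab_overpressure tau : 0 <= tau -> slab (front (tau + 1)) (-1) (tau + 1) overpressure.
Proof.
move=> t0; apply: slab_background => //; first exact: (continuous_overpressure gamma1 F).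
by move=> t x h _; rewrite /overpressure_density h subrr.
Qed.

Lemma slab_eta tau : 0 <= tau -> slab (front (tau + 1)) (-1) (tau + 1) eta.
Proof.
move=> t0; apply: slab_background => //; first exact: (continuous_eta gamma1 F).
by move=> t x; exact: eta_background.
Qed.

Lemma bump_section_integrable A t : 0 <= A ->
  mu.-integrable setT (EFin \o (fun x => bump_fun A (t, x))).
Proof.
move=> A0; apply: (@integrable_supp _ _ _ (A + 1)).
  apply: (@continuous_section R d (fun t x => bump_fun A (t, x)) t).
  exact: (C1_with_cont (C1_with_bump_fun A)).
by move=> x xA; exact: bump_fun_out.
Qed.

(** The cutoff is constant wherever the velocity does not vanish, so testing the mass
equation with it gives no flux. *)
Lemma excess_conserved t : 0 <= t -> \int[mu]_x excess_density t x = \int[mu]_x excess_density 0 x.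
Proof.
rewrite le_eqVlt => /predU1P[<-//|t0].
pose A := front t; have A0 : 0 <= A by apply: ltW; apply: front_gt0; exact: ltW.
have Fm := @flow_mass _ _ _ _ _ F 0 t (A + 1) _ _ _ (lexx 0) t0 (C1_with_bump_fun A).
have {}Fm := Fm (fun s x _ => bump_fun_out s A0 (x := x)).
have E s : 0 <= s <= t -> \int[mu]_x excess_density s x =
    \int[mu]_x (r s x * bump_fun A (s, x)) - rb * \int[mu]_x bump_fun A (0, x).
  move=> /andP[s0 st].
  have i1 : mu.-integrable setT (EFin \o (fun x => r s x * bump_fun A (s, x))).
    apply: (@integrable_supp _ _ _ (A + 1)).
      apply: (@continuous_section R d (fun t x => r t x * bump_fun A (t, x)) s).
      by apply: continuous_mul; [exact: cr|exact: (C1_with_cont (C1_with_bump_fun A))].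
    by move=> x xA; rewrite bump_fun_out// mulr0.
  have i2 : mu.-integrable setT (EFin \o (fun x => rb * bump_fun A (0, x))).
    apply: (@integrable_supp _ _ _ (A + 1)).
      apply: (@continuous_section R d (fun t x => rb * bump_fun A (t, x)) 0).
      by apply: continuous_mul; [exact: cst_continuous|exact: (C1_with_cont (C1_with_bump_fun A))].
    by move=> x xA; rewrite bump_fun_out// mulr0.
  rewrite -(RintegralZl rb measurableT (bump_section_integrable 0 A0)).
  rewrite -(RintegralB measurableT i1 i2); apply: eq_Rintegral => x _.
  have [xA|xA] := leP (enorm x) A; first by rewrite !bump_fun_in// !mulr1.
  have [h _] := background_before (ltW t0) st xA.
  by rewrite /excess_density h /bump_fun /= !subrr.
have t0' : 0 <= t by exact: ltW.
have tt : 0 <= t <= t by apply/andP; split.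
have zt : 0 <= (0 : R) <= t by apply/andP; split.
rewrite (E t tt) (E 0 zt); congr (_ - _).
apply/eqP; rewrite -subr_eq0; apply/eqP; apply: (etrans Fm).
transitivity (dblint 0 t (fun (_ : R) (_ : space) => 0)).
  apply: eq_dblint => s x /andP[s0 st]; rewrite mulr0 add0r big1 ?mulr0// => j _.
  have [xA|xA] := leP (enorm x) A; first by rewrite bump_fun_x_in ?mulr0.
  by have [_ ->] := background_before (ltW t0) st xA; rewrite mxE mul0r.
rewrite /dblint Rintegral_cst//; rewrite Rintegral_cst//.
by rewrite !mul0r.
Qed.

(** Testing with the truncated position field psi. Inside the front its gradient is the
identity; outside, u = 0 and the pressure is constant. The constant pressure contributes the
integral of div psi, which is zero. *)
Lemma radial_momentum_balance t : 0 < t ->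
  \int[mu]_x radial_momentum_density t x - \int[mu]_x radial_momentum_density 0 x =
  dblint 0 t (fun t x => kinetic_density t x + d%:R * overpressure t x).
Proof.
move=> t0.
pose A := front t; have A0 : 0 <= A by apply: ltW; apply: front_gt0; exact: ltW.
pose psi (i : 'I_d) := bump_fun A \* (fun z : R * space => z.2 ord0 i).
have Cpsi i := C1_with_mul (C1_with_bump_fun A) (@C1_with_coord R d i).
have Fm := @flow_momentum _ _ _ _ _ F 0 t (A + 1) psi _ _ (lexx 0) t0 Cpsi.
have /Fm {}Fm : forall i s x, 0 <= s <= t -> A + 1 < enorm x -> psi i (s, x) = 0.
  by move=> i s x _ xA; rewrite /psi /= bump_fun_out// mul0r.
have E s : 0 <= s <= t -> \int[mu]_x radial_momentum_density s x =
    \int[mu]_x (r s x * \sum_i v s x ord0 i * psi i (s, x)).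
  move=> /andP[s0 st]; apply: eq_Rintegral => x _; congr (_ * _).
  have [xA|xA] := leP (enorm x) A.
    by apply: eq_bigr => i _; rewrite /psi /= bump_fun_in// mul1r.
  have [_ ->] := background_before (ltW t0) st xA.
  by rewrite dotp0l big1// => i _; rewrite mxE mul0r.
have t0' : 0 <= t by exact: ltW.
have tt : 0 <= t <= t by apply/andP; split.
have zt : 0 <= (0 : R) <= t by apply/andP; split.
rewrite (E t tt) (E 0 zt); apply: (etrans Fm).
have t00 : -1 < (0 : R) by rewrite oppr_lt0.
have t1 : t < t + 1 by rewrite ltrDl.
have SK := slab_add (slab_kinetic (ltW t0)) (slab_scale d%:R (slab_overpressure (ltW t0))).
have B1 : A + 1 <= Num.max (front (t + 1)) (A + 1) by rewrite le_max lexx orbT.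
have B2 : front (t + 1) <= Num.max (front (t + 1)) (A + 1) by rewrite le_max lexx.
set A' := Num.max _ _ in B1 B2.
have SK' : slab A' (-1) (t + 1) (fun t x => kinetic_density t x + d%:R * overpressure t x).
  by have [c s] := SK; split => // w ww; exact: (supp_in_le B2 (s w ww)).
have Sdiv : slab A' (-1) (t + 1) (fun (_ : R) (x : space) => div_bump A x).
  split.
    have cdot : continuous (fun z : R * space => dotp z.2 z.2).
      have := C1_with_cont (@C1_with_sqdist R d 0).
      by under eq_fun do rewrite subr0.
    have c : continuous (fun z : R * space => dotp z.2 z.2 - A ^+ 2).
      by apply: continuous_sub; [exact: cdot|exact: cst_continuous].
    have cpl : continuous (fun z : R * space => dplateau (dotp z.2 z.2 - A ^+ 2)).
      move=> z; have := @continuous_comp _ _ _ (fun z : R * space => dotp z.2 z.2 - A ^+ 2) dplateau z.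
      by apply; [exact: c|exact: continuous_dplateau].
    apply: continuous_add; apply: continuous_mul.
    - exact: cst_continuous.
    - exact: (C1_with_cont (C1_with_bump_fun A)).
    - exact: cpl.
    - by apply: continuous_mul; [exact: cst_continuous|exact: cdot].
  move=> w _ x xA; have {}xA := le_lt_trans B1 xA.
  by rewrite /div_bump bump_fun_out// dplateau_ge1 ?mul0r ?mulr0 ?addr0//; exact: bump_out.
transitivity (dblint 0 t (fun t x => (kinetic_density t x + d%:R * overpressure t x) +
    rb `^ gamma * div_bump A x)).
  apply: eq_dblint => s x /andP[s0 st].
  have divE : \sum_j (bump_fun A (s, x) * (j == j)%:R + (s, x).2 ord0 j * bump_fun_x A j (s, x)) =
      div_bump A x.
    rewrite big_split /= /div_bump; congr (_ + _).
      rewrite (eq_bigr (fun=> bump_fun A (0, x))); last by move=> j _; rewrite eqxx mulr1.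
      by rewrite sumr_const card_ord mulr_natl.
    rewrite /dotp !mulr_sumr; apply: eq_bigr => j _; rewrite /bump_fun_x /=; ring.
  rewrite /= divE.
  have [xA|xA] := leP (enorm x) A; last first.
    have [h1 h2] := background_before (ltW t0) st xA.
    rewrite /kinetic_density /overpressure_density h1 h2 dotp0l !big1.
    - by rewrite subrr !mulr0 !add0r.
    - by move=> i _; rewrite big1// => j _; rewrite mxE !mul0r.
    - by move=> i _; rewrite mxE mul0r.
  rewrite big1 ?mulr0 ?add0r; last by move=> i _; rewrite !mulr0 addr0 mulr0.
  have -> : \sum_i \sum_j v s x ord0 i * v s x ord0 j *
      (bump_fun A (s, x) * (i == j)%:R + x ord0 i * bump_fun_x A j (s, x)) = dotp (v s x) (v s x).
    apply: eq_bigr => i _; rewrite (bigD1 i)//= big1 => [|j ji].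
      by rewrite bump_fun_in// bump_fun_x_in// eqxx !mulr1 mulr0 !addr0 mulr1.
    by rewrite bump_fun_x_in// eq_sym (negPf ji) !mulr0 addr0 mulr0.
  have -> : div_bump A x = d%:R.
    rewrite /div_bump bump_fun_in// mulr1 dplateau_le0 ?mul0r ?addr0//.
    by rewrite -sqr_enorm subr_le0 ler_pXn2r// nnegrE enorm_ge0.
  rewrite /kinetic_density /overpressure_density; ring.
rewrite (dblintD SK' (slab_scale _ Sdiv) t00 t1) (dblintZ _ Sdiv t00 t1).
have -> : dblint 0 t (fun (_ : R) (x : space) => div_bump A x) = 0.
  transitivity (\int[leb]_(s in `[0, t]) (cst 0 s : R)).
    by apply: eq_Rintegral => s _; rewrite /= Rintegral_div_bump.
  by rewrite Rintegral_cst// mul0r.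
by rewrite mulr0 addr0.
Qed.

End virial.

(** * Growth of the radial momentum against the energy bound *)

Lemma cubic_contradiction {R : realType} (c e : R) : 0 < c -> 0 <= e - (3 * e + c) / 3 -> False.
Proof. by move=> c0; lra. Qed.

Section blowup.
Context {R : realType} {d : nat}.
Local Notation space := 'rV[R]_d.
Local Notation mu := (@lebesgue_rV R d).
Local Notation leb := (@lebesgue_measure R).
Variables (gamma rb : R) (r : R -> space -> R) (v : R -> space -> space) (R0 M0 : R).
Hypotheses (gamma1 : 1 < gamma) (rb0 : 0 < rb) (F : euler_flow gamma r v).
Hypotheses (R00 : 0 < R0)
  (bg0 : forall x, R0 <= enorm x -> r 0 x = rb /\ v 0 x = 0)
  (past : forall t, t <= 0 -> r t = r 0 /\ v t = v 0).
Local Notation eta := (relative_energy_density gamma rb r v).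
Local Notation overpressure := (overpressure_density gamma rb r).
Local Notation sigma := (sound_speed gamma rb).
Local Notation B := (front gamma rb R0).
Local Notation excess := (excess_density rb r).
Local Notation radial_momentum := (radial_momentum_density r v).
Local Notation kinetic := (kinetic_density r v).
Local Notation V := (@ball_vol R d).
Hypotheses (rM : forall x, r 0 x <= M0) (excess0 : 0 <= \int[mu]_x excess 0 x).

Let sigma_gt0 : 0 < sigma. Proof. exact: sound_speed_gt0. Qed.
Let V0 : 0 < V. Proof. exact: ball_vol_gt0. Qed.

Let in_slab (t : R) : 0 <= t -> -1 < t < t + 1.
Proof. by move=> t0; rewrite ltrDl ltr01 andbT (lt_le_trans _ t0)// oppr_lt0. Qed.

(** The excess mass is carried by the initial ball, where the density is at most M0. *)
Lemma excess_upper : \int[mu]_x excess 0 x <= (M0 - rb) * (R0 ^+ d * V).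
Proof.
have [c s] := slab_excess gamma1 rb0 F bg0 past (lexx 0).
apply: (Rintegral_le_cball (continuous_section (t := 0) c) (s 0 (in_slab (lexx 0))) R00).
  by move=> x _; rewrite /excess_density lerD2r; exact: rM.
by move=> x /ltW /bg0[h _]; rewrite /excess_density h subrr.
Qed.

Lemma background_le_bound : rb <= M0.
Proof.
have := le_trans excess0 excess_upper.
by rewrite pmulr_lge0 ?subr_ge0// mulr_gt0// exprn_gt0.
Qed.

(** Cauchy-Schwarz in the form: the integral over the ball of r |v - l x|^2 is nonnegative.
The mass of the ball is the excess mass plus rb V B^d, at most M0 V B^d. *)
Lemma kinetic_lower t l : 0 <= t ->
  2 * l * \int[mu]_x radial_momentum t x - l ^+ 2 * B t ^+ 2 * (M0 * (B t ^+ d * V)) <=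
  \int[mu]_x kinetic t x.
Proof.
move=> t0; have tI := in_slab t0.
have Bt0 : 0 < B t by exact: front_gt0.
have S1 := slab_excess gamma1 rb0 F bg0 past t0.
have S2 := slab_radial gamma1 rb0 F bg0 past t0.
have S3 := slab_kinetic gamma1 rb0 F bg0 past t0.
pose a := - (l ^+ 2 * B t ^+ 2).
pose h s x := -1 * kinetic s x + (2 * l * radial_momentum s x + a * excess s x).
have SH : slab (front gamma rb R0 (t + 1)) (-1) (t + 1) h.
  exact: (slab_add (slab_scale (-1) S3) (slab_add (slab_scale (2 * l) S2) (slab_scale a S1))).
have [cH sH] := SH.
have h1 : forall x, enorm x <= B t -> h t x <= l ^+ 2 * B t ^+ 2 * rb.
  move=> x xB; rewrite /h /kinetic_density /radial_momentum_density /excess_density /a.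
  have r0 := flow_density_ge0 F t x.
  have x2 : dotp x x <= B t ^+ 2 by rewrite -sqr_enorm ler_pXn2r// nnegrE ?enorm_ge0// ltW.
  have h2 : 0 <= r t x * (dotp (v t x) (v t x) - 2 * l * dotp (v t x) x + l ^+ 2 * dotp x x).
    apply: mulr_ge0 => //.
    have := dotp_ge0 (v t x + (- l) *: x).
    rewrite !(dotpDl, dotpDr) !(dotpZl, dotpZr) (dotpC x (v t x)) => h0; lra.
  have h3 : 0 <= r t x * (l ^+ 2 * (B t ^+ 2 - dotp x x)).
    by rewrite mulr_ge0// mulr_ge0 ?sqr_ge0// subr_ge0.
  lra.
have h2 : forall x, B t < enorm x -> h t x <= 0.
  move=> x xB; have [e1 e2] := background gamma1 rb0 F bg0 t0 xB.
  rewrite /h /kinetic_density /radial_momentum_density /excess_density e1 e2 !dotp0l subrr.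
  by rewrite !mulr0 !addr0.
have := Rintegral_le_cball (continuous_section (t := t) cH) (sH t tI) Bt0 h1 h2.
rewrite /h (RintegralD2 (slab_scale (-1) S3) (slab_add (slab_scale (2 * l) S2) (slab_scale a S1)) tI).
rewrite (RintegralD2 (slab_scale (2 * l) S2) (slab_scale a S1) tI).
rewrite (RintegralZ2 _ S3 tI) (RintegralZ2 _ S2 tI) (RintegralZ2 _ S1 tI).
rewrite (excess_conserved gamma1 rb0 F R00 bg0 past t0) => H.
have h3 := excess_upper.
have h4 : R0 ^+ d <= B t ^+ d.
  apply: lerXn2r; rewrite ?nnegrE; [exact: ltW|exact: ltW|].
  by rewrite /front lerDl mulr_ge0// ltW.
have h5 : (M0 - rb) * (R0 ^+ d * V) <= (M0 - rb) * (B t ^+ d * V).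
  by rewrite ler_wpM2l ?subr_ge0 ?background_le_bound// ler_wpM2r// ltW.
have h6 : 0 <= l ^+ 2 * B t ^+ 2 * ((M0 - rb) * (B t ^+ d * V) - \int[mu]_x excess 0 x).
  apply: mulr_ge0; first by apply: mulr_ge0; exact: sqr_ge0.
  by rewrite subr_ge0; exact: le_trans h3 h5.
move: H; rewrite /a; lra.
Qed.

(** The pressure lies above its tangent at rb, whose integral is a nonnegative multiple of the
excess mass. *)
Lemma overpressure_ge0 t : 0 <= t -> 0 <= \int[mu]_x overpressure t x.
Proof.
move=> t0; have tI := in_slab t0.
have S1 := slab_excess gamma1 rb0 F bg0 past t0.
have S4 := slab_overpressure gamma1 rb0 F bg0 past t0.
apply: (@le_trans _ _ (\int[mu]_x (gamma * rb `^ (gamma - 1) * excess t x))).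
  rewrite (RintegralZ2 _ S1 tI) (excess_conserved gamma1 rb0 F R00 bg0 past t0).
  by rewrite mulr_ge0// mulr_ge0 ?powR_ge0// ltW// (lt_trans _ gamma1).
apply: le_Rintegral => //; first exact: (slab_integrable (slab_scale _ S1) tI).
  exact: (slab_integrable S4 tI).
by move=> x _; apply: pressure_tangent => //; exact: (flow_density_ge0 F).
Qed.

Hypothesis d1 : (0 < d)%N.
Let k := d.+1%:R * sigma.
Let L := k * (M0 * V).
Hypothesis radial0 : L * R0 ^+ d.+1 <= \int[mu]_x radial_momentum 0 x.

Let k0 : 0 < k. Proof. by apply: mulr_gt0 => //; rewrite ltr0n. Qed.
Let M00 : 0 < M0. Proof. exact: lt_le_trans background_le_bound. Qed.
Let L0 : 0 < L. Proof. by apply: mulr_gt0 => //; exact: mulr_gt0. Qed.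

(** With Y = F - L B^(d+1), [kinetic_lower] for l = k / B gives Y' >= (2 k / B) Y. As
B' = sigma and 2 k = 2 (d + 1) sigma, the integrating factor is B^(-2 (d+1)), and the
function Y / B^(2 (d+1)) is nondecreasing. *)
Lemma radial_growth t : 0 <= t -> L * B t ^+ d.+1 <= \int[mu]_x radial_momentum t x.
Proof.
rewrite le_eqVlt => /predU1P[<-|t0]; first by rewrite /front mulr0 addr0.
pose W s := \int[mu]_x (kinetic s x + d%:R * overpressure s x).
have SW := slab_add (slab_kinetic gamma1 rb0 F bg0 past (ltW t0))
  (slab_scale d%:R (slab_overpressure gamma1 rb0 F bg0 past (ltW t0))).
have W_lower s : 0 <= s -> \int[mu]_x kinetic s x <= W s.
  move=> s0; have sI := in_slab s0.
  have S3 := slab_kinetic gamma1 rb0 F bg0 past s0.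
  have S4 := slab_overpressure gamma1 rb0 F bg0 past s0.
  rewrite /W (RintegralD2 S3 (slab_scale d%:R S4) sI) (RintegralZ2 _ S4 sI).
  by rewrite lerDl mulr_ge0// overpressure_ge0.
(* Starting the primitive before 0 makes 0 an interior point. *)
pose a : R := - (1 / 2).
pose G x := \int[leb]_(s in `[a, x]) W s.
have a1 : -1 < a by rewrite /a; lra.
have t2 : t + 1 / 2 < t + 1 by lra.
have iW := slab_time_integrable SW a1 t2.
have dG x : 0 <= x <= t -> is_derive x (1 : R) G (W x).
  move=> /andP[x0 xt].
  have cW : {for x, continuous W}.
    by apply: (slab_integral_continuous SW); apply/andP; split; lra.
  have xt2 : x < t + 1 / 2 by lra.
  have [h1 h2] : derivable G x 1 /\ derive1 G x = W x.
    apply: (@continuous_FTC1 R W (BLeft a) x (t + 1 / 2) xt2 iW _ cW).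
    by rewrite /= lte_fin /a; lra.
  by apply: DeriveDef; [exact: h1|rewrite -derive1E; exact: h2].
have FG x : 0 <= x <= t -> \int[mu]_x0 radial_momentum x x0 =
    \int[mu]_x0 radial_momentum 0 x0 + (G x - G 0).
  move=> /andP[]; rewrite le_eqVlt => /predU1P[<- _|x0 xt]; first by rewrite subrr addr0.
  have E := radial_momentum_balance gamma1 rb0 F R00 bg0 past x0.
  have -> : G x - G 0 = dblint 0 x (fun t x => kinetic t x + d%:R * overpressure t x).
    have ix : leb.-integrable `[a, x] (EFin \o W).
      apply: integrableS iW; [exact: measurable_itv|exact: measurable_itv|].
      by move=> s; rewrite /= !in_itv/= => /andP[-> h]; lra.
    rewrite /G Rintegral_itvB//; [|by rewrite bnd_simp /a; lra|by rewrite bnd_simp ltW].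
    rewrite Rintegral_itv_obnd_cbnd//.
    apply: integrableS ix; [exact: measurable_itv|exact: measurable_itv|].
    by move=> s; rewrite /= !in_itv/= /a => /andP[h1 h2]; apply/andP; split; lra.
  by rewrite -E; ring.
pose Y x := \int[mu]_x0 radial_momentum 0 x0 + (G x - G 0) - L * B x ^+ d.+1.
pose n := (2 * d.+1)%N.
pose z x := Y x * (B x)^-1 ^+ n.
pose dz x := (W x - L * (d.+1%:R * B x ^+ d * sigma)) * (B x)^-1 ^+ n +
   Y x * (n%:R * (B x)^-1 ^+ n.-1 * (- (B x) ^- 2 * sigma)).
have dz_ x : 0 <= x <= t -> is_derive x (1 : R) z (dz x).
  move=> xI; have /andP[x0 xt] := xI.
  have B0 : 0 < B x by exact: front_gt0.
  have HB : is_derive x (1 : R) B sigma.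
    have H := is_deriveD (is_derive_cst R0 x (1 : R)) (is_deriveZ sigma (is_derive_id x (1 : R))).
    by apply: (is_derive_eq H); rewrite /GRing.scale/= mulr1 add0r.
  have HBd := @is_derive1_comp _ (fun y => y ^+ d.+1) B x _ _ (is_derive_expn d.+1 (B x)) HB.
  have HBi := is_deriveV (lt0r_neq0 B0) HB.
  have HBn := @is_derive1_comp _ (fun y => y ^+ n) (fun y => (B y)^-1) x _ _
    (is_derive_expn n (B x)^-1) HBi.
  have HG := dG x xI.
  have HY : is_derive x (1 : R) Y (W x - L * (d.+1%:R * B x ^+ d * sigma)).
    have H1 := is_deriveD (is_derive_cst (\int[mu]_x0 radial_momentum 0 x0 : R) x (1 : R))
      (is_deriveB HG (is_derive_cst (G 0) x (1 : R))).
    apply: (is_derive_eq (is_deriveB H1 (is_deriveZ L HBd))).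
    by rewrite add0r subr0.
  apply: (is_derive_eq (is_deriveM HY HBn)).
  rewrite /dz /GRing.scale /=; move: (W x) (Y x) (B x) => w y b; ring.
have dz0 x : 0 <= x <= t -> 0 <= dz x.
  move=> xI; have /andP[x0 xt] := xI.
  have B0 : 0 < B x by exact: front_gt0.
  have Bi0 : 0 < (B x)^-1 by rewrite invr_gt0.
  have BB : B x * (B x)^-1 = 1 by rewrite mulfV// gt_eqF.
  have Q := le_trans (kinetic_lower (k * (B x)^-1) x0) (W_lower x x0).
  rewrite (FG x xI) in Q.
  have -> : dz x = (B x)^-1 ^+ n * (W x - k * L * B x ^+ d - 2 * k * (B x)^-1 * Y x).
    have nE : (B x)^-1 ^+ n.-1 * (B x)^-1 = (B x)^-1 ^+ n by rewrite -exprSr prednK.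
    have n2 : n%:R * sigma = 2 * k by rewrite /n natrM /k mulrA.
    rewrite /dz -exprVn; transitivity ((W x - (d.+1%:R * sigma) * L * B x ^+ d) * (B x)^-1 ^+ n -
      Y x * (n%:R * sigma) * ((B x)^-1 ^+ n.-1 * (B x)^-1) * (B x)^-1); first by ring.
    by rewrite nE n2 -/k; ring.
  apply: mulr_ge0; first by rewrite exprn_ge0// ltW.
  rewrite /Y; set Fx := _ + (G x - G 0) in Q *.
  have E1 : (k * (B x)^-1) ^+ 2 * B x ^+ 2 * (M0 * (B x ^+ d * V)) = k * L * B x ^+ d.
    rewrite /L; transitivity ((B x * (B x)^-1) ^+ 2 * (k * (k * (M0 * V)) * B x ^+ d)); first by ring.
    by rewrite BB expr1n mul1r.
  have E2 : 2 * k * (B x)^-1 * (L * B x ^+ d.+1) = 2 * (k * L * B x ^+ d).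
    rewrite exprS; transitivity ((B x * (B x)^-1) * (2 * (k * L * B x ^+ d))); first by ring.
    by rewrite BB mul1r.
  rewrite E1 in Q; rewrite mulrBr E2; lra.
have B00 : B 0 = R0 by rewrite /front mulr0 addr0.
have z0 : 0 <= z 0.
  rewrite /z /Y subrr addr0 B00 mulr_ge0 ?subr_ge0//.
  by rewrite exprn_ge0// invr_ge0 ltW.
have [||c cI] := @MVT_segment _ z dz 0 t (ltW t0).
- by move=> x; rewrite in_itv/= => /andP[h1 h2]; apply: dz_; rewrite !ltW.
- apply: continuous_in_subspaceT => x; rewrite inE/= in_itv/= => xI.
  have H := dz_ x xI.
  by apply: differentiable_continuous; apply/derivable1_diffP; apply: ex_derive.
rewrite subr0 => E.
have zt : 0 <= z t.
  have h : 0 <= dz c * t by rewrite mulr_ge0 ?dz0 ?(ltW t0)//; move: cI; rewrite in_itv.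
  by rewrite -E in h; lra.
have Bt0 : 0 < B t by apply: front_gt0 => //; exact: ltW.
move: zt; rewrite /z pmulr_lge0; last by rewrite exprn_gt0// invr_gt0.
have tt : 0 <= t <= t by rewrite lexx andbT ltW.
by rewrite /Y -(FG t tt) subr_ge0.
Qed.

Lemma kinetic_growth t : 0 <= t -> k * L * B t ^+ d <= \int[mu]_x kinetic t x.
Proof.
move=> t0; have B0 : 0 < B t by exact: front_gt0.
have BB : B t * (B t)^-1 = 1 by rewrite mulfV// gt_eqF.
have Q := kinetic_lower (k * (B t)^-1) t0.
have G := radial_growth t0.
have E1 : (k * (B t)^-1) ^+ 2 * B t ^+ 2 * (M0 * (B t ^+ d * V)) = k * L * B t ^+ d.
  rewrite /L; transitivity ((B t * (B t)^-1) ^+ 2 * (k * (k * (M0 * V)) * B t ^+ d)); first by ring.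
  by rewrite BB expr1n mul1r.
have E2 : 2 * (k * (B t)^-1) * (L * B t ^+ d.+1) = 2 * (k * L * B t ^+ d).
  rewrite exprS; transitivity ((B t * (B t)^-1) * (2 * (k * L * B t ^+ d))); first by ring.
  by rewrite BB mul1r.
have h : 0 <= 2 * (k * (B t)^-1).
  by apply: mulr_ge0 => //; apply: mulr_ge0; [exact: ltW|rewrite invr_ge0 ltW].
have := ler_wpM2l h G; rewrite E2; rewrite E1 in Q; lra.
Qed.

Let c1 := k * L * (sigma * R0 ^+ d.-1) / 2.

Let c10 : 0 < c1.
Proof.
apply: divr_gt0 => //; apply: mulr_gt0; first exact: mulr_gt0.
by apply: mulr_gt0 => //; exact: exprn_gt0.
Qed.

Lemma energy_growth t : 0 <= t -> c1 * t <= \int[mu]_x eta t x.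
Proof.
move=> t0; have tI := in_slab t0.
have S3 := slab_kinetic gamma1 rb0 F bg0 past t0.
have S5 := slab_eta gamma1 rb0 F bg0 past t0.
apply: (@le_trans _ _ (2^-1 * \int[mu]_x kinetic t x)).
  have Q := kinetic_growth t0.
  have h1 : sigma * t * R0 ^+ d.-1 <= B t ^+ d.
    rewrite -(prednK d1) exprS; apply: ler_pM.
    - by apply: mulr_ge0 => //; exact: ltW.
    - by rewrite exprn_ge0// ltW.
    - by rewrite /front lerDr ltW.
    - apply: lerXn2r; rewrite ?nnegrE; [exact: ltW|by apply: ltW; exact: front_gt0|].
      by rewrite /front lerDl mulr_ge0// ltW.
  have h2 : 0 <= k * L by apply: mulr_ge0; exact: ltW.
  have := ler_wpM2l h2 h1; rewrite /c1; lra.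
rewrite -(RintegralZ2 2^-1 S3 tI).
apply: le_Rintegral => //; first exact: (slab_integrable (slab_scale _ S3) tI).
  exact: (slab_integrable S5 tI).
move=> x _; rewrite /relative_energy_density /relen /kinetic_density sqr_enorm.
have := relpot_ge0 gamma1 rb0 (flow_density_ge0 F t x); lra.
Qed.

(** The relative energy inequality for (tau - t)^2 times a cutoff that is 1 inside the front:
no flux remains, and the time derivative of the weight is -2 (tau - t). *)
Lemma energy_average tau : 0 < tau ->
  0 <= \int[leb]_(t in `[0, tau]) (- (2 * (tau - t)) * \int[mu]_x eta t x) +
    tau ^+ 2 * \int[mu]_x eta 0 x.
Proof.
move=> tau0; have tau0' := ltW tau0.
pose A := B tau; have A0 : 0 <= A by apply: ltW; exact: front_gt0.
have C := C1_with_mul (@C1_with_possq_time R d tau) (C1_with_bump_fun A).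
have late t x : tau <= t ->
    [/\ ((fun z : R * space => possq (tau - z.1)) \* bump_fun A) (t, x) = 0,
     possq (tau - (t, x).1) * cst 0 (t, x) + bump_fun A (t, x) * - dpossq (tau - (t, x).1) = 0 &
     forall j, possq (tau - (t, x).1) * bump_fun_x A j (t, x) + bump_fun A (t, x) * cst 0 (t, x) = 0].
  move=> tt; have t0 : tau - t <= 0 by lra.
  by rewrite /= (possq_le0 t0) (dpossq_le0 t0) !mul0r oppr0 mulr0 addr0; split => // j;
    rewrite mul0r ?mulr0 addr0.
have out t x : -1 < t -> A + 1 < enorm x ->
    [/\ ((fun z : R * space => possq (tau - z.1)) \* bump_fun A) (t, x) = 0,
     possq (tau - (t, x).1) * cst 0 (t, x) + bump_fun A (t, x) * - dpossq (tau - (t, x).1) = 0 &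
     forall j, possq (tau - (t, x).1) * bump_fun_x A j (t, x) + bump_fun A (t, x) * cst 0 (t, x) = 0].
  move=> _ xA; rewrite /= bump_fun_out// !mulr0 mul0r addr0; split => // j.
  by rewrite bump_fun_x_out// ?mulr0 ?mul0r addr0.
have pos t x : 0 <= t -> 0 <= ((fun z : R * space => possq (tau - z.1)) \* bump_fun A) (t, x).
  by move=> _; apply: mulr_ge0; [exact: possq_ge0|exact: plateau_ge0].
have RE := relative_energy gamma1 rb0 F tau0 C pos out late.
have S5 := slab_eta gamma1 rb0 F bg0 past tau0'.
have E1 : \int[mu]_x (eta 0 x * ((fun z : R * space => possq (tau - z.1)) \* bump_fun A) (0, x)) =
    tau ^+ 2 * \int[mu]_x eta 0 x.
  rewrite -(RintegralZ2 (tau ^+ 2) S5); last by rewrite oppr_lt0 ltr01/=; lra.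
  apply: eq_Rintegral => x _; rewrite /= subr0 (possq_ge tau0').
  have [xA|xA] := leP (enorm x) A; first by rewrite bump_fun_in// mulr1 mulrC.
  have [h1 h2] := background_before gamma1 rb0 F bg0 past tau0' tau0' xA.
  by rewrite (eta_background _ h1 h2) mul0r mulr0.
rewrite E1 in RE; apply: (le_trans RE); rewrite lerD2r.
have -> // : forall a b : R, a = b -> a <= b by move=> a b ->.
apply: eq_Rintegral => t; rewrite inE/= in_itv/= => /andP[t0 tt].
rewrite -(RintegralZ2 _ S5); last by apply/andP; split; lra.
apply: eq_Rintegral => x _; rewrite /= mulr0 add0r.
have tt0 : 0 <= tau - t by lra.
rewrite (dpossq_ge tt0).
have [xA|xA] := leP (enorm x) A.
  rewrite bump_fun_in// mul1r big1 ?mulr0 ?addr0; first by ring.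
  by move=> j _; rewrite bump_fun_x_in// mulr0 addr0 mulr0.
have [h1 h2] := background_before gamma1 rb0 F bg0 past tau0' tt xA.
rewrite (eta_background _ h1 h2) h2 big1 ?mulr0 ?mul0r ?addr0//.
by move=> j _; rewrite mxE mul0r.
Qed.

(** If the energy grows like c1 t, the left-hand side of [energy_average] is at most
-c1 tau^3 / 3 + tau^2 E0, which is negative for large tau. *)
Lemma no_global_flow : False.
Proof.
have [E0 E0def] : exists E0 : R, E0 = \int[mu]_x eta 0 x by eexists.
have E00 : 0 <= E0 by rewrite E0def; apply: Rintegral_ge0 => x _; exact: (eta_ge0 gamma1 rb0 F).
have [tau tau0 tauE] : exists2 tau, 0 < tau & c1 * tau = 3 * E0 + c1.
  exists ((3 * E0 + c1) / c1); last by rewrite mulrC divfK// gt_eqF.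
  by apply: divr_gt0 => //; apply: ltr_wpDl => //; exact: mulr_ge0.
have tau0' := ltW tau0.
have S5 := slab_eta gamma1 rb0 F bg0 past tau0'.
have b1 : -1 < (0 : R) by rewrite oppr_lt0.
have b2 : tau < tau + 1 by rewrite ltrDl.
have Sw : slab (B (tau + 1)) (-1) (tau + 1) (fun t x => - (2 * (tau - t)) * eta t x).
  apply: slab_mul => //.
  rewrite (_ : (fun z : R * space => _) = (fun z => -2 * (tau - z.1))); last first.
    by apply/funext => z; ring.
  apply: continuous_mul; first exact: cst_continuous.
  by apply: continuous_sub; [exact: cst_continuous|move=> z; apply: cvg_fst].
pose p t := - (2 * (tau - t)) * (c1 * t).
(* A primitive of p. *)
pose P t := c1 * (- tau * t ^+ 2 + 2 / 3 * t ^+ 3).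
have dP (t : R) : is_derive t (1 : R) P (p t).
  have H := is_deriveZ c1 (is_deriveD (is_deriveZ (- tau) (is_derive_expn 2 t))
    (is_deriveZ (2 / 3) (is_derive_expn 3 t))).
  by apply: (is_derive_eq H); rewrite /p /GRing.scale/=; field.
have cp : continuous p.
  rewrite (_ : p = (fun t => (-2 * (tau - t)) * (c1 * t))); last by apply/funext => t; rewrite /p; ring.
  have cid : continuous (fun t : R => t) by move=> t; apply: cvg_id.
  apply: continuous_mul; apply: continuous_mul => //; try exact: cst_continuous.
  by apply: continuous_sub => //; exact: cst_continuous.
have cP : continuous P.
  by move=> t; have H := dP t; apply: differentiable_continuous; apply/derivable1_diffP; apply: ex_derive.
have ip : leb.-integrable `[0, tau] (EFin \o p).
  by apply: continuous_compact_integrable; [exact: segment_compact|exact: continuous_subspaceT].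
have := energy_average tau0.
have -> : \int[leb]_(t in `[0, tau]) (- (2 * (tau - t)) * \int[mu]_x eta t x) =
   \int[leb]_(t in `[0, tau]) \int[mu]_x (- (2 * (tau - t)) * eta t x).
  apply: eq_Rintegral => t; rewrite inE/= in_itv/= => /andP[t0 tt].
  by rewrite (RintegralZ2 _ S5)//; apply/andP; split; lra.
have : \int[leb]_(t in `[0, tau]) \int[mu]_x (- (2 * (tau - t)) * eta t x) <=
    \int[leb]_(t in `[0, tau]) p t.
  apply: le_Rintegral => //; first exact: (slab_time_integrable Sw b1 b2).
  move=> t; rewrite /= in_itv/= => /andP[t0 tt].
  rewrite (RintegralZ2 _ S5); last by apply/andP; split; lra.
  rewrite /p !mulNr lerN2; apply: ler_wpM2l; first by lra.
  exact: energy_growth.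
have -> : \int[leb]_(t in `[0, tau]) p t = P tau - P 0.
  rewrite /Rintegral.
  have -> // := @continuous_FTC2 R p P 0 tau tau0.
  - exact: continuous_subspaceT.
  - split.
    + by move=> t _; have H := dP t; apply: ex_derive.
    + by apply: cvg_at_right_filter; exact: cP.
    + by apply: cvg_at_left_filter; exact: cP.
  - by move=> t _; have H := dP t; rewrite derive1E derive_val.
rewrite -E0def => h1 h2.
have h3 : 0 <= P tau - P 0 + tau ^+ 2 * E0 by exact: le_trans h2 (lerD h1 (lexx _)).
have E : P tau - P 0 + tau ^+ 2 * E0 = tau ^+ 2 * (E0 - c1 * tau / 3) by rewrite /P; field.
rewrite E pmulr_rge0 ?exprn_gt0// tauE in h3.
exact: cubic_contradiction c10 h3.
Qed.

End blowup.

(** * The theorem *)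

Section final.
Context {R : realType} {d : nat}.
Local Notation space := 'rV[R]_d.
Local Notation mu := (@lebesgue_rV R d).

Lemma lebesgue_rV_setT_gt0 : (0 < mu setT)%E.
Proof.
apply: (@lt_le_trans _ _ (mu (cube 0 1))).
  by rewrite lebesgue_cube// lte_fin exprn_gt0// mulr_gt0.
by apply: le_measure; rewrite ?inE; [exact: measurable_cube|exact: measurableT|].
Qed.

(** The essential bound holds everywhere by continuity. *)
Lemma Lnormy_bound (f : space -> R) (M : R) : continuous f ->
  'N[mu]_+oo[EFin \o f]%E = M%:E -> forall x, f x <= M.
Proof.
move=> cf; rewrite unlock lebesgue_rV_setT_gt0 => NM x; rewrite -subr_ge0.
move: x; apply: (@ae_ge0_continuous _ _ (fun x => M - f x)).
  by apply: continuous_sub; [exact: cst_continuous|exact: cf].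
have := ess_sup_ge mu (abse \o (EFin \o f)); rewrite NM.
apply: filterS => x /=; rewrite lee_fin subr_ge0.
exact: le_trans (ler_norm _).
Qed.

End final.

Theorem theorem2p2 (R : realType) (d : nat) (gamma : R) (Tstar : \bar R)
    (rho : R -> 'rV[R]_d -> R) (u : R -> 'rV[R]_d -> 'rV[R]_d)
    (rho0 : 'rV[R]_d -> R) (u0 : 'rV[R]_d -> 'rV[R]_d) (rhobar r : R) :
  (1 <= d)%N -> 1 < gamma -> (0 < Tstar)%E ->
  {within lifespan Tstar `*` [set: 'rV[R]_d],
    continuous (fun z : R * 'rV[R]_d => rho z.1 z.2)} ->
  {within lifespan Tstar `*` [set: 'rV[R]_d],
    continuous (fun z : R * 'rV[R]_d => u z.1 z.2)} ->
  admissible_solution gamma Tstar rho u rho0 u0 ->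
  0 < rhobar -> 0 < r ->
  (forall x, r <= enorm x -> rho0 x = rhobar /\ u0 x = 0) ->
  (0 <= \int[lebesgue_rV d]_x (rho0 x - rhobar)%:E)%E ->
  let sigma := Num.sqrt gamma * rhobar `^ ((gamma - 1) / 2) in
  (((d.+1)%:R * sigma)%:E * 'N[lebesgue_rV d]_+oo[EFin \o rho0] <=
    ((omega R d * r ^+ d.+1)^-1)%:E *
      \int[lebesgue_rV d]_x (rho0 x * dotp (u0 x) x)%:E)%E ->
  (Tstar < +oo)%E.
Proof.
case: Tstar => [t| |] //; first by move=> *; exact: ltry.
move=> d1 gamma1 _ crho cu sol rb0 r0 bg excess0 sigma big.
exfalso.
have [_ rho0E u0E _] := sol.
have F := solution_flow crho cu sol.
have m00 : Num.max (0 : R) 0 = 0 by rewrite maxxx.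
have past (t : R) : t <= 0 ->
    rho (Num.max t 0) = rho (Num.max 0 0) /\ u (Num.max t 0) = u (Num.max 0 0).
  by move=> t0; rewrite (max_idPr t0) m00.
have bg0 (x : 'rV[R]_d) : r <= enorm x ->
    rho (Num.max 0 0) x = rhobar /\ u (Num.max 0 0) x = 0.
  by rewrite m00 -rho0E -u0E; exact: bg.
have c0 : continuous rho0.
  have H := @continuous_section R d (fun t => rho (Num.max t 0)) 0 (flow_cont_density F).
  by move: H; rewrite /= m00 -rho0E.
have sigma_gt0 : 0 < sigma by exact: sound_speed_gt0.
have momE (x : 'rV[R]_d) : rho0 x * dotp (u0 x) x =
    radial_momentum_density (fun t => rho (Num.max t 0)) (fun t => u (Num.max t 0)) 0 x.
  by rewrite /radial_momentum_density m00 rho0E u0E.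
set I := (\int[_]_x (rho0 x * _)%:E)%E in big.
have If : I = (\int[lebesgue_rV d]_x (rho0 x * dotp (u0 x) x))%:E.
  rewrite /Rintegral fineK//; apply: integrable_fin_num => //.
  have [cm sm] := slab_radial gamma1 rb0 F bg0 past (lexx 0).
  have z0 : -1 < (0 : R) < 0 + 1 by rewrite oppr_lt0 add0r ltr01.
  apply: eq_integrable (integrable_supp (continuous_section (t := 0) cm) (sm 0 z0)) => //.
  by move=> x _ /=; rewrite -momE.
have [M NM] : exists M : R, 'N[lebesgue_rV d]_+oo[EFin \o rho0]%E = M%:E.
  move: big; rewrite If; case: ('N[_]__[_])%E (Lnorm_ge0 (lebesgue_rV d) +oo%E (EFin \o rho0)) => [M| |] // _.
  - by exists M.
  - have k0 : 0 < d.+1%:R * sigma by apply: mulr_gt0 => //; rewrite ltr0n.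
    by rewrite gt0_muley ?lte_fin.
have rM := Lnormy_bound c0 NM.
have rM' (x : 'rV[R]_d) : rho (Num.max 0 0) x <= M by rewrite m00 -rho0E; exact: rM.
have ex0 : 0 <= \int[lebesgue_rV d]_x excess_density rhobar (fun t => rho (Num.max t 0)) 0 x.
  apply: fine_ge0; rewrite /excess_density m00 -rho0E; exact: excess0.
apply: (no_global_flow gamma1 rb0 F r0 bg0 past rM' ex0 d1).
have V0 := @ball_vol_gt0 R d.
have M0 : 0 < M by apply: lt_le_trans rb0 (background_le_bound gamma1 rb0 F r0 bg0 past rM' ex0).
move: big; rewrite NM If -!EFinM lee_fin omegaE.
have dR : 1 <= d%:R :> R by rewrite ler1n.
have rp : 0 < r ^+ d.+1 by exact: exprn_gt0.
have W0 : 0 < d%:R * @ball_vol R d * r ^+ d.+1.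
  by apply: mulr_gt0 => //; apply: mulr_gt0 => //; apply: lt_le_trans dR.
rewrite [leRHS]mulrC ler_pdivlMr// => big.
have -> : \int[lebesgue_rV d]_x radial_momentum_density (fun t => rho (Num.max t 0))
    (fun t => u (Num.max t 0)) 0 x = \int[lebesgue_rV d]_x (rho0 x * dotp (u0 x) x).
  by apply: eq_Rintegral => x _; rewrite momE.
apply: le_trans big.
change (d.+1%:R * sigma * (M * @ball_vol R d) * r ^+ d.+1 <=
  d.+1%:R * sigma * M * (d%:R * @ball_vol R d * r ^+ d.+1)).
rewrite [leLHS](_ : _ = d.+1%:R * sigma * M * (1 * @ball_vol R d * r ^+ d.+1)); last by ring.
apply: ler_wpM2l; first by apply: mulr_ge0; [apply: mulr_ge0 => //; exact: ltW|exact: ltW].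
by apply: ler_wpM2r; [exact: ltW|apply: ler_wpM2r => //; exact: ltW].
Qed.
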